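(* Let $\ell$ be a commutative unital ring with involution containing $\lambda$ with $\lambda+\lambda^*=1$, let $G$ be a group, $E$ a graph and $\omega:E^1\to G$ a weight. Consider the $G$-graded $*$-homomorphism $\varphi:\ell^{(E^0)}\to C_\omega(E)$, $\chi_v\mapsto v$. Let $H$ be a homotopy invariant, excisive, $E$-stable and $E^0$-additive homology theory from $G$-graded $*$-algebras to a triangulated category $\mathcal{T}$. Then $H(\varphi)$ is an isomorphism.
   Context: Graphs and algebras. $E$ has vertices $E^0$, edges $E^1$, source/range maps $s,r$. The Cohn algebra $C(E)$ is the $\ell$-algebra generated by $v\in E^0$, $e,e^*$ ($e\in E^1$) with relations $vw=\delta_{v,w}v$, $s(e)e=e=e\,r(e)$, $r(e)e^*=e^*=e^*s(e)$, $e^*f=\delta_{e,f}r(e)$; its involution is semilinear over that of $\ell$, fixes vertices and sends $e\mapsto e^*$. $C_\omega(E)$ is $C(E)$ with the $G$-grading $|v|=1$, $|e|=\omega(e)$, $|e^*|=\omega(e)^{-1}$. $\ell^{(E^0)}$ is the algebra of finitely supported functions on $E^0$, with pointwise operations and trivial grading; $\chi_v$ are characteristic functions. $\ell$-algebras are associative, not necessarily unital. A $G$-graded $*$-algebra is a $G$-graded $\ell$-algebra with additive involution with $(ab)^*=b^*a^*$, $(\mu a)^*=\mu^*a^*$, $A_g^*\subset A_{g^{-1}}$; morphisms are degree-preserving $*$-homomorphisms. A $G$-graded set is a set $X$ with a function $|\cdot|:X\to G$. $M_XA$ is the algebra of finitely supported $X\times X$-matrices with conjugate-transpose involution and grading $|\varepsilon_{x,y}\otimes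 a|=|x||a||y|^{-1}$. Homology theories. An excisive homology theory is a functor $H$ to a triangulated category with maps $\partial:\Omega H(C)\to H(A)$ ($\Omega$ the inverse suspension), for each exact sequence $0\to A\to B\to C\to0$ of $G$-graded $*$-algebras such that $B\to C$ has a degree-preserving $\ell$-linear section, compatible with morphisms of extensions, making $\Omega H(C)\to H(A)\to H(B)\to H(C)$ distinguished. $H$ is homotopy invariant if it inverts $A\to A[t]$ ($t^*=t$, $|t|=1$). $H$ is $E$-stable if it inverts the upper-left corner inclusions $A\to M_\pm A$, where $M_\pm A=M_2A$ with involution $x\mapsto hx^*h$, $h=\mathrm{diag}(1,-1)$ ($\iota_+$-stability), and inverts $M_XA\to M_{X\sqcup Y}A$ for all $G$-graded sets $X,Y$ of cardinality at most $\#(E^0\sqcup E^1\sqcup\mathbb{N}\sqcup G)$ ($G$-stability). $H$ is $I$-additive if direct sums of cardinality $\le\#I$ exist in the target and $\bigoplus_{j\in J}H(A_j)\to H(\bigoplus_{j\in J}A_j)$ is an isomorphism whenever $\#J\le\#I$. *)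

(* Defs.v *)
From HB Require Import structures.
From mathcomp Require Import all_boot all_algebra.
From mathcomp Require Import finmap.
From mathcomp Require Import boolp classical_sets functions cardinality fsbigop.

Set Implicit Arguments.
Unset Strict Implicit.
Unset Printing Implicit Defensive.

Import GRing.Theory.

Local Open Scope classical_set_scope.
Local Open Scope card_scope.
Local Open Scope ring_scope.

HB.mixin Record ComPzRing_isStar R of GRing.ComPzRing R := {
  conjr : R -> R;
  conjrD : {morph conjr : x y / x + y};
  conjrM : {morph conjr : x y / x * y};
  conjrK : involutive conjr
}.

#[short(type="comStarRingType")]
HB.structure Definition ComStarRing := {R of GRing.ComPzRing R & ComPzRing_isStar R}.

HB.mixin Record Lmodule_isNuAlgebra (R : comPzRingType) A of GRing.Lmodule R A := {
  nmul : A -> A -> A;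
  nmulA : associative nmul;
  nmulDl : left_distributive nmul +%R;
  nmulDr : right_distributive nmul +%R;
  nmulZl : forall (k : R) a b, nmul (k *: a) b = k *: nmul a b;
  nmulZr : forall (k : R) a b, nmul a (k *: b) = k *: nmul a b
}.

#[short(type="nuAlgType")]
HB.structure Definition NuAlgebra (R : comPzRingType) :=
  {A of GRing.Lmodule R A & Lmodule_isNuAlgebra R A}.

Notation "a ** b" := (nmul a b) (at level 40, left associativity) : ring_scope.

(* [gr g] is the homogeneous component of degree [g]; [gr_span] and [gr_free]
   say that the algebra is the direct sum of its components. *)
HB.mixin Record NuAlgebra_isGrStar (l : comStarRingType) (G : groupType) A
    of NuAlgebra l A := {
  star : A -> A;
  starK : involutive star;
  starD : {morph star : a b / a + b};
  starM : forall a b : A, star (a ** b) = star b ** star a;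
  starZ : forall (k : l) a, star (k *: a) = conjr k *: star a;
  gr : G -> set A;
  gr0 : forall g, gr g 0;
  grD : forall g a b, gr g a -> gr g b -> gr g (a + b);
  grZ : forall g (k : l) a, gr g a -> gr g (k *: a);
  gr_span : forall a, exists2 s : seq A,
    (forall x, x \in s -> exists g, gr g x) & a = \sum_(x <- s) x;
  gr_free : forall (s : seq G) (f : G -> A), uniq s -> (forall g, gr g (f g)) ->
    \sum_(g <- s) f g = 0 -> forall g, g \in s -> f g = 0;
  grM : forall g h a b, gr g a -> gr h b -> gr (g * h)%g (a ** b);
  gr_star : forall g a, gr g a -> gr g^-1%g (star a)
}.

#[short(type="grStarAlgType")]
HB.structure Definition GrStarAlg (l : comStarRingType) (G : groupType) :=
  {A of NuAlgebra l A & NuAlgebra_isGrStar l G A}.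

Record grhom (l : comStarRingType) (G : groupType) (A B : grStarAlgType l G) :=
  GrHom {
    grhom_fun :> A -> B;
    grhom_linear : linear grhom_fun;
    grhomM : {morph grhom_fun : a b / a ** b};
    grhom_star : {morph grhom_fun : a / star a};
    grhom_gr : forall g a, gr g a -> gr g (grhom_fun a)
  }.

Section GrHomTheory.
Variables (l : comStarRingType) (G : groupType).
Implicit Types A B C : grStarAlgType l G.

Lemma grhom_ext A B (f f' : grhom A B) : f =1 f' -> f = f'.
Proof.
case: f f' => f f1 f2 f3 f4 [f' f'1 f'2 f'3 f'4] /= /funext ff'.
case: f' / ff' in f'1 f'2 f'3 f'4 *.
by congr GrHom; exact: Prop_irrelevance.
Qed.

Definition grhom_id A : grhom A A :=
  @GrHom _ _ A A idfun (fun _ _ _ => erefl) (fun _ _ => erefl) (fun=> erefl)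
    (fun _ _ h => h).

Program Definition grhom_comp A B C (f : grhom B C) (f' : grhom A B) : grhom A C :=
  @GrHom _ _ A C (f \o f') _ _ _ _.
Next Obligation. by move=> k a b; rewrite /= !grhom_linear. Qed.
Next Obligation. by move=> a b; rewrite /= !grhomM. Qed.
Next Obligation. by move=> a; rewrite /= !grhom_star. Qed.
Next Obligation. by do 2 apply: grhom_gr. Qed.

End GrHomTheory.

Section NuTheory.
Variables (R : comPzRingType) (A : nuAlgType R).
Lemma nmul0l (a : A) : 0 ** a = 0.
Proof. by rewrite -(scale0r 0) nmulZl !scale0r. Qed.
Lemma nmul0r (a : A) : a ** 0 = 0.
Proof. by rewrite -(scale0r 0) nmulZr !scale0r. Qed.
Lemma nmulNl (a b : A) : (- a) ** b = - (a ** b).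
Proof. by rewrite -scaleN1r nmulZl scaleN1r. Qed.
Lemma nmulNr (a b : A) : a ** (- b) = - (a ** b).
Proof. by rewrite -scaleN1r nmulZr scaleN1r. Qed.
Lemma nmul_suml I (r : seq I) P (F : I -> A) b :
  (\sum_(i <- r | P i) F i) ** b = \sum_(i <- r | P i) (F i ** b).
Proof. by elim/big_rec2: _ => [|i x y _ <-]; rewrite ?nmul0l ?nmulDl. Qed.
Lemma nmul_sumr I (r : seq I) P (F : I -> A) b :
  b ** (\sum_(i <- r | P i) F i) = \sum_(i <- r | P i) (b ** F i).
Proof. by elim/big_rec2: _ => [|i x y _ <-]; rewrite ?nmul0r ?nmulDr. Qed.
End NuTheory.

Section StarTheory.
Variables (l : comStarRingType).
Lemma conjr0 : conjr (0 : l) = 0.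
Proof. by apply: (addIr (conjr 0)); rewrite -conjrD !add0r. Qed.
Lemma conjr1 : conjr (1 : l) = 1.
Proof. by have := conjrM (conjr (1 : l)) 1; rewrite mulr1 !conjrK mul1r => <-. Qed.
Lemma conjrN (x : l) : conjr (- x) = - conjr x.
Proof. by apply: (addrI (conjr x)); rewrite -conjrD !subrr conjr0. Qed.
Lemma conjr_sign n : conjr ((-1) ^+ n : l) = (-1) ^+ n.
Proof. by elim: n => [|n IH]; rewrite ?expr0 ?conjr1 // exprS conjrM conjrN conjr1 IH. Qed.

Variables (G : groupType) (A : grStarAlgType l G).
Lemma star0 : star (0 : A) = 0.
Proof. by rewrite -(scale0r 0) starZ conjr0 !scale0r. Qed.
Lemma star_sum I (r : seq I) P (F : I -> A) :
  star (\sum_(i <- r | P i) F i) = \sum_(i <- r | P i) star (F i).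
Proof. by elim/big_rec2: _ => [|i x y _ <-]; rewrite ?star0 ?starD. Qed.
Lemma gr_sum g I (r : seq I) (P : pred I) (F : I -> A) :
  (forall i, P i -> gr g (F i)) -> gr g (\sum_(i <- r | P i) F i).
Proof. by move=> h; elim/big_ind: _ => //; [exact: gr0|exact: grD]. Qed.
End StarTheory.

Section FinFam.
Variables (R : pzRingType) (I : choiceType) (M : I -> lmodType R).

Record finfam := FinFam {
  finfam_fun :> forall i, M i;
  finfam_fin : finite_set [set i | finfam_fun i != 0]
}.

HB.instance Definition _ := gen_eqMixin finfam.
HB.instance Definition _ := gen_choiceMixin finfam.

Lemma finfamP (f h : finfam) : (forall i, f i = h i) -> f = h.
Proof.
case: f h => f ff [h fh] /= fhE.
have {}fhE : f = h by apply: functional_extensionality_dep.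
by case: h / fhE in fh *; congr FinFam; exact: Prop_irrelevance.
Qed.

Program Definition ff0 := @FinFam (fun i => 0) _.
Next Obligation. by apply: (sub_finite_set _ (finite_set0 I)) => i /=; rewrite eqxx. Qed.
Program Definition ffD (f h : finfam) := @FinFam (fun i => f i + h i) _.
Next Obligation.
have fin : finite_set ([set i | f i != 0] `|` [set i | h i != 0]).
  by rewrite finite_setU; split; exact: finfam_fin.
apply: (sub_finite_set _ fin) => i /=.
case: (eqVneq (f i) 0) => [->|]; last by left.
by rewrite add0r; right.
Qed.
Program Definition ffN (f : finfam) := @FinFam (fun i => - f i) _.
Next Obligation.
by apply: (sub_finite_set _ (finfam_fin f)) => i /=; rewrite oppr_eq0.
Qed.
Program Definition ffZ (k : R) (f : finfam) := @FinFam (fun i => k *: f i) _.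
Next Obligation.
apply: (sub_finite_set _ (finfam_fin f)) => i /=.
by apply: contraNneq => ->; rewrite scaler0.
Qed.

Lemma ffDA : associative ffD.
Proof. by move=> ???; apply: finfamP => i /=; rewrite addrA. Qed.
Lemma ffDC : commutative ffD.
Proof. by move=> ??; apply: finfamP => i /=; rewrite addrC. Qed.
Lemma ff0D : left_id ff0 ffD.
Proof. by move=> ?; apply: finfamP => i /=; rewrite add0r. Qed.
Lemma ffND : left_inverse ff0 ffN ffD.
Proof. by move=> ?; apply: finfamP => i /=; rewrite addNr. Qed.
HB.instance Definition _ := GRing.isZmodule.Build finfam ffDA ffDC ff0D ffND.

Lemma ffZA a b v : ffZ a (ffZ b v) = ffZ (a * b) v.
Proof. by apply: finfamP => i /=; rewrite scalerA. Qed.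
Lemma ff1Z : left_id 1 ffZ.
Proof. by move=> ?; apply: finfamP => i /=; rewrite scale1r. Qed.
Lemma ffZDr : right_distributive ffZ +%R.
Proof. by move=> ???; apply: finfamP => i /=; rewrite scalerDr. Qed.
Lemma ffZDl v : {morph ffZ^~ v : a b / a + b}.
Proof. by move=> ??; apply: finfamP => i /=; rewrite scalerDl. Qed.
HB.instance Definition _ :=
  GRing.Zmodule_isLmodule.Build R finfam ffZA ff1Z ffZDr ffZDl.

Lemma ff_sumE J (r : seq J) (P : pred J) (F : J -> finfam) i :
  (\sum_(j <- r | P j) F j) i = \sum_(j <- r | P j) F j i.
Proof. by elim/big_rec2: _ => // j x y _ <-. Qed.

(* The family with value [a] at [i] and [0] elsewhere. *)
Definition single_fun (i : I) (a : M i) (j : I) : M j :=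
  match pselect (i = j) with
  | left e => eq_rect i (fun k => M k : Type) a j e
  | right _ => 0
  end.

Lemma single_fun_eq i a : @single_fun i a i = a.
Proof. by rewrite /single_fun; case: pselect => // e; rewrite (Prop_irrelevance e erefl). Qed.
Lemma single_fun_ne i a j : i != j -> @single_fun i a j = 0.
Proof. by move=> /eqP; rewrite /single_fun; case: pselect. Qed.

Program Definition single (i : I) (a : M i) : finfam := @FinFam (single_fun a) _.
Next Obligation.
apply: (sub_finite_set _ (finite_set1 i)) => j /=.
by apply: contra_neqP => /eqP ij; rewrite single_fun_ne // eq_sym.
Qed.

Lemma singleE i a : single a i = a :> M i. Proof. exact: single_fun_eq. Qed.
Lemma single_ne i (a : M i) j : i != j -> single a j = 0.
Proof. exact: single_fun_ne. Qed.

Lemma single0 i : single (0 : M i) = 0.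
Proof.
apply: finfamP => j; case: (eqVneq i j) => [<-|ij]; first by rewrite singleE.
by rewrite single_ne.
Qed.
Lemma single_linear i : linear (@single i).
Proof.
move=> k a b; apply: finfamP => j /=; case: (eqVneq i j) => [<-|ij].
  by rewrite !single_fun_eq.
by rewrite !single_fun_ne // scaler0 addr0.
Qed.
Lemma singleD i : {morph @single i : a b / a + b}.
Proof. by move=> a b; have := single_linear 1 a b; rewrite !scale1r. Qed.
Lemma singleZ i k a : @single i (k *: a) = k *: single a.
Proof. by have := single_linear k a 0; rewrite !addr0 single0 addr0. Qed.

Definition supp (f : finfam) : {fset I} := fset_set [set i | f i != 0].
Lemma suppP f i : (i \in supp f) = (f i != 0).
Proof. by rewrite in_fset_set; [apply/idP/idP; rewrite inE|exact: finfam_fin]. Qed.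

Lemma finfam_sum f : f = \sum_(i <- supp f) single (f i).
Proof.
apply: finfamP => j; rewrite ff_sumE.
case: (boolP (j \in supp f)) => [jf|jf].
  rewrite (big_fsetD1 j) //= single_fun_eq big_seq big1 ?addr0 // => i.
  by rewrite !inE => /andP[ij _]; rewrite single_fun_ne.
rewrite big_seq big1; first by apply/eqP; move: jf; rewrite suppP negbK.
by move=> i isf; rewrite single_ne //; apply: contraNneq jf => <-.
Qed.

Lemma finfam_ind (P : finfam -> Prop) :
  P 0 -> (forall f h, P f -> P h -> P (f + h)) -> (forall i (a : M i), P (single a)) ->
  forall f, P f.
Proof. by move=> P0 PD P1 f; rewrite (finfam_sum f); elim/big_ind: _. Qed.
End FinFam.

Section GrSumTheory.
Variables (G : groupType).
Implicit Types V W : zmodType.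

(* Sums of homogeneous elements, for the components [gr] of a candidate grading. *)
Definition hsum V (gr : G -> set V) (a : V) :=
  exists2 s : seq V, (forall x, x \in s -> exists g, gr g x) & a = \sum_(x <- s) x.

Lemma hsum0 V gr : @hsum V gr 0.
Proof. by exists [::]; rewrite ?big_nil. Qed.
Lemma hsumD V gr a b : @hsum V gr a -> hsum gr b -> hsum gr (a + b).
Proof.
move=> [s sP ->] [t tP ->]; exists (s ++ t); last by rewrite big_cat.
by move=> x; rewrite mem_cat => /orP[/sP|/tP].
Qed.
Lemma hsum_hom V gr g a : gr g a -> @hsum V gr a.
Proof.
by move=> ga; exists [:: a]; [move=> x; rewrite inE => /eqP->; exists g|rewrite big_seq1].
Qed.
Lemma hsum_morph V W gr gr' (f : V -> W) : f 0 = 0 -> {morph f : a b / a + b} ->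
  (forall g a, gr g a -> exists h, gr' h (f a)) ->
  forall a, @hsum V gr a -> @hsum W gr' (f a).
Proof.
move=> f0 fD fgr _ [s sP ->]; elim: s sP => [|x s IH] sP.
  by rewrite big_nil f0; exact: hsum0.
rewrite big_cons fD; apply: hsumD; last by apply: IH => y ys; apply: sP; rewrite inE ys orbT.
have [|g gx] := sP x; first by rewrite inE eqxx.
by have [h] := fgr _ _ gx; exact: hsum_hom.
Qed.
End GrSumTheory.

(* A semigroup with zero, the zero being represented by [None]. *)
Record szSemi := SzSemi {
  sz_sort :> choiceType;
  sz_op : sz_sort -> sz_sort -> option sz_sort;
  sz_opA : forall a b c, obind (sz_op^~ c) (sz_op a b) = obind (sz_op a) (sz_op b c)
}.

Definition sgalg (R : comPzRingType) (S : szSemi) (A : nuAlgType R) : Type :=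
  finfam (fun _ : S => A : lmodType R).

Section SgAlg.
Variables (R : comPzRingType) (S : szSemi) (A : nuAlgType R).
Local Notation T := (sgalg S A).

HB.instance Definition _ := GRing.Lmodule.copy T (finfam (fun _ : S => A : lmodType R)).

Definition eps (s : S) (a : A) : T := single (M := fun _ : S => A : lmodType R) (i := s) a.

Definition osingle (s : option S) (a : A) : T := if s is Some c then eps c a else 0.

(* [(a e_s) (b e_t) = (a b) e_(s t)], extended bilinearly. *)
Definition sgmul (f h : T) : T :=
  \sum_(p \in [set: S * S]) osingle (sz_op p.1 p.2) (f p.1 ** h p.2).

Lemma epsD s : {morph eps s : a b / a + b}. Proof. exact: singleD. Qed.
Lemma epsZ s k a : eps s (k *: a) = k *: eps s a. Proof. exact: singleZ. Qed.
Lemma eps0 s : eps s 0 = 0. Proof. exact: single0. Qed.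

Lemma osingle0 s : osingle s 0 = 0. Proof. by case: s => //= s; exact: eps0. Qed.
Lemma osingleD s : {morph osingle s : a b / a + b}.
Proof. by case: s => [s|] a b /=; [rewrite epsD|rewrite addr0]. Qed.
Lemma osingleZ s k a : osingle s (k *: a) = k *: osingle s a.
Proof. by case: s => [s|] /=; [rewrite epsZ|rewrite scaler0]. Qed.

Lemma sgmulE (F H : {fset S}) (f h : T) : 
  (forall i, i \notin F -> f i = 0) -> (forall i, i \notin H -> h i = 0) ->
  sgmul f h =
  \sum_(p <- (F `*` H)%fset) osingle (sz_op p.1 p.2) (f p.1 ** h p.2).
Proof.
move=> fF hH; rewrite /sgmul; apply: fsbigTE => -[a b].
rewrite in_fsetM /= negb_and => /orP[/fF->|/hH->]; first by rewrite nmul0l osingle0.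
by rewrite nmul0r osingle0.
Qed.

Lemma sgmul_eps s t a b : sgmul (eps s a) (eps t b) = osingle (sz_op s t) (a ** b).
Proof.
rewrite (@sgmulE [fset s]%fset [fset t]%fset).
- rewrite (big_fsetD1 (s, t)) /=; last by rewrite in_fsetM /= !inE !eqxx.
  rewrite !single_fun_eq big_seq big1 ?addr0 // => -[x y].
  rewrite in_fsetD1 in_fsetM /= !inE => /andP[/eqP xy /andP[/eqP xs /eqP yt]].
  by case: xy; rewrite xs yt.
- by move=> i; rewrite inE eq_sym => si; rewrite /eps single_ne.
- by move=> i; rewrite inE eq_sym => si; rewrite /eps single_ne.
Qed.

Lemma notin_supp (f : T) (F : {fset S}) i :
  i \notin (supp f `|` F)%fset -> f i = 0.
Proof. by rewrite inE negb_or suppP negbK => /andP[/eqP]. Qed.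

Lemma sgmulDl : left_distributive sgmul +%R.
Proof.
move=> f f' h; set F := (supp f `|` supp f')%fset.
have fF i : i \notin F -> f i = 0 by apply: notin_supp.
have f'F i : i \notin F -> f' i = 0 by rewrite /F fsetUC; apply: notin_supp.
have hH i : i \notin supp h -> h i = 0 by rewrite suppP negbK => /eqP.
rewrite !(@sgmulE F (supp h)) //.
  by rewrite -big_split; apply: eq_bigr => p _; rewrite nmulDl osingleD.
by move=> i iF /=; rewrite fF // f'F // addr0.
Qed.
Lemma sgmulDr : right_distributive sgmul +%R.
Proof.
move=> h f f'; set F := (supp f `|` supp f')%fset.
have fF i : i \notin F -> f i = 0 by apply: notin_supp.
have f'F i : i \notin F -> f' i = 0 by rewrite /F fsetUC; apply: notin_supp.
have hH i : i \notin supp h -> h i = 0 by rewrite suppP negbK => /eqP.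
rewrite !(@sgmulE (supp h) F) //.
  by rewrite -big_split; apply: eq_bigr => p _; rewrite nmulDr osingleD.
by move=> i iF /=; rewrite fF // f'F // addr0.
Qed.
Lemma sgmulZl (k : R) (f h : T) : sgmul (k *: f) h = k *: sgmul f h.
Proof.
have fF i : i \notin supp f -> f i = 0 by rewrite suppP negbK => /eqP.
have hH i : i \notin supp h -> h i = 0 by rewrite suppP negbK => /eqP.
rewrite !(@sgmulE (supp f) (supp h)) //.
  by rewrite scaler_sumr; apply: eq_bigr => p _; rewrite nmulZl osingleZ.
by move=> i iF /=; rewrite fF // scaler0.
Qed.
Lemma sgmulZr (k : R) (f h : T) : sgmul f (k *: h) = k *: sgmul f h.
Proof.
have fF i : i \notin supp f -> f i = 0 by rewrite suppP negbK => /eqP.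
have hH i : i \notin supp h -> h i = 0 by rewrite suppP negbK => /eqP.
rewrite !(@sgmulE (supp f) (supp h)) //.
  by rewrite scaler_sumr; apply: eq_bigr => p _; rewrite nmulZr osingleZ.
by move=> i iF /=; rewrite hH // scaler0.
Qed.

Lemma sgmul0l h : sgmul 0 h = 0.
Proof. by rewrite -(scale0r 0) sgmulZl !scale0r. Qed.
Lemma sgmul0r h : sgmul h 0 = 0.
Proof. by rewrite -(scale0r 0) sgmulZr !scale0r. Qed.

Lemma sgalg_ind (P : T -> Prop) :
  P 0 -> (forall f h, P f -> P h -> P (f + h)) -> (forall s a, P (eps s a)) ->
  forall f, P f.
Proof. exact: finfam_ind. Qed.

Lemma sgmulA : associative sgmul.
Proof.
move=> f g h; elim/sgalg_ind: f => [|f f' IH IH'|s a]; rewrite ?sgmul0l //.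
  by rewrite !sgmulDl IH IH'.
elim/sgalg_ind: g => [|f f' IH IH'|t b]; rewrite ?(sgmul0l, sgmul0r) //.
  by rewrite !(sgmulDl, sgmulDr) IH IH'.
elim/sgalg_ind: h => [|f f' IH IH'|u c]; rewrite ?(sgmul0l, sgmul0r) //.
  by rewrite !(sgmulDl, sgmulDr) IH IH'.
rewrite !sgmul_eps.
have -> : sgmul (eps s a) (osingle (sz_op t u) (b ** c)) =
    osingle (obind (sz_op s) (sz_op t u)) (a ** (b ** c)).
  by case: (sz_op t u) => [w|] /=; rewrite ?sgmul0r ?sgmul_eps.
have -> : sgmul (osingle (sz_op s t) (a ** b)) (eps u c) =
    osingle (obind (fun w => sz_op w u) (sz_op s t)) (a ** b ** c).
  by case: (sz_op s t) => [w|] /=; rewrite ?sgmul0l ?sgmul_eps.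
by rewrite sz_opA nmulA.
Qed.

HB.instance Definition _ :=
  Lmodule_isNuAlgebra.Build R T sgmulA sgmulDl sgmulDr sgmulZl sgmulZr.

Lemma eps_mul s t a b : eps s a ** eps t b = osingle (sz_op s t) (a ** b).
Proof. exact: sgmul_eps. Qed.
End SgAlg.

(* A semigroup with zero [S] with an involution and with source and target
   degrees [gs_l], [gs_r]; for an algebra [A], the element [eps s a] of the
   semigroup algebra gets the degree [|s| = gs_l s * |a| * (gs_r s)^-1]. *)
Record grSemi (G : groupType) := GrSemi {
  gs_sz :> szSemi;
  gs_star : gs_sz -> gs_sz;
  gs_l : gs_sz -> G;
  gs_r : gs_sz -> G;
  gs_starK : involutive gs_star;
  gs_starM : forall a b,
    sz_op (gs_star b) (gs_star a) = omap gs_star (sz_op a b);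
  gs_l_star : forall a, gs_l (gs_star a) = gs_r a;
  gs_opP : forall a b c, sz_op a b = Some c ->
    [/\ gs_l c = gs_l a, gs_r a = gs_l b & gs_r c = gs_r b]
}.

Definition gsgalg (l : comStarRingType) (G : groupType) (S : grSemi G)
  (A : grStarAlgType l G) : Type := sgalg S A.

Section GSgAlg.
Variables (l : comStarRingType) (G : groupType) (S : grSemi G).
Variable (A : grStarAlgType l G).
Local Notation T := (gsgalg S A).
HB.instance Definition _ := NuAlgebra.copy T (sgalg S A).

Program Definition gsstar (f : T) : T :=
  @FinFam _ _ (fun _ : S => A : lmodType l) (fun s => star (f (gs_star s))) _.
Next Obligation.
apply: (sub_finite_set _ (finite_image (@gs_star _ S) (finfam_fin f))) => s /= fs.
exists (gs_star s); last by rewrite gs_starK.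
by apply: contraNneq fs => ->; rewrite star0.
Qed.

Definition gsgr (g : G) : set T :=
  [set f | forall s, gr ((gs_l s)^-1 * g * gs_r s)%g (f s)].

Lemma gs_r_star (s : S) : gs_r (gs_star s) = gs_l s.
Proof. by rewrite -gs_l_star gs_starK. Qed.

Lemma gsstarK : involutive gsstar.
Proof. by move=> f; apply: finfamP => s /=; rewrite gs_starK starK. Qed.
Lemma gsstarD : {morph gsstar : a b / a + b}.
Proof. by move=> f h; apply: finfamP => s /=; rewrite starD. Qed.
Lemma gsstarZ (k : l) a : gsstar (k *: a) = conjr k *: gsstar a.
Proof. by apply: finfamP => s /=; rewrite starZ. Qed.
Lemma gsstar0 : gsstar 0 = 0.
Proof. by apply: finfamP => s /=; rewrite star0. Qed.

Lemma gsstar_eps s (a : A) : gsstar (eps s a) = eps (gs_star s) (star a).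
Proof.
apply: finfamP => t; rewrite [LHS]/=.
case: (eqVneq (gs_star s) t) => [<-|st]; first by rewrite gs_starK single_fun_eq /eps singleE.
rewrite /eps single_ne // single_fun_ne ?star0 //.
by apply: contraNneq st => ->; rewrite gs_starK eqxx.
Qed.

Lemma gsstarM (f h : T) : gsstar (f ** h) = gsstar h ** gsstar f.
Proof.
elim/sgalg_ind: f => [|f f' IH IH'|s a]; rewrite ?(nmul0l, nmul0r, gsstar0) //.
  by rewrite !(nmulDl, gsstarD, nmulDr) IH IH'.
elim/sgalg_ind: h => [|h h' IH IH'|t b]; rewrite ?(nmul0l, nmul0r, gsstar0) //.
  by rewrite !(nmulDr, gsstarD, nmulDl) IH IH'.
rewrite eps_mul !gsstar_eps eps_mul gs_starM -starM.
by case: (sz_op s t) => [c|] /=; rewrite ?gsstar_eps ?gsstar0.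
Qed.

Lemma gsgr0 g : gsgr g 0. Proof. by move=> s; exact: gr0. Qed.
Lemma gsgrD g f h : gsgr g f -> gsgr g h -> gsgr g (f + h).
Proof. by move=> gf gh s; apply: grD. Qed.
Lemma gsgrZ g (k : l) f : gsgr g f -> gsgr g (k *: f).
Proof. by move=> gf s; apply: grZ. Qed.

Lemma gsgr_eps g s (a : A) :
  gr g a -> gsgr (gs_l s * g * (gs_r s)^-1)%g (eps s a : T).
Proof.
move=> ga t; case: (eqVneq s t) => [<-|st]; last by rewrite /eps single_ne //; exact: gr0.
by rewrite /eps singleE !mulgA mulVg mul1g mulgVK.
Qed.

Lemma gsgr_span (f : T) : hsum gsgr f.
Proof.
elim/sgalg_ind: f => [|f h|s a]; [exact: hsum0|exact: hsumD|].
apply: (@hsum_morph _ _ _ (@gr l G A)); [exact: eps0|exact: epsD| |exact: gr_span].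
by move=> g b gb; eexists; exact: gsgr_eps gb.
Qed.

Lemma gsgr_free (r : seq G) (f : G -> T) : uniq r -> (forall g, gsgr g (f g)) ->
  \sum_(g <- r) f g = 0 -> forall g, g \in r -> f g = 0.
Proof.
move=> ur gf sf g gr_; apply: finfamP => s.
have inj : injective (fun g : G => (gs_l s)^-1 * g * gs_r s)%g.
  by move=> x y /mulIg /mulgI.
pose F k := f (gs_l s * k * (gs_r s)^-1)%g s.
have FE x : F ((gs_l s)^-1 * x * gs_r s)%g = f x s.
  by rewrite /F !mulgA mulgV mul1g mulgK.
have := @gr_free l G A [seq ((gs_l s)^-1 * x * gs_r s)%g | x <- r] F.
rewrite map_inj_uniq // big_map => /(_ ur) H.
rewrite -FE; apply: H; last by apply/mapP; exists g.
  move=> k; have := gf (gs_l s * k * (gs_r s)^-1)%g s.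
  by rewrite !mulgA mulVg mul1g mulgVK.
under eq_bigr do rewrite FE.
by have := congr1 (fun h : T => h s) sf; rewrite ff_sumE.
Qed.

Lemma gsgrM g h (f k : T) : gsgr g f -> gsgr h k -> gsgr (g * h)%g (f ** k).
Proof.
move=> gf gk s; change (f ** k) with (sgmul f k).
rewrite (@sgmulE _ _ _ (supp f) (supp k)); try by move=> i; rewrite suppP negbK => /eqP.
rewrite ff_sumE; apply: gr_sum => -[a b] _ /=.
case E: (sz_op a b) => [c|] /=; last exact: gr0.
case: (eqVneq c s) => [<-|cs]; last by rewrite single_fun_ne //; exact: gr0.
rewrite single_fun_eq; have [-> lr ->] := gs_opP E.
suff -> : ((gs_l a)^-1 * (g * h) * gs_r b =
   ((gs_l a)^-1 * g * gs_r a) * ((gs_l b)^-1 * h * gs_r b))%g by apply: grM.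
by rewrite lr !mulgA mulgK.
Qed.

Lemma gsgr_star g f : gsgr g f -> gsgr g^-1%g (gsstar f).
Proof.
move=> gf s /=; have := gr_star _ _ (gf (gs_star s)).
by rewrite gs_l_star gs_r_star !invgM invgK mulgA.
Qed.

HB.instance Definition _ := NuAlgebra_isGrStar.Build l G T
  gsstarK gsstarD gsstarM gsstarZ gsgr0 gsgrD gsgrZ gsgr_span gsgr_free gsgrM gsgr_star.

End GSgAlg.

#[local] Obligation Tactic := idtac.

Program Definition nat_sz : szSemi := @SzSemi nat (fun m n => Some (m + n)%N) _.
Next Obligation. by move=> a b c; rewrite /= addnA. Qed.

Program Definition nat_semi (G : groupType) : grSemi G :=
  @GrSemi G nat_sz id (fun=> 1%g) (fun=> 1%g) _ _ _ _.
Next Obligation. by []. Qed.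
Next Obligation. by move=> G a b; rewrite /= addnC. Qed.
Next Obligation. by []. Qed.
Next Obligation. by []. Qed.

(* [A[t]]: [eps n a] is the monomial a t^n. *)
Definition polyalg (l : comStarRingType) (G : groupType) (A : grStarAlgType l G) :
  grStarAlgType l G := gsgalg (nat_semi G) A.

Program Definition poly_const (l : comStarRingType) (G : groupType)
    (A : grStarAlgType l G) : grhom A (polyalg A) :=
  @GrHom l G A (polyalg A) (fun a => eps (S := nat_sz) 0%N a) _ _ _ _.
Next Obligation. by move=> l G A k a b; rewrite epsD epsZ. Qed.
Next Obligation. by move=> l G A a b; rewrite eps_mul. Qed.
Next Obligation. by move=> l G A a; exact/esym/(gsstar_eps (S := nat_semi G)). Qed.
Next Obligation.
move=> l G A g a ga.
have := gsgr_eps (S := nat_semi G) (0%N : nat_semi G) ga.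
by rewrite /= mul1g invg1 mulg1.
Qed.

Record gset (G : groupType) := GSet {
  gset_sort :> choiceType;
  gdeg : gset_sort -> G
}.

Definition gsetU (G : groupType) (X Y : gset G) : gset G :=
  GSet (fun z : X + Y => match z with inl x => gdeg x | inr y => gdeg y end).

(* The pair [(x, y)] is the matrix unit with entry 1 in row [x] and column [y]. *)
Program Definition mxunit_sz (X : choiceType) : szSemi :=
  @SzSemi (X * X)%type (fun p q => if p.2 == q.1 then Some (p.1, q.2) else None) _.
Next Obligation.
move=> X [a b] [c d] [e f] /=.
by case E: (b == c); case F: (d == e); rewrite //= ?E ?F.
Qed.

Program Definition mxunit (G : groupType) (X : gset G) : grSemi G :=
  @GrSemi G (mxunit_sz X) (fun p => (p.2, p.1)) (fun p => gdeg p.1)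
    (fun p => gdeg p.2) _ _ _ _.
Next Obligation. by move=> G X [a b]. Qed.
Next Obligation.
by move=> G X [a b] [c d] /=; rewrite eq_sym; case: eqP.
Qed.
Next Obligation. by []. Qed.
Next Obligation.
by move=> G X [a b] [c d] [e f] /=; case: eqP => // <- [-> ->].
Qed.

Definition matx (l : comStarRingType) (G : groupType) (X : gset G)
  (A : grStarAlgType l G) : grStarAlgType l G := gsgalg (mxunit X) A.

Lemma matx_mulE (l : comStarRingType) (G : groupType) (X : gset G)
    (A : grStarAlgType l G) (f h : matx X A) (x z : X) :
  (f ** h) (x, z) = \sum_(y \in [set: X]) f (x, y) ** h (y, z).
Proof.
pose S := [fset p.2 | p in supp f]%fset.
have RHS_E (k : matx X A) : \sum_(y \in [set: X]) f (x, y) ** k (y, z) =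
    \sum_(y <- S) f (x, y) ** k (y, z).
  apply: fsbigTE => y yS; suff -> : f (x, y) = 0 by rewrite nmul0l.
  apply: contraNeq yS => fxy; apply/imfsetP; exists (x, y) => //=.
  by rewrite suppP.
rewrite RHS_E; elim/sgalg_ind: h => [|h h' IH IH'|[s t] b].
- by rewrite nmul0r big1 // => y _ /=; rewrite nmul0r.
- rewrite nmulDr /= IH IH' -big_split; apply: eq_bigr => y _ /=.
  by rewrite nmulDr.
rewrite -RHS_E (fsbigTE [fset s]%fset); last first.
  move=> y; rewrite inE eq_sym => sy.
  rewrite [X in _ ** X]single_ne ?nmul0r //.
  by apply: contraNneq sy => -[->].
rewrite (big_fsetD1 s) ?inE //= big_seq big1 ?addr0; last first.
  by move=> y; rewrite !inE andNb.
elim/sgalg_ind: {S RHS_E} f => [|f f' IH IH'|[u v] a].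
- by rewrite !nmul0l.
- by rewrite !nmulDl /= IH IH'.
rewrite eps_mul /=; case: (eqVneq v s) => [->|vs] /=; last first.
  rewrite (@single_fun_ne _ _ _ (u, v)) ?nmul0l //.
  by apply: contraNneq vs => -[_ ->].
case: (eqVneq u x) => [->|ux]; last first.
  rewrite [LHS]single_fun_ne; last by apply: contraNneq ux => -[->].
  rewrite (@single_fun_ne _ _ _ (u, s)) ?nmul0l //.
  by apply: contraNneq ux => -[->].
case: (eqVneq t z) => [->|tz]; first by rewrite !single_fun_eq.
rewrite [LHS]single_fun_ne; last by apply: contraNneq tz => -[->].
rewrite (@single_fun_ne _ _ _ (s, t)) ?nmul0r //.
by apply: contraNneq tz => -[->].
Qed.

Section MatIncl.
Variables (l : comStarRingType) (G : groupType) (X Y : gset G).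
Variable (A : grStarAlgType l G).

Definition matx_incl_fun (f : matx X A) (p : mxunit (gsetU X Y)) : A :=
  match p with
  | (inl x, inl y) => f (x, y)
  | _ => 0
  end.

Program Definition matx_incl_raw (f : matx X A) : matx (gsetU X Y) A :=
  @FinFam _ _ (fun _ : mxunit (gsetU X Y) => A : lmodType l) (matx_incl_fun f) _.
Next Obligation.
move=> f; apply: (sub_finite_set _
  (finite_image (fun p => (inl p.1, inl p.2)) (finfam_fin f))) => -[[x|x] [y|y]] //=;
  rewrite ?eqxx // => fxy.
by exists (x, y).
Qed.

Lemma matx_incl_linear : linear matx_incl_raw.
Proof.
by move=> k a b; apply: finfamP => -[[x|x] [y|y]] //=; rewrite scaler0 addr0.
Qed.
Lemma matx_incl_eps x y (a : A) :
  matx_incl_raw (eps (S := mxunit X) (x, y) a) =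
  eps (S := mxunit (gsetU X Y)) (inl x, inl y) a.
Proof.
apply: finfamP => -[[z|z] [w|w]]; try by rewrite /eps single_ne //; apply/eqP.
case: (eqVneq (x, y) (z, w)) => [[-> ->]|ne].
  by rewrite [LHS]single_fun_eq /eps singleE.
by rewrite [LHS]single_fun_ne // /eps single_ne.
Qed.
Lemma matx_inclM : {morph matx_incl_raw : a b / a ** b}.
Proof.
have D a b : matx_incl_raw (a + b) = matx_incl_raw a + matx_incl_raw b.
  by have := matx_incl_linear 1 a b; rewrite !scale1r.
have O : matx_incl_raw 0 = 0.
  by apply: finfamP => -[[x|x] [y|y]].
move=> f h; elim/sgalg_ind: f => [|f f' IH IH'|[s s'] a]; rewrite ?(O, nmul0l) //.
  by rewrite !(nmulDl, D) IH IH'.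
elim/sgalg_ind: h => [|h h' IH IH'|[t t'] b]; rewrite ?(O, nmul0r) //.
  by rewrite !(nmulDr, D) IH IH'.
rewrite eps_mul !matx_incl_eps eps_mul /=.
rewrite (_ : (inl s' == inl t) = (s' == t)) //.
by case: eqP => _ /=; rewrite ?matx_incl_eps.
Qed.

Program Definition matx_incl : grhom (matx X A) (matx (gsetU X Y) A) :=
  @GrHom _ _ (matx X A) (matx (gsetU X Y) A) matx_incl_raw matx_incl_linear matx_inclM _ _.
Next Obligation.
by move=> f; apply: finfamP => -[[x|x] [y|y]] //=; rewrite star0.
Qed.
Next Obligation.
by move=> g f gf [[x|x] [y|y]] /=; try exact: gr0; exact: (gf (x, y)).
Qed.
End MatIncl.

Definition two (G : groupType) : gset G := GSet (fun _ : 'I_2 => 1%g).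

Section MatPm.
Variables (l : comStarRingType) (G : groupType) (A : grStarAlgType l G).
Local Notation M2 := (matx (two G) A).

(* Conjugation x |-> h x h by h = diag(1, -1), whose i-th entry is (-1)^i. *)
Program Definition conj_h (f : M2) : M2 :=
  @FinFam _ _ (fun _ : mxunit (two G) => A : lmodType l)
    (fun p => (-1) ^+ (p.1 + p.2) *: f p) _.
Next Obligation.
move=> f; apply: (sub_finite_set _ (finfam_fin f)) => p /=.
by apply: contraNneq => ->; rewrite scaler0.
Qed.

Lemma conj_hK : involutive conj_h.
Proof.
by move=> f; apply: finfamP => p /=; rewrite scalerA -expr2 sqrr_sign scale1r.
Qed.
Lemma conj_h_linear : linear conj_h.
Proof.
move=> k f h; apply: finfamP => p /=.
by rewrite scalerDr !scalerA mulrC.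
Qed.
Lemma conj_hD : {morph conj_h : a b / a + b}.
Proof. by move=> a b; have := conj_h_linear 1 a b; rewrite !scale1r. Qed.
Lemma conj_h0 : conj_h 0 = 0.
Proof. by apply: finfamP => p /=; rewrite scaler0. Qed.
Lemma conj_hZ k f : conj_h (k *: f) = k *: conj_h f.
Proof. by have := conj_h_linear k f 0; rewrite !addr0 conj_h0 addr0. Qed.
Lemma conj_h_eps i j (a : A) :
  conj_h (eps (S := mxunit (two G)) (i, j) a) =
  eps (S := mxunit (two G)) (i, j) ((-1) ^+ (i + j) *: a).
Proof.
apply: finfamP => p; case: (eqVneq (i, j) p) => [<-|ne].
  by rewrite /= /eps !single_fun_eq.
by rewrite /= /eps !single_fun_ne // scaler0.
Qed.
Lemma conj_hM : {morph conj_h : a b / a ** b}.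
Proof.
move=> f h; elim/sgalg_ind: f => [|f f' IH IH'|[s s'] a]; rewrite ?(conj_h0, nmul0l) //.
  by rewrite !(nmulDl, conj_hD) IH IH'.
elim/sgalg_ind: h => [|h h' IH IH'|[t t'] b]; rewrite ?(conj_h0, nmul0r) //.
  by rewrite !(nmulDr, conj_hD) IH IH'.
rewrite eps_mul !conj_h_eps eps_mul /=.
case: eqP => [->|_] /=; last by rewrite conj_h0.
rewrite conj_h_eps nmulZl nmulZr scalerA -exprD; congr (eps _ (_ *: _)).
rewrite -[LHS]signr_odd -[RHS]signr_odd !oddD.
by case: (odd s); case: (odd t); case: (odd t').
Qed.
Lemma conj_h_star f : conj_h (star f) = star (conj_h f).
Proof.
by apply: finfamP => p /=; rewrite starZ conjr_sign addnC.
Qed.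
Lemma conj_h_gr g (f : M2) : gr g f -> gr g (conj_h f).
Proof. by move=> gf p; apply: grZ; exact: gf. Qed.

Definition matpm_sort : Type := M2.
HB.instance Definition _ := NuAlgebra.copy matpm_sort M2.

Definition pmstar (f : matpm_sort) : matpm_sort := conj_h (star (f : M2)).

Lemma pmstarK : involutive pmstar.
Proof. by move=> f; rewrite /pmstar -conj_h_star conj_hK starK. Qed.
Lemma pmstarD : {morph pmstar : a b / a + b}.
Proof. by move=> f h; rewrite /pmstar starD conj_hD. Qed.
Lemma pmstarM (f h : matpm_sort) : pmstar (f ** h) = pmstar h ** pmstar f.
Proof. by rewrite /pmstar (starM (f : M2)) conj_hM. Qed.
Lemma pmstarZ (k : l) (f : matpm_sort) : pmstar (k *: f) = conjr k *: pmstar f.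
Proof. by rewrite /pmstar (starZ k (f : M2)) conj_hZ. Qed.
Lemma pmgr_star g (f : matpm_sort) : gr g (f : M2) -> gr g^-1%g (pmstar f : M2).
Proof. by move=> gf; apply: conj_h_gr; apply: gr_star. Qed.

HB.instance Definition _ := NuAlgebra_isGrStar.Build l G matpm_sort
  pmstarK pmstarD pmstarM pmstarZ (@gr0 l G M2) (@grD l G M2) (@grZ l G M2)
  (@gr_span l G M2) (@gr_free l G M2) (@grM l G M2) pmgr_star.

Definition matpm : grStarAlgType l G := matpm_sort.

Program Definition pm_corner : grhom A matpm :=
  @GrHom l G A matpm (fun a => eps (S := mxunit (two G)) (ord0, ord0) a) _ _ _ _.
Next Obligation. by move=> k a b; rewrite epsD epsZ. Qed.
Next Obligation. by move=> a b; rewrite eps_mul. Qed.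
Next Obligation.
move=> a; rewrite /star /= /pmstar.
by rewrite [star _](gsstar_eps (S := mxunit (two G))) conj_h_eps scale1r.
Qed.
Next Obligation.
move=> g a ga.
have := gsgr_eps (S := mxunit (two G)) ((ord0, ord0) : mxunit (two G)) ga.
by rewrite /= mul1g invg1 mulg1.
Qed.
End MatPm.

Section DirSum.
Variables (l : comStarRingType) (G : groupType) (J : choiceType).
Variable (A : J -> grStarAlgType l G).

Definition dirsum_sort : Type := finfam (fun j => A j : lmodType l).
Local Notation T := dirsum_sort.
HB.instance Definition _ := GRing.Lmodule.copy T (finfam (fun j => A j : lmodType l)).

Program Definition dsmul (f h : T) : T :=
  @FinFam _ _ (fun j => A j : lmodType l) (fun j => f j ** h j) _.
Next Obligation.
move=> f h; apply: (sub_finite_set _ (finfam_fin f)) => j /=.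
by apply: contraNneq => ->; rewrite nmul0l.
Qed.
Program Definition dsstar (f : T) : T :=
  @FinFam _ _ (fun j => A j : lmodType l) (fun j => star (f j)) _.
Next Obligation.
move=> f; apply: (sub_finite_set _ (finfam_fin f)) => j /=.
by apply: contraNneq => ->; rewrite star0.
Qed.
Definition dsgr (g : G) : set T := [set f | forall j, gr g (f j)].

Lemma dsmulA : associative dsmul.
Proof. by move=> ???; apply: finfamP => j /=; rewrite nmulA. Qed.
Lemma dsmulDl : left_distributive dsmul +%R.
Proof. by move=> ???; apply: finfamP => j /=; rewrite nmulDl. Qed.
Lemma dsmulDr : right_distributive dsmul +%R.
Proof. by move=> ???; apply: finfamP => j /=; rewrite nmulDr. Qed.
Lemma dsmulZl (k : l) (f h : T) : dsmul (k *: f) h = k *: dsmul f h.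
Proof. by apply: finfamP => j /=; rewrite nmulZl. Qed.
Lemma dsmulZr (k : l) (f h : T) : dsmul f (k *: h) = k *: dsmul f h.
Proof. by apply: finfamP => j /=; rewrite nmulZr. Qed.
HB.instance Definition _ :=
  Lmodule_isNuAlgebra.Build l T dsmulA dsmulDl dsmulDr dsmulZl dsmulZr.

Lemma dsstarK : involutive dsstar.
Proof. by move=> ?; apply: finfamP => j /=; rewrite starK. Qed.
Lemma dsstarD : {morph dsstar : a b / a + b}.
Proof. by move=> ??; apply: finfamP => j /=; rewrite starD. Qed.
Lemma dsstarM (f h : T) : dsstar (f ** h) = dsstar h ** dsstar f.
Proof. by apply: finfamP => j /=; rewrite starM. Qed.
Lemma dsstarZ (k : l) (f : T) : dsstar (k *: f) = conjr k *: dsstar f.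
Proof. by apply: finfamP => j /=; rewrite starZ. Qed.
Lemma dsgr0 g : dsgr g 0. Proof. by move=> j; exact: gr0. Qed.
Lemma dsgrD g f h : dsgr g f -> dsgr g h -> dsgr g (f + h).
Proof. by move=> gf gh j; apply: grD. Qed.
Lemma dsgrZ g (k : l) f : dsgr g f -> dsgr g (k *: f).
Proof. by move=> gf j; apply: grZ. Qed.
Lemma dsgr_single g j (a : A j) : gr g a -> dsgr g (single (M := fun j => A j : lmodType l) a).
Proof.
move=> ga i; case: (eqVneq j i) => [<-|ji]; last by rewrite single_ne //; exact: gr0.
by rewrite singleE.
Qed.
Lemma dsgr_span (f : T) : hsum dsgr f.
Proof.
elim/finfam_ind: f => [|f h|j a]; [exact: hsum0|exact: hsumD|].
apply: (@hsum_morph _ _ _ (@gr l G (A j))); [exact: single0|exact: singleD| |exact: gr_span].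
by move=> g b gb; exists g; exact: dsgr_single.
Qed.
Lemma dsgr_free (r : seq G) (f : G -> T) : uniq r -> (forall g, dsgr g (f g)) ->
  \sum_(g <- r) f g = 0 -> forall g, g \in r -> f g = 0.
Proof.
move=> ur gf sf g gr_; apply: finfamP => j.
apply: (@gr_free l G (A j) r (fun g => f g j)) => //.
  by move=> k; exact: gf.
by have := congr1 (fun h => finfam_fun h j) sf; rewrite ff_sumE.
Qed.
Lemma dsgrM g h (f k : T) : dsgr g f -> dsgr h k -> dsgr (g * h)%g (f ** k).
Proof. by move=> gf gk j; apply: grM. Qed.
Lemma dsgr_star g f : dsgr g f -> dsgr g^-1%g (dsstar f).
Proof. by move=> gf j; apply: gr_star. Qed.
HB.instance Definition _ := NuAlgebra_isGrStar.Build l G T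
  dsstarK dsstarD dsstarM dsstarZ dsgr0 dsgrD dsgrZ dsgr_span dsgr_free dsgrM dsgr_star.

Definition dirsum : grStarAlgType l G := dirsum_sort.

Program Definition dirsum_inj (j : J) : grhom (A j) dirsum :=
  @GrHom l G (A j) dirsum (@single l J (fun j => A j : lmodType l) j) _ _ _ _.
Next Obligation. by move=> j; exact: single_linear. Qed.
Next Obligation.
move=> j a b; apply: finfamP => i; case: (eqVneq j i) => [<-|ji] /=.
  by rewrite !single_fun_eq.
by rewrite !single_fun_ne // nmul0l.
Qed.
Next Obligation.
move=> j a; apply: finfamP => i; case: (eqVneq j i) => [<-|ji] /=.
  by rewrite !single_fun_eq.
by rewrite !single_fun_ne // star0.
Qed.
Next Obligation. by move=> j g a; exact: dsgr_single. Qed.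
End DirSum.

Definition scal (l : comStarRingType) : Type := l^o.

Section Scal.
Variable l : comStarRingType.
HB.instance Definition _ := GRing.Lmodule.copy (scal l) (l^o).
Definition smul (a b : scal l) : scal l := (a : l) * b.
Lemma smulA : associative smul. Proof. exact: mulrA. Qed.
Lemma smulDl : left_distributive smul +%R. Proof. exact: mulrDl. Qed.
Lemma smulDr : right_distributive smul +%R. Proof. exact: mulrDr. Qed.
Lemma smulZl (k : l) (a b : scal l) : smul (k *: a) b = k *: smul a b.
Proof. exact/esym/(mulrA k). Qed.
Lemma smulZr (k : l) (a b : scal l) : smul a (k *: b) = k *: smul a b.
Proof. exact: (mulrCA (a : l) k b). Qed.
HB.instance Definition _ :=
  Lmodule_isNuAlgebra.Build l (scal l) smulA smulDl smulDr smulZl smulZr.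

Variable G : groupType.
Definition gscal_sort (_ : groupType) : Type := scal l.
HB.instance Definition _ := NuAlgebra.copy (gscal_sort G) (scal l).

Definition scal_gr (g : G) : set (gscal_sort G) := [set a | g = 1%g \/ a = 0].

Definition scal_star (a : gscal_sort G) : gscal_sort G := conjr (a : l).
Lemma scal_starK : involutive scal_star. Proof. exact: conjrK. Qed.
Lemma scal_starD : {morph scal_star : a b / a + b}. Proof. exact: conjrD. Qed.
Lemma scal_starM (a b : gscal_sort G) : scal_star (a ** b) = scal_star b ** scal_star a.
Proof. by rewrite /scal_star [LHS]conjrM mulrC. Qed.
Lemma scal_starZ (k : l) (a : gscal_sort G) : scal_star (k *: a) = conjr k *: scal_star a.
Proof. exact: conjrM. Qed.
Lemma scal_gr0 g : scal_gr g 0. Proof. by right. Qed.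
Lemma scal_grD g a b : scal_gr g a -> scal_gr g b -> scal_gr g (a + b).
Proof. by move=> [->|->]; [left|rewrite add0r]. Qed.
Lemma scal_grZ g (k : l) a : scal_gr g a -> scal_gr g (k *: a).
Proof. by move=> [->|->]; [left|rewrite scaler0; right]. Qed.
Lemma scal_span (a : gscal_sort G) : hsum scal_gr a.
Proof. by apply: (@hsum_hom _ _ _ 1%g); left. Qed.
Lemma scal_free (r : seq G) (f : G -> gscal_sort G) : uniq r ->
  (forall g, scal_gr g (f g)) -> \sum_(g <- r) f g = 0 -> forall g, g \in r -> f g = 0.
Proof.
move=> ur gf; have ne g : g != 1%g -> f g = 0.
  by move=> /eqP ng; case: (gf g).
move=> s0 g gr_; case: (eqVneq g 1%g) => [g1|/ne//].
rewrite -s0 (bigD1_seq g) //= big1 ?addr0 // => h hg; apply: ne.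
by rewrite -g1.
Qed.
Lemma scal_grM g h (a b : gscal_sort G) :
  scal_gr g a -> scal_gr h b -> scal_gr (g * h)%g (a ** b).
Proof.
move=> [->|->]; last by rewrite nmul0l; right.
move=> [->|->]; last by rewrite nmul0r; right.
by left; rewrite mulg1.
Qed.
Lemma scal_gr_star g a : scal_gr g a -> scal_gr g^-1%g (scal_star a).
Proof.
by move=> [->|->]; [left; rewrite invg1|right; exact: conjr0].
Qed.
HB.instance Definition _ := NuAlgebra_isGrStar.Build l G (gscal_sort G)
  scal_starK scal_starD scal_starM scal_starZ scal_gr0 scal_grD scal_grZ
  scal_span scal_free scal_grM scal_gr_star.
Definition gscal : grStarAlgType l G := gscal_sort G.
End Scal.

Record graph := Graph {
  vert : choiceType;
  edge : choiceType;
  src : edge -> vert;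
  rng : edge -> vert
}.

Inductive cohn_gen (E : graph) :=
  | GVert of vert E
  | GEdge of edge E
  | GGhost of edge E.
Arguments GVert {E}. Arguments GEdge {E}. Arguments GGhost {E}.

Section Cohn.
Variables (l : comStarRingType) (E : graph).
Local Notation gen := (cohn_gen E).

HB.instance Definition _ := gen_eqMixin gen.
HB.instance Definition _ := gen_choiceMixin gen.

Definition word := {w : seq gen | w != [::]}.
HB.instance Definition _ := Choice.on word.

Program Definition wcat (u v : word) : word := exist _ (val u ++ val v) _.
Next Obligation. by move=> [u Hu] [v Hv] /=; case: u Hu. Qed.
Definition wgen (x : gen) : word := exist _ [:: x] isT.

Lemma wcatA : associative wcat.
Proof. by move=> u v w; apply: val_inj; rewrite /= catA. Qed.

Program Definition word_sz : szSemi := @SzSemi word (fun u v => Some (wcat u v)) _.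
Next Obligation. by move=> u v w /=; rewrite wcatA. Qed.

(* The free algebra without unit on the generators. *)
Definition free_cohn : nuAlgType l := sgalg word_sz (scal l).
Local Notation F := free_cohn.

Definition wordF (w : word) : F := eps (S := word_sz) (A := scal l) w (1 : l).
Definition genF (x : gen) : F := wordF (wgen x).
Local Notation V v := (genF (GVert v)).
Local Notation Ed e := (genF (GEdge e)).
Local Notation Gh e := (genF (GGhost e)).

Variant cohn_rel : F -> F -> Prop :=
  | CohnVV v w : cohn_rel (V v ** V w) (if v == w then V v else 0)
  | CohnSE e : cohn_rel (V (src e) ** Ed e) (Ed e)
  | CohnER e : cohn_rel (Ed e ** V (rng e)) (Ed e)
  | CohnRG e : cohn_rel (V (rng e) ** Gh e) (Gh e)
  | CohnGS e : cohn_rel (Gh e ** V (src e)) (Gh e)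
  | CohnGE e f : cohn_rel (Gh e ** Ed f) (if e == f then V (rng e) else 0).

(* The two-sided ideal generated by the relations. *)
Inductive cohn_ideal : F -> Prop :=
  | CohnRel a b : cohn_rel a b -> cohn_ideal (a - b)
  | Cohn0 : cohn_ideal 0
  | CohnD a b : cohn_ideal a -> cohn_ideal b -> cohn_ideal (a + b)
  | CohnZ k a : cohn_ideal a -> cohn_ideal (k *: a)
  | CohnMl a b : cohn_ideal b -> cohn_ideal (a ** b)
  | CohnMr a b : cohn_ideal a -> cohn_ideal (a ** b).

Definition cohn_pred : {pred F} := fun x => `[< cohn_ideal x >].
Lemma cohn_predP x : reflect (cohn_ideal x) (x \in cohn_pred).
Proof. exact: asboolP. Qed.

Lemma cohn_ideal_zmod : zmod_closed cohn_pred.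
Proof.
split=> [|x y /cohn_predP Ix /cohn_predP Iy]; apply/cohn_predP; first exact: Cohn0.
by apply: CohnD => //; rewrite -scaleN1r; apply: CohnZ.
Qed.
HB.instance Definition _ := GRing.isZmodClosed.Build F cohn_pred cohn_ideal_zmod.

Definition cohn_sort : Type := Quotient.quot cohn_pred.
Local Notation C := cohn_sort.
HB.instance Definition _ := GRing.Zmodule.copy C (Quotient.quot cohn_pred).
Definition cohn_pi (x : F) : C := (\pi_(Quotient.quot cohn_pred) x)%qT.

Lemma cohn_pi_surj c : exists x, c = cohn_pi x.
Proof. by exists (repr c); rewrite /cohn_pi reprK. Qed.
Lemma cohn_piP x y : (cohn_pi x = cohn_pi y) <-> cohn_ideal (x - y).
Proof.
rewrite /cohn_pi; split.
  by move/eqP; rewrite -Quotient.idealrBE => /cohn_predP.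
by move=> H; apply/eqP; rewrite -Quotient.idealrBE; apply/cohn_predP.
Qed.
Lemma cohn_piD : {morph cohn_pi : x y / x + y}.
Proof. by move=> x y; rewrite /cohn_pi pi_addr. Qed.
Lemma cohn_pi0 : cohn_pi 0 = 0.
Proof. by rewrite /cohn_pi pi_zeror. Qed.

Definition cohnZ (k : l) (c : C) : C := cohn_pi (k *: repr c).
Definition cohnM (c d : C) : C := cohn_pi (repr c ** repr d).

Lemma cohn_repr x : cohn_ideal (repr (cohn_pi x) - x).
Proof. by apply/cohn_piP; rewrite /cohn_pi reprK. Qed.

Lemma cohnZE k x : cohnZ k (cohn_pi x) = cohn_pi (k *: x).
Proof. by apply/cohn_piP; rewrite -scalerBr; apply: CohnZ; exact: cohn_repr. Qed.
Lemma cohnME x y : cohnM (cohn_pi x) (cohn_pi y) = cohn_pi (x ** y).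
Proof.
apply/cohn_piP; set x' := repr _; set y' := repr _.
have -> : x' ** y' - x ** y = (x' - x) ** y' + x ** (y' - y).
  by rewrite nmulDl nmulDr nmulNl nmulNr addrA subrK.
by apply: CohnD; [apply: CohnMr|apply: CohnMl]; exact: cohn_repr.
Qed.

Lemma cohnZA a b v : cohnZ a (cohnZ b v) = cohnZ (a * b) v.
Proof. by have [x ->] := cohn_pi_surj v; rewrite !cohnZE scalerA. Qed.
Lemma cohn1Z : left_id 1 cohnZ.
Proof. by move=> v; have [x ->] := cohn_pi_surj v; rewrite !cohnZE scale1r. Qed.
Lemma cohnZDr : right_distributive cohnZ +%R.
Proof.
move=> k u v; have [x ->] := cohn_pi_surj u; have [y ->] := cohn_pi_surj v.
by rewrite -cohn_piD !cohnZE scalerDr cohn_piD.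
Qed.
Lemma cohnZDl v : {morph cohnZ^~ v : a b / a + b}.
Proof. by move=> a b; have [x ->] := cohn_pi_surj v; rewrite !cohnZE scalerDl cohn_piD. Qed.
HB.instance Definition _ :=
  GRing.Zmodule_isLmodule.Build l C cohnZA cohn1Z cohnZDr cohnZDl.

Lemma cohn_piZ k x : cohn_pi (k *: x) = k *: cohn_pi x.
Proof. by rewrite -cohnZE. Qed.

Lemma cohnMA : associative cohnM.
Proof.
move=> u v w; have [x ->] := cohn_pi_surj u; have [y ->] := cohn_pi_surj v.
by have [z ->] := cohn_pi_surj w; rewrite !cohnME nmulA.
Qed.
Lemma cohnMDl : left_distributive cohnM +%R.
Proof.
move=> u v w; have [x ->] := cohn_pi_surj u; have [y ->] := cohn_pi_surj v.
by have [z ->] := cohn_pi_surj w; rewrite -cohn_piD !cohnME nmulDl cohn_piD.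
Qed.
Lemma cohnMDr : right_distributive cohnM +%R.
Proof.
move=> u v w; have [x ->] := cohn_pi_surj u; have [y ->] := cohn_pi_surj v.
by have [z ->] := cohn_pi_surj w; rewrite -cohn_piD !cohnME nmulDr cohn_piD.
Qed.
Lemma cohnMZl (k : l) (u v : C) : cohnM (k *: u) v = k *: cohnM u v.
Proof.
have [x ->] := cohn_pi_surj u; have [y ->] := cohn_pi_surj v.
by rewrite -cohn_piZ !cohnME nmulZl cohn_piZ.
Qed.
Lemma cohnMZr (k : l) (u v : C) : cohnM u (k *: v) = k *: cohnM u v.
Proof.
have [x ->] := cohn_pi_surj u; have [y ->] := cohn_pi_surj v.
by rewrite -cohn_piZ !cohnME nmulZr cohn_piZ.
Qed.
HB.instance Definition _ :=
  Lmodule_isNuAlgebra.Build l C cohnMA cohnMDl cohnMDr cohnMZl cohnMZr.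

Lemma cohn_piM : {morph cohn_pi : x y / x ** y}.
Proof. by move=> x y; rewrite -[LHS]cohnME. Qed.
Lemma cohn_pi_sum I (r : seq I) (P : pred I) (f : I -> F) :
  cohn_pi (\sum_(i <- r | P i) f i) = \sum_(i <- r | P i) cohn_pi (f i).
Proof. by elim/big_rec2: _ => [|i x y _ <-]; rewrite ?cohn_pi0 ?cohn_piD. Qed.

Definition gen_star (x : gen) : gen :=
  match x with GVert v => GVert v | GEdge e => GGhost e | GGhost e => GEdge e end.
Lemma gen_starK : involutive gen_star. Proof. by case. Qed.

Program Definition wstar (w : word) : word := exist _ (rev (map gen_star (val w))) _.
Next Obligation. by move=> [w Hw]; rewrite -size_eq0 size_rev size_map size_eq0. Qed.

Lemma wstarK : involutive wstar.
Proof.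
by move=> w; apply: val_inj; rewrite /= map_rev revK -map_comp map_id_in // => x _ /=; exact: gen_starK.
Qed.
Lemma wstar_cat u v : wstar (wcat u v) = wcat (wstar v) (wstar u).
Proof. by apply: val_inj; rewrite /= map_cat rev_cat. Qed.

Program Definition freestar (f : F) : F :=
  @FinFam _ _ (fun _ : word_sz => scal l : lmodType l)
    (fun w => conjr (f (wstar w) : l)) _.
Next Obligation.
move=> f; apply: (sub_finite_set _ (finite_image wstar (finfam_fin f))) => w /= fw.
exists (wstar w); last by rewrite wstarK.
by apply: contraNneq fw => ->; apply/eqP; exact: conjr0.
Qed.

Lemma freestarK : involutive freestar.
Proof. by move=> f; apply: finfamP => w /=; rewrite wstarK conjrK. Qed.
Lemma freestarD : {morph freestar : a b / a + b}.
Proof. by move=> f h; apply: finfamP => w; exact: (conjrD (f (wstar w) : l) (h (wstar w) : l)). Qed.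
Lemma freestarZ (k : l) a : freestar (k *: a) = conjr k *: freestar a.
Proof. by apply: finfamP => w; exact: (conjrM k (a (wstar w) : l)). Qed.
Lemma freestar0 : freestar 0 = 0.
Proof. by apply: finfamP => w; exact: conjr0. Qed.
Lemma freestarN a : freestar (- a) = - freestar a.
Proof. by rewrite -scaleN1r freestarZ conjrN conjr1 scaleN1r. Qed.
Lemma freestar_eps (w : word_sz) (a : scal l) :
  freestar (eps w a) = eps (S := word_sz) (wstar w) (conjr (a : l) : scal l).
Proof.
apply: finfamP => t; rewrite [LHS]/=.
case: (eqVneq (wstar w) t) => [<-|st].
  by rewrite wstarK single_fun_eq /eps singleE.
rewrite /eps single_ne // single_fun_ne; first exact: conjr0.
by apply: contraNneq st => ->; rewrite wstarK eqxx.
Qed.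
Lemma freestarM (f h : F) : freestar (f ** h) = freestar h ** freestar f.
Proof.
elim/sgalg_ind: f => [|f f' IH IH'|s a]; rewrite ?(nmul0l, nmul0r, freestar0) //.
  by rewrite !(nmulDl, freestarD, nmulDr) IH IH'.
elim/sgalg_ind: h => [|h h' IH IH'|t b]; rewrite ?(nmul0l, nmul0r, freestar0) //.
  by rewrite !(nmulDr, freestarD, nmulDl) IH IH'.
rewrite [eps s a ** _]eps_mul !freestar_eps [RHS]eps_mul /= wstar_cat.
by congr (eps _ _); exact: etrans (conjrM (a : l) (b : l)) (mulrC _ _).
Qed.
Lemma freestar_gen x : freestar (genF x) = genF (gen_star x).
Proof.
rewrite /genF /wordF freestar_eps conjr1; congr (eps _ _).
exact: val_inj.
Qed.

Lemma cohn_rel_star a b : cohn_rel a b -> cohn_rel (freestar a) (freestar b).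
Proof.
case=> [v w|e|e|e|e|e f]; rewrite freestarM !freestar_gen /=.
- have -> : freestar (if v == w then V v else 0) = if w == v then V w else 0.
    by rewrite eq_sym; case: eqP => [->|_]; rewrite ?freestar0 ?freestar_gen.
  exact: CohnVV.
- exact: CohnGS.
- exact: CohnRG.
- exact: CohnER.
- exact: CohnSE.
- have -> : freestar (if e == f then V (rng e) else 0) = if f == e then V (rng f) else 0.
    by rewrite eq_sym; case: eqP => [->|_]; rewrite ?freestar0 ?freestar_gen.
  exact: CohnGE.
Qed.

Lemma cohn_ideal_star a : cohn_ideal a -> cohn_ideal (freestar a).
Proof.
elim=> {a} [a b rab||a b _ IHa _ IHb|k a _ IH|a b _ IH|a b _ IH].
- by rewrite freestarD freestarN; apply: CohnRel; exact: cohn_rel_star.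
- by rewrite freestar0; exact: Cohn0.
- by rewrite freestarD; exact: CohnD.
- by rewrite freestarZ; exact: CohnZ.
- by rewrite freestarM; exact: CohnMr.
- by rewrite freestarM; exact: CohnMl.
Qed.

Definition cohn_star (c : C) : C := cohn_pi (freestar (repr c)).
Lemma cohn_starE x : cohn_star (cohn_pi x) = cohn_pi (freestar x).
Proof.
apply/cohn_piP; rewrite -freestarN -freestarD.
by apply: cohn_ideal_star; exact: cohn_repr.
Qed.
Lemma cohn_starK : involutive cohn_star.
Proof. by move=> c; have [x ->] := cohn_pi_surj c; rewrite !cohn_starE freestarK. Qed.
Lemma cohn_starD : {morph cohn_star : a b / a + b}.
Proof.
move=> u v; have [x ->] := cohn_pi_surj u; have [y ->] := cohn_pi_surj v.
by rewrite -cohn_piD !cohn_starE freestarD cohn_piD.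
Qed.
Lemma cohn_starM (u v : C) : cohn_star (u ** v) = cohn_star v ** cohn_star u.
Proof.
have [x ->] := cohn_pi_surj u; have [y ->] := cohn_pi_surj v.
by rewrite -cohn_piM !cohn_starE freestarM cohn_piM.
Qed.
Lemma cohn_starZ (k : l) (u : C) : cohn_star (k *: u) = conjr k *: cohn_star u.
Proof.
by have [x ->] := cohn_pi_surj u; rewrite -cohn_piZ !cohn_starE freestarZ cohn_piZ.
Qed.

Variables (G : groupType) (om : edge E -> G).

Definition gen_deg (x : gen) : G :=
  match x with GVert _ => 1%g | GEdge e => om e | GGhost e => (om e)^-1%g end.
Definition wdeg (w : word) : G := foldr (fun x d => gen_deg x * d)%g 1%g (val w).

Lemma wdeg_cat u v : wdeg (wcat u v) = (wdeg u * wdeg v)%g.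
Proof.
rewrite /wdeg /=; elim: (val u) => [|x s IH] /=; first by rewrite mul1g.
by rewrite IH mulgA.
Qed.
Lemma gen_deg_star x : gen_deg (gen_star x) = (gen_deg x)^-1%g.
Proof. by case: x => //= [_|e]; rewrite ?invg1 ?invgK. Qed.
Lemma wdeg_star w : wdeg (wstar w) = (wdeg w)^-1%g.
Proof.
rewrite /wdeg /=; elim: (val w) => [|x s IH] /=; first by rewrite invg1.
rewrite rev_cons -cats1 foldr_cat /= mulg1 invgM -IH -gen_deg_star.
elim: (rev _) => [|y t IHt] /=; first by rewrite mul1g.
by rewrite IHt mulgA.
Qed.

(* Elements of the free algebra that are supported on words of degree [g]. *)
Definition freegr (g : G) : set F := [set f | forall w, wdeg w <> g -> f w = 0].

Program Definition fproj (g : G) (f : F) : F :=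
  @FinFam _ _ (fun _ : word_sz => scal l : lmodType l)
    (fun w => if wdeg w == g then f w else 0) _.
Next Obligation.
move=> g f; apply: (sub_finite_set _ (finfam_fin f)) => w /=.
by case: (wdeg w == g) => // /eqP.
Qed.
Lemma fprojD g : {morph fproj g : a b / a + b}.
Proof. by move=> a b; apply: finfamP => w /=; case: eqP; rewrite ?addr0. Qed.
Lemma fprojZ g k a : fproj g (k *: a) = k *: fproj g a.
Proof. by apply: finfamP => w /=; case: eqP; rewrite ?scaler0. Qed.
Lemma fproj0 g : fproj g 0 = 0.
Proof. by apply: finfamP => w /=; case: eqP. Qed.
Lemma fproj_sum g I (r : seq I) (P : pred I) (f : I -> F) :
  fproj g (\sum_(i <- r | P i) f i) = \sum_(i <- r | P i) fproj g (f i).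
Proof. by elim/big_rec2: _ => [|i x y _ <-]; rewrite ?fproj0 ?fprojD. Qed.
Lemma fproj_gr g f : freegr g f -> fproj g f = f.
Proof. by move=> gf; apply: finfamP => w /=; case: eqP => // /gf. Qed.
Lemma fproj_gr0 g h f : g != h -> freegr h f -> fproj g f = 0.
Proof.
move=> gh gf; apply: finfamP => w /=; case: eqP => // wg.
by apply: gf => wh; move/eqP: gh; rewrite -wg wh.
Qed.
Lemma fproj_eps g (w : word_sz) (a : scal l) :
  fproj g (eps w a) = if wdeg w == g then eps w a else 0.
Proof.
case: eqP => [wg|wg]; apply: finfamP => t /=; case: (eqVneq w t) => [<-|wt].
- by rewrite wg eqxx.
- by rewrite single_fun_ne // if_same.
- by rewrite (introF eqP wg).
- by rewrite single_fun_ne // if_same.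
Qed.
Lemma fproj_epsM g (w : word_sz) (a : scal l) (f : F) :
  fproj g (eps w a ** f) = eps w a ** fproj ((wdeg w)^-1 * g)%g f.
Proof.
elim/sgalg_ind: f => [|f f' IH IH'|t b].
- by rewrite !(fproj0, nmul0r).
- by rewrite !(nmulDr, fprojD) IH IH'.
rewrite [eps w a ** eps t b]eps_mul /= !fproj_eps wdeg_cat.
have -> : (wdeg t == (wdeg w)^-1 * g)%g = (wdeg w * wdeg t == g)%g.
  by apply/eqP/eqP => [->|<-]; rewrite mulgA ?mulgV ?mulVg mul1g.
by case: eqP => _; rewrite ?nmul0r // [RHS]eps_mul.
Qed.
Lemma fproj_Meps g (w : word_sz) (a : scal l) (f : F) :
  fproj g (f ** eps w a) = fproj (g * (wdeg w)^-1)%g f ** eps w a.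
Proof.
elim/sgalg_ind: f => [|f f' IH IH'|t b].
- by rewrite !(fproj0, nmul0l).
- by rewrite !(nmulDl, fprojD) IH IH'.
rewrite [eps t b ** eps w a]eps_mul /= !fproj_eps wdeg_cat.
have -> : (wdeg t == g * (wdeg w)^-1)%g = (wdeg t * wdeg w == g)%g.
  by apply/eqP/eqP => [->|<-]; rewrite -mulgA ?mulgV ?mulVg mulg1.
by case: eqP => _; rewrite ?nmul0l // [RHS]eps_mul.
Qed.

Lemma freegrD g f h : freegr g f -> freegr g h -> freegr g (f + h).
Proof. by move=> gf gh w wg /=; rewrite gf // gh // addr0. Qed.
Lemma freegrZ g k f : freegr g f -> freegr g (k *: f).
Proof. by move=> gf w wg /=; rewrite gf // scaler0. Qed.
Lemma freegr0 g : freegr g 0. Proof. by []. Qed.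
Lemma freegr_eps (w : word_sz) a : freegr (wdeg w) (eps w a : F).
Proof. by move=> t wt; rewrite /eps single_ne //; apply/eqP => e; apply: wt; rewrite e. Qed.
Lemma freegr_sum g I (r : seq I) (f : I -> F) :
  (forall i, freegr g (f i)) -> freegr g (\sum_(i <- r) f i).
Proof. by move=> h; elim/big_ind: _ => // x y; exact: freegrD. Qed.
Lemma freegrM g h (a b : F) : freegr g a -> freegr h b -> freegr (g * h)%g (a ** b).
Proof.
move=> ga hb; change (a ** b) with (sgmul a b).
rewrite (@sgmulE _ _ _ (supp a) (supp b)); try by move=> i; rewrite suppP negbK => /eqP.
apply: freegr_sum => -[u v] /=.
case: (eqVneq (wdeg u) g) => [<-|/eqP/ga->]; last by rewrite nmul0l eps0.
case: (eqVneq (wdeg v) h) => [<-|/eqP/hb->]; last by rewrite nmul0r eps0.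
by rewrite -wdeg_cat; exact: freegr_eps.
Qed.
Lemma freegr_rel a b : cohn_rel a b -> exists g, freegr g a /\ freegr g b.
Proof.
have gg x : freegr (gen_deg x) (genF x).
  by have := @freegr_eps (wgen x) (1 : l); rewrite /wdeg /= mulg1.
have ggM x y : freegr (gen_deg x * gen_deg y)%g (genF x ** genF y).
  by apply: freegrM.
case=> [v w|e|e|e|e|e f]; eexists; split; try exact: ggM; rewrite /= ?mul1g ?mulg1.
- by case: eqP => _; [exact: (gg (GVert v))|exact: freegr0].
- exact: (gg (GEdge e)).
- exact: (gg (GEdge e)).
- exact: (gg (GGhost e)).
- exact: (gg (GGhost e)).
- case: eqP => [->|_]; last exact: freegr0.
  by rewrite mulVg; exact: (gg (GVert (rng f))).
Qed.
Lemma cohn_ideal_proj a : cohn_ideal a -> forall g, cohn_ideal (fproj g a).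
Proof.
elim=> {a} [a b rab||a b _ IHa _ IHb|k a _ IH|a b _ IH|a b _ IH] g.
- have [h [ha hb]] := freegr_rel rab.
  have hab : freegr h (a - b).
    by apply: freegrD => //; rewrite -scaleN1r; apply: freegrZ.
  case: (eqVneq g h) => [->|gh]; last by rewrite (fproj_gr0 gh hab); exact: Cohn0.
  by rewrite fproj_gr //; exact: CohnRel.
- by rewrite fproj0; exact: Cohn0.
- by rewrite fprojD; exact: CohnD.
- by rewrite fprojZ; exact: CohnZ.
- elim/sgalg_ind: a => [|a a' Ha Ha'|w c].
  + by rewrite nmul0l fproj0; exact: Cohn0.
  + by rewrite nmulDl fprojD; exact: CohnD.
  + by rewrite fproj_epsM; apply: CohnMl.
- elim/sgalg_ind: b => [|b b' Hb Hb'|w c].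
  + by rewrite nmul0r fproj0; exact: Cohn0.
  + by rewrite nmulDr fprojD; exact: CohnD.
  + by rewrite fproj_Meps; apply: CohnMr.
Qed.

Definition cohnw_sort (_ : edge E -> G) : Type := C.
HB.instance Definition _ := NuAlgebra.copy (cohnw_sort om) C.

Definition cohn_gr (g : G) : set (cohnw_sort om) := cohn_pi @` freegr g.

Lemma cohn_gr0 g : cohn_gr g 0.
Proof. by exists 0; [exact: freegr0|exact: cohn_pi0]. Qed.
Lemma cohn_grD g a b : cohn_gr g a -> cohn_gr g b -> cohn_gr g (a + b).
Proof.
move=> [x gx <-] [y gy <-]; exists (x + y); last exact: cohn_piD.
exact: freegrD.
Qed.
Lemma cohn_grZ g (k : l) a : cohn_gr g a -> cohn_gr g (k *: a).
Proof.
move=> [x gx <-]; exists (k *: x); last exact: cohn_piZ.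
exact: freegrZ.
Qed.
Lemma cohn_gr_span a : hsum cohn_gr a.
Proof.
have [x ->] := cohn_pi_surj a; elim/sgalg_ind: x => [|x y Hx Hy|w c].
- by rewrite cohn_pi0; exact: hsum0.
- by rewrite cohn_piD; exact: hsumD.
- apply: (@hsum_hom _ _ _ (wdeg w)); exists (eps w c) => //; exact: freegr_eps.
Qed.
Lemma cohn_gr_free (r : seq G) (f : G -> cohnw_sort om) : uniq r ->
  (forall g, cohn_gr g (f g)) -> \sum_(g <- r) f g = 0 -> forall g, g \in r -> f g = 0.
Proof.
move=> ur gf sf g gr_.
have /choice [x xP] : forall h, exists y, freegr h y /\ cohn_pi y = f h.
  by move=> h; have [y ? ?] := gf h; exists y.
have := sf; under eq_bigr do rewrite -(xP _).2.
rewrite -cohn_pi_sum -[X in _ = X]cohn_pi0 => /cohn_piP.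
rewrite subr0 => /cohn_ideal_proj /(_ g).
rewrite fproj_sum (bigD1_seq g) //= big1 ?addr0 => [|h hg].
  rewrite fproj_gr; last exact: (xP g).1.
  by move=> Ig; rewrite -(xP g).2 -[RHS]cohn_pi0; apply/cohn_piP; rewrite subr0.
by apply: (@fproj_gr0 _ h); [rewrite eq_sym|exact: (xP h).1].
Qed.
Lemma cohn_grM g h (a b : cohnw_sort om) :
  cohn_gr g a -> cohn_gr h b -> cohn_gr (g * h)%g (a ** b).
Proof.
move=> [x gx <-] [y gy <-]; exists (x ** y); last exact: cohn_piM.
exact: freegrM.
Qed.
Lemma cohn_gr_star g a : cohn_gr g a -> cohn_gr g^-1%g (cohn_star a).
Proof.
move=> [x gx <-]; rewrite cohn_starE; exists (freestar x) => // w wg /=.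
rewrite gx; first exact: conjr0.
by rewrite wdeg_star => e; apply: wg; rewrite -e invgK.
Qed.

HB.instance Definition _ := NuAlgebra_isGrStar.Build l G (cohnw_sort om)
  cohn_starK cohn_starD cohn_starM cohn_starZ cohn_gr0 cohn_grD cohn_grZ
  cohn_gr_span cohn_gr_free cohn_grM cohn_gr_star.

(* C_omega(E) *)
Definition cohn : grStarAlgType l G := cohnw_sort om.

Definition cohn_vert (v : vert E) : cohn := cohn_pi (V v).
Definition cohn_edge (e : edge E) : cohn := cohn_pi (Ed e).
Definition cohn_ghost (e : edge E) : cohn := cohn_pi (Gh e).

End Cohn.

(* [l^(I)], finitely supported functions with pointwise operations. *)
Definition fsfuns (l : comStarRingType) (G : groupType) (I : choiceType) :
  grStarAlgType l G := dirsum (fun _ : I => gscal l G).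

Definition chi (l : comStarRingType) (G : groupType) (I : choiceType) (i : I) :
  fsfuns l G I := dirsum_inj (fun _ : I => gscal l G) i (1 : l).

Section CohnVertMap.
Variables (l : comStarRingType) (E : graph) (G : groupType) (om : edge E -> G).
Local Notation D := (fsfuns l G (vert E)).
Local Notation C := (cohn l om).

Definition cohn_phi_fun (f : D) : C :=
  \sum_(v \in [set: vert E]) (f v : l) *: cohn_vert l om v.

Lemma cohn_phi_funE (S : {fset vert E}) (f : D) :
  (forall v, v \notin S -> f v = 0) ->
  cohn_phi_fun f = \sum_(v <- S) (f v : l) *: cohn_vert l om v.
Proof. by move=> fS; apply: fsbigTE => v /fS ->; rewrite scale0r. Qed.

Lemma cohn_phi_linear : linear cohn_phi_fun.
Proof.
move=> k f h; pose S := (supp f `|` supp h)%fset.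
have fS v : v \notin S -> f v = 0.
  by rewrite inE negb_or suppP negbK => /andP[/eqP].
have hS v : v \notin S -> h v = 0.
  by rewrite inE negb_or [v \in supp h]suppP andbC negbK => /andP[/eqP].
rewrite !(@cohn_phi_funE S) //; last first.
  by move=> v vS /=; rewrite fS // hS // scaler0 addr0.
rewrite scaler_sumr -big_split; apply: eq_bigr => v _ /=.
by rewrite scalerA -scalerDl.
Qed.

Lemma cohn_vertM v w :
  cohn_vert l om v ** cohn_vert l om w = if v == w then cohn_vert l om v else 0.
Proof.
rewrite -[LHS]cohn_piM.
have -> : (if v == w then cohn_vert l om v else 0) =
    cohn_pi (if v == w then genF l (GVert v) else 0).
  by case: eqP; rewrite ?cohn_pi0.
by apply/cohn_piP; apply: CohnRel; exact: CohnVV.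
Qed.
Lemma cohn_vert_star v : star (cohn_vert l om v) = cohn_vert l om v.
Proof. by rewrite [LHS]cohn_starE freestar_gen. Qed.
Lemma cohn_vert_gr v : gr 1%g (cohn_vert l om v).
Proof.
exists (genF l (GVert v)) => //.
by have := @freegr_eps l E G om (wgen (GVert v)) (1 : l); rewrite /wdeg /= mulg1.
Qed.

Lemma cohn_phiM : {morph cohn_phi_fun : a b / a ** b}.
Proof.
move=> f h.
have sP (k : D) v : v \notin supp k -> k v = 0 by rewrite suppP negbK => /eqP.
rewrite (cohn_phi_funE (sP f)) (cohn_phi_funE (sP h)) nmul_suml.
rewrite (@cohn_phi_funE (supp f)); last by move=> v /sP fv /=; rewrite fv nmul0l.
apply: eq_bigr => v _; rewrite nmul_sumr.
under eq_bigr do rewrite nmulZl nmulZr cohn_vertM.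
case: (boolP (v \in supp h)) => vh.
  rewrite (big_fsetD1 v) //= eqxx big_seq big1 ?addr0; first by rewrite scalerA.
  by move=> w; rewrite !inE eq_sym => /andP[/negbTE-> _]; rewrite !scaler0.
rewrite /= (sP h v vh) nmul0r scale0r big_seq big1 // => w wh.
by case: eqP => [vw|_]; [move: vh; rewrite vw wh|rewrite !scaler0].
Qed.

Lemma cohn_phi_star : {morph cohn_phi_fun : a / star a}.
Proof.
move=> f.
have sP v : v \notin supp f -> f v = 0 by rewrite suppP negbK => /eqP.
rewrite (cohn_phi_funE sP) (@cohn_phi_funE (supp f)); last first.
  by move=> v /sP fv /=; rewrite fv; exact: conjr0.
rewrite star_sum; apply: eq_bigr => v _.
by rewrite starZ cohn_vert_star.
Qed.

Lemma cohn_phi_gr g (f : D) : gr g f -> gr g (cohn_phi_fun f).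
Proof.
move=> gf.
have sP v : v \notin supp f -> f v = 0 by rewrite suppP negbK => /eqP.
rewrite (cohn_phi_funE sP); apply: gr_sum => v _.
case: (gf v) => [->|->]; last by rewrite scale0r; exact: gr0.
by apply: grZ; exact: cohn_vert_gr.
Qed.

Definition cohn_phi : grhom D C :=
  GrHom cohn_phi_linear cohn_phiM cohn_phi_star cohn_phi_gr.

Lemma cohn_phi_chi v : cohn_phi (chi l G v) = cohn_vert l om v.
Proof.
rewrite /= (@cohn_phi_funE [fset v]%fset).
  by rewrite (big_fsetD1 v) ?inE //= big_seq big1 ?addr0 ?single_fun_eq ?scale1r //
    => w; rewrite !inE andNb.
by move=> w; rewrite inE eq_sym => vw; rewrite /= single_fun_ne.
Qed.
End CohnVertMap.

Record precat := PreCat {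
  ob :> Type;
  hom : ob -> ob -> zmodType;
  idm : forall X, hom X X;
  comp : forall X Y Z, hom Y Z -> hom X Y -> hom X Z;
  comp1m : forall X Y (f : hom X Y), comp (idm Y) f = f;
  compm1 : forall X Y (f : hom X Y), comp f (idm X) = f;
  compA : forall X Y Z W (f : hom Z W) (g : hom Y Z) (h : hom X Y),
    comp f (comp g h) = comp (comp f g) h;
  compDl : forall X Y Z (f f' : hom Y Z) (g : hom X Y),
    comp (f + f') g = comp f g + comp f' g;
  compDr : forall X Y Z (f : hom Y Z) (g g' : hom X Y),
    comp f (g + g') = comp f g + comp f g'
}.
Arguments idm {p} X.
Notation "g \oc f" := (comp g f) (at level 40, left associativity) : ring_scope.

Definition is_iso (T : precat) (X Y : T) (f : hom X Y) : Prop :=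
  exists g : hom Y X, g \oc f = idm X /\ f \oc g = idm Y.

Definition is_zero (T : precat) (Z : T) : Prop := idm Z = 0.

Definition additive_cat (T : precat) : Prop :=
  (exists Z : T, is_zero Z) /\
  forall X Y : T, exists P (i1 : hom X P) (i2 : hom Y P) (p1 : hom P X) (p2 : hom P Y),
    [/\ p1 \oc i1 = idm X, p2 \oc i2 = idm Y, p1 \oc i2 = 0, p2 \oc i1 = 0 &
        i1 \oc p1 + i2 \oc p2 = idm P].

Definition is_coproduct (T : precat) (J : Type) (X : J -> T) (S : T)
    (inj : forall j, hom (X j) S) : Prop :=
  forall (Y : T) (f : forall j, hom (X j) Y),
    exists! u : hom S Y, forall j, u \oc inj j = f j.

Record addfunctor (T T' : precat) := AddFunctor {
  fob :> T -> T';
  fmap : forall X Y, hom X Y -> hom (fob X) (fob Y);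
  fmap1 : forall X, fmap (idm X) = idm (fob X);
  fmapM : forall X Y Z (g : hom Y Z) (f : hom X Y),
    fmap (g \oc f) = fmap g \oc fmap f;
  fmapD : forall X Y (f g : hom X Y), fmap (f + g) = fmap f + fmap g
}.

(* The suspension [susp] is an additive autoequivalence with quasi-inverse [loop];
   [dist f g h] means that X -f-> Y -g-> Z -h-> susp X is distinguished. *)
Record tricat := TriCat {
  tri_cat :> precat;
  tri_add : additive_cat tri_cat;
  susp : addfunctor tri_cat tri_cat;
  loop : addfunctor tri_cat tri_cat;
  susp_loop : forall X, hom (susp (loop X)) X;
  susp_loop_iso : forall X, is_iso (susp_loop X);
  susp_loop_nat : forall X Y (f : hom X Y),
    susp_loop Y \oc fmap susp (fmap loop f) = f \oc susp_loop X;
  loop_susp : forall X, hom (loop (susp X)) X;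
  loop_susp_iso : forall X, is_iso (loop_susp X);
  loop_susp_nat : forall X Y (f : hom X Y),
    loop_susp Y \oc fmap loop (fmap susp f) = f \oc loop_susp X;
  dist : forall X Y Z : tri_cat, hom X Y -> hom Y Z -> hom Z (susp X) -> Prop;
  (* TR1 *)
  dist_idm : forall X Z : tri_cat, is_zero Z ->
    dist (idm X) (0 : hom X Z) (0 : hom Z (susp X));
  dist_cone : forall X Y (f : hom X Y),
    exists Z (g : hom Y Z) (h : hom Z (susp X)), dist f g h;
  dist_iso : forall X Y Z X' Y' Z' (f : hom X Y) (g : hom Y Z) (h : hom Z (susp X))
    (f' : hom X' Y') (g' : hom Y' Z') (h' : hom Z' (susp X'))
    (a : hom X X') (b : hom Y Y') (c : hom Z Z'),
    is_iso a -> is_iso b -> is_iso c ->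
    b \oc f = f' \oc a -> c \oc g = g' \oc b -> fmap susp a \oc h = h' \oc c ->
    dist f g h -> dist f' g' h';
  (* TR2 *)
  dist_rot : forall X Y Z (f : hom X Y) (g : hom Y Z) (h : hom Z (susp X)),
    dist f g h <-> dist g h (- fmap susp f);
  (* TR3 *)
  dist_fill : forall X Y Z X' Y' Z' (f : hom X Y) (g : hom Y Z) (h : hom Z (susp X))
    (f' : hom X' Y') (g' : hom Y' Z') (h' : hom Z' (susp X'))
    (a : hom X X') (b : hom Y Y'),
    dist f g h -> dist f' g' h' -> b \oc f = f' \oc a ->
    exists c : hom Z Z', c \oc g = g' \oc b /\ fmap susp a \oc h = h' \oc c;
  (* TR4, the octahedral axiom *)
  dist_octa : forall X Y Z Z' Y' X' (f : hom X Y) (g : hom Y Z)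
    (p1 : hom Y Z') (d1 : hom Z' (susp X))
    (p2 : hom Z Y') (d2 : hom Y' (susp X))
    (p3 : hom Z X') (d3 : hom X' (susp Y)),
    dist f p1 d1 -> dist (g \oc f) p2 d2 -> dist g p3 d3 ->
    exists (a : hom Z' Y') (b : hom Y' X'),
      [/\ a \oc p1 = p2 \oc g, d2 \oc a = d1,
          b \oc p2 = p3, d3 \oc b = fmap susp f \oc d2 &
          dist a b (fmap susp p1 \oc d3)]
}.

Section Homology.
Variables (l : comStarRingType) (G : groupType).
Implicit Types A B C : grStarAlgType l G.

(* 0 -> A -i-> B -p-> C -> 0 is exact and [p] has a degree-preserving linear section. *)
Definition split_ext A B C (i : grhom A B) (p : grhom B C) : Prop :=
  [/\ injective i, (forall b, p b = 0 <-> exists a, b = i a),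
      (forall c, exists b, c = p b) &
      exists s : C -> B, [/\ linear s, (forall g c, gr g c -> gr g (s c)) & cancel s p]].

Record homology (T : tricat) := Homology {
  hob :> grStarAlgType l G -> T;
  hmap : forall A B, grhom A B -> hom (hob A) (hob B);
  hmap1 : forall A, hmap (grhom_id A) = idm (hob A);
  hmapM : forall A B C (f : grhom B C) (h : grhom A B),
    hmap (grhom_comp f h) = hmap f \oc hmap h;
  bdry : forall A B C (i : grhom A B) (p : grhom B C),
    split_ext i p -> hom (loop T (hob C)) (hob A);
  bdry_nat : forall A B C A' B' C' (i : grhom A B) (p : grhom B C)
    (i' : grhom A' B') (p' : grhom B' C') (e : split_ext i p) (e' : split_ext i' p')
    (a : grhom A A') (b : grhom B B') (c : grhom C C'),
    (forall x, b (i x) = i' (a x)) -> (forall x, c (p x) = p' (b x)) ->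
    hmap a \oc bdry e = bdry e' \oc fmap (loop T) (hmap c);
  (* The triangle loop H(C) -> H(A) -> H(B) -> H(C), where the target of the last
     map is identified with susp (loop H(C)). *)
  bdry_dist : forall A B C (i : grhom A B) (p : grhom B C) (e : split_ext i p)
    (q : hom (hob B) (susp T (loop T (hob C)))),
    susp_loop (hob C) \oc q = hmap p -> dist (bdry e) (hmap i) q
}.

Variables (T : tricat) (H : homology T).

Definition homotopy_invariant : Prop :=
  forall A, is_iso (hmap H (poly_const A)).

Definition iota_stable : Prop := forall A, is_iso (hmap H (pm_corner A)).

(* The index set [X] is required to be nonempty: for [X] empty the condition would
   say that H(M_Y A) = 0, hence H = 0. *)
Definition G_stable (E : graph) : Prop :=
  forall (X Y : gset G) A, [set: X] !=set0 ->
    [set: X] #<= [set: vert E + edge E + nat + G] ->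
    [set: Y] #<= [set: vert E + edge E + nat + G] ->
    is_iso (hmap H (matx_incl X Y A)).

Definition graph_stable (E : graph) : Prop := iota_stable /\ G_stable E.

Definition additive_for (I : choiceType) : Prop :=
  forall J : choiceType, [set: J] #<= [set: I] ->
    (forall X : J -> T, exists S (inj : forall j, hom (X j) S), is_coproduct inj) /\
    forall (A : J -> grStarAlgType l G) (S : T) (inj : forall j, hom (H (A j)) S)
      (u : hom S (H (dirsum A))),
      is_coproduct inj -> (forall j, u \oc inj j = hmap H (dirsum_inj A j)) -> is_iso u.

End Homology.

(* Main.v *)
From HB Require Import structures.
From mathcomp Require Import all_boot all_algebra.
From mathcomp Require Import finmap.
From mathcomp Require Import boolp classical_sets functions cardinality fsbigop.
Require Import Defs.

Set Implicit Arguments.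
Unset Strict Implicit.
Unset Printing Implicit Defensive.

Import GRing.Theory.
Local Open Scope classical_set_scope.
Local Open Scope card_scope.
Local Open Scope ring_scope.

(** Write [C] for the Cohn algebra, [V] for [l^(E^0)] and [phi : V -> C].  The
    theorem is proved by a Fock space argument in the style of Cuntz and Pimsner:
    an inverse of [H phi] is built from the regular representation of [C] on paths.

    For an algebra [A] with orthogonal projections [p v] indexed by the vertices, let
    [K A] be the algebra of finite matrices over [A] whose rows and columns are
    indexed by a base point and by the nonempty sequences of edges, each of them taken
    once with sign + and once with sign -.  The inclusion [kappa : A -> K A] of the
    corner at the positive base point is inverted by [H], by stability
    ([corner_iso]); this needs that there are no more sequences of edges than
    elements of [E^0 + E^1 + N + G], which follows from Hessenberg's theorem
    ([infinite_square]).

    The algebra [C] acts on [K A] by multipliers: an edge is prepended to those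
    nonempty sequences to which it can be prepended, and the base point is killed
    ([fock_action]).  The semidirect product [D A] of [C] and [K A] is a split
    extension of [C] by [K A], with section [base], which is [sd_base].  A second
    section [full], given by [fock_family], adds to [base] what is missing at the base
    point: a vertex [v] also acts by [p v] at the base point, and an edge [e] also maps
    the base point to the sequence [e] with coefficient [p (rng e)].  Since [H] is split exact, [H full - H base] factors
    through [H (K A)].  For [A = V] and [p] the characteristic functions this defines
    [theta : H C -> H (K V)], with two properties.

    - [theta o H phi = H kappa], because [full o phi] is the sum of [base o phi] and
      [kappa], which are orthogonal ([hmap_base_corner]).

    - [H (K phi) o theta = H kappa], where now [kappa : C -> K C].  By naturality the
      left side, composed with the inclusion of [K C] in [D C], is [H full - H base]
      for [A = C]; and there [full] is homotopic to the orthogonal sum of [base] and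
      [kappa] ([hmap_fock_corner]).

    As [H (K phi) o H kappa = H kappa o H phi], these identities say that
    [(H kappa)^-1 o theta] is inverse to [H phi].

    The homotopy in the second property is where the signs enter.  At the base point,
    [full] sends the edge [e] to the unit vector at the sequence [e], and the
    orthogonal sum sends it to [e] at the base point.  Call these two orthogonal
    vectors [x] and [y], and let [z] be the unit vector at the negative copy of the
    sequence [e], so that [(z, z) = -1].  Then [y + z] is isotropic and orthogonal to
    [x], so that [x + t (y + z)] has norm 1 for every [t]; the same holds for
    [y + t (x + z)], and both paths end at [x + y + z].  The Cohn relations only ask
    the images of the edges to be isometries with orthogonal ranges, so that each path
    of vectors is a path of homomorphisms ([hmap_family_shift]). *)

(** * Sequences in an infinite set *)

Section Cardinality.

(** Any two sets are comparable: a maximal partial injection is total or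
    surjective. *)
Lemma injection_total (T U : Type) :
  (exists f : T -> U, injective f) \/ (exists f : U -> T, injective f).
Proof.
pose P (R : set (T * U)) :=
  (forall x y y', R (x, y) -> R (x, y') -> y = y') /\
  (forall x x' y, R (x, y) -> R (x', y) -> x = x').
have [F FP Ftot|R [[Rf Ri] Rmax]] := @Zorn_bigcup _ P.
  have glue a b : (\bigcup_(X in F) X) a -> (\bigcup_(X in F) X) b ->
      exists X, [/\ F X, X a & X b].
    move=> [X FX Xa] [Y FY Yb]; case: (Ftot _ _ FX FY) => XY.
    - by exists Y; split=> //; exact: XY.
    - by exists X; split=> //; exact: XY.
  split=> [x y y'|x x' y] /glue /[apply] -[X [/FP[Xf Xi]]]; first exact: Xf.
  exact: Xi.
case: (pselect (forall x, exists y, R (x, y))) => [/choice[f fR]|].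
  by left; exists f => x x' e; apply: (Ri x x' (f x)); rewrite ?fR // e.
case: (pselect (forall y, exists x, R (x, y))) => [/choice[f fR] _|].
  by right; exists f => y y' e; apply: (Rf (f y)); rewrite ?fR // e.
move=> /existsNP[y0 Ry0] /existsNP[x0 Rx0]; exfalso.
apply: (Rmax (R `|` [set (x0, y0)])).
  split=> [p Rp|H]; first by left.
  by apply: Rx0; exists y0; apply: H; right.
split=> [x y y'|x x' y] [h|[-> ->]] [h'|].
- exact: Rf h h'.
- by case=> ex _; case: Rx0; exists y; rewrite -ex.
- by case: Rx0; exists y'.
- by case=> ->.
- exact: Ri h h'.
- by case=> _ ey; case: Ry0; exists x; rewrite -ey.
- by case: Ry0; exists x'.
- by case=> ->.
Qed.

Variable S : Type.

Let field (R : set (S * S * S)) (x : S) := exists z, R (x, x, z).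

(** The graphs of the injective maps from the square of a subset, their field, to
    that subset.  Relations are used because their chains have unions. *)
Let pairing (R : set (S * S * S)) :=
  [/\ forall x y z z', R (x, y, z) -> R (x, y, z') -> z = z',
      forall x y x' y' z, R (x, y, z) -> R (x', y', z) -> x = x' /\ y = y',
      forall x y z, R (x, y, z) -> [/\ field R x, field R y & field R z] &
      forall x y, field R x -> field R y -> exists z, R (x, y, z)].

Let pairing_bigcup (F : set (set (S * S * S))) :
  F `<=` pairing -> total_on F subset -> pairing (\bigcup_(X in F) X).
Proof.
move=> FP Ftot.
have glue a b : (\bigcup_(X in F) X) a -> (\bigcup_(X in F) X) b ->
    exists X, [/\ F X, X a & X b].
  move=> [X FX Xa] [Y FY Yb]; case: (Ftot _ _ FX FY) => XY.
  - by exists Y; split=> //; exact: XY.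
  - by exists X; split=> //; exact: XY.
split.
- by move=> x y z z' /glue /[apply] -[X [/FP[Xf _ _ _]]]; exact: Xf.
- by move=> x y x' y' z /glue /[apply] -[X [/FP[_ Xi _ _]]]; exact: Xi.
- move=> x y z [X FX Xxyz]; have [_ _ Xc _] := FP _ FX.
  by have [[a ?] [b ?] [c ?]] := Xc _ _ _ Xxyz; split; [exists a|exists b|exists c];
    exists X.
- move=> x y [a xa] [b yb]; have [X [FX Xa Xb]] := glue _ _ xa yb.
  have [_ _ _ Xt] := FP _ FX; have [|//|z Xz] := Xt x y; first by exists a.
    by exists b.
  by exists z, X.
Qed.

(** Adjoining to the field [A] of a pairing a disjoint copy [g A] of [A]: all the
    new pairs can be sent injectively into [g A], since three copies of [A * A]
    embed into [A]. *)
Let pairing_extend (R : set (S * S * S)) (g : S -> S) (a0 a1 a2 : S) :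
  pairing R -> field R a0 -> field R a1 -> field R a2 ->
  a0 <> a1 -> a0 <> a2 -> a1 <> a2 ->
  (forall x, field R x -> ~ field R (g x)) ->
  (forall x y, field R x -> field R y -> g x = g y -> x = y) ->
  exists2 R', R `<` R' & pairing R'.
Proof.
move=> [Rf Ri Rc Rt] A0 A1 A2 n01 n02 n12 gA gi.
pose A := field R.
(* [(t, c)] with [c] the old code of [(a, b)] is coded again, and the tag [t] records
   which of the two coordinates lie in the copy. *)
pose new x y z := exists a b t c d, [/\ A a, A b, R (a, b, c) /\ R (t, c, d), z = g d &
  [\/ [/\ t = a0, x = a & y = g b], [/\ t = a1, x = g a & y = b] |
      [/\ t = a2, x = g a & y = g b]]].
have newz x y z : new x y z -> exists2 d, A d & z = g d.
  by move=> [a [b [t [c [d [_ _ [_ tcd] -> _]]]]]]; exists d => //; case: (Rc _ _ _ tcd).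
have newN x y z : new x y z -> A x -> A y -> False.
  move=> [a [b [t [c [d [Aa Ab _ _]]]]]] [[_ -> ->]|[_ -> ->]|[_ -> ->]] //.
  - by move=> _; exact: gA.
  - by move=> + _; exact: gA.
  - by move=> + _; exact: gA.
have RA x y z : R (x, y, z) -> [/\ A x, A y & A z] by exact: Rc.
have newXY x y z : new x y z -> (A x \/ exists2 a, A a & x = g a) /\
    (A y \/ exists2 a, A a & y = g a).
  move=> [a [b [t [c [d [Aa Ab _ _]]]]]].
  by move=> [[_ -> ->]|[_ -> ->]|[_ -> ->]]; split; try (by left); right;
    [exists b|exists a|exists a|exists b].
have cases x y : (A x \/ exists2 a, A a & x = g a) -> (A y \/ exists2 a, A a & y = g a) ->
    exists z, R (x, y, z) \/ new x y z.
  have mk a b t : A a -> A b -> A t -> exists c d, R (a, b, c) /\ R (t, c, d).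
    move=> Aa Ab At; have [c abc] := Rt _ _ Aa Ab.
    have [_ _ Ac] := Rc _ _ _ abc; have [d tcd] := Rt _ _ At Ac.
    by exists c, d.
  move=> [Ax|[a Aa ->]] [Ay|[b Ab ->]].
  - by have [z] := Rt _ _ Ax Ay; exists z; left.
  - have [c [d [h1 h2]]] := mk _ _ _ Ax Ab A0; exists (g d); right.
    by exists x, b, a0, c, d; split=> //; constructor 1.
  - have [c [d [h1 h2]]] := mk _ _ _ Aa Ay A1; exists (g d); right.
    by exists a, y, a1, c, d; split=> //; constructor 2.
  - have [c [d [h1 h2]]] := mk _ _ _ Aa Ab A2; exists (g d); right.
    by exists a, b, a2, c, d; split=> //; constructor 3.
pose R' : set (S * S * S) := [set p | R p \/ new p.1.1 p.1.2 p.2].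
have fieldR' x : field R' x <-> (A x \/ exists2 a, A a & x = g a).
  split; last by move=> h; have [z hz] := cases x x h h; exists z.
  by move=> [z [/RA[Ax _ _]|/newXY[]//]]; left.
exists R'.
  split=> [p|H]; first by left.
  have [z [/RA[]|nz]] := cases a0 (g a0) (or_introl A0) (or_intror (ex_intro2 _ _ a0 A0 erefl)).
    by move=> _ /(gA _ A0).
  have /RA[_ /(gA _ A0)//] : R (a0, g a0, z) by apply: H; right.
split.
- move=> x y z z' [xyz|/= n] [xyz'|/= n'].
  + exact: Rf xyz xyz'.
  + by have [Ax Ay _] := RA _ _ _ xyz; case: (newN _ _ _ n').
  + by have [Ax Ay _] := RA _ _ _ xyz'; case: (newN _ _ _ n).
  + case: n n' => [a [b [t [c [d [Aa Ab [abc tcd] -> h]]]]]].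
    move=> [a' [b' [t' [c' [d' [Aa' Ab' [abc' tcd'] -> h']]]]]].
    suff [ea eb et] : [/\ a = a', b = b' & t = t'].
      by move: abc' tcd'; rewrite -ea -eb -et => /(Rf _ _ _ _ abc) <- /(Rf _ _ _ _ tcd) ->.
    case: h h' => -[-> -> ->] [] [-> e1 e2].
    * by split=> //; exact: gi.
    * by case: (gA _ Aa'); rewrite -e1.
    * by case: (gA _ Aa'); rewrite -e1.
    * by case: (gA _ Aa); rewrite e1.
    * by split=> //; exact: gi.
    * by case: (gA _ Ab'); rewrite -e2.
    * by case: (gA _ Aa); rewrite e1.
    * by case: (gA _ Ab); rewrite e2.
    * by split=> //; exact: gi.
- move=> x y x' y' z [xyz|/= n] [xyz'|/= n'].
  + exact: Ri xyz xyz'.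
  + by have [_ _ Az] := RA _ _ _ xyz; have [d /gA Ad zd] := newz _ _ _ n'; case: Ad; rewrite -zd.
  + by have [_ _ Az] := RA _ _ _ xyz'; have [d /gA Ad zd] := newz _ _ _ n; case: Ad; rewrite -zd.
  + case: n n' => [a [b [t [c [d [Aa Ab [abc tcd] -> h]]]]]].
    move=> [a' [b' [t' [c' [d' [Aa' Ab' [abc' tcd'] e h']]]]]].
    have [_ _ Ad] := RA _ _ _ tcd; have [_ _ Ad'] := RA _ _ _ tcd'.
    move: tcd'; rewrite -(gi _ _ Ad Ad' e) => /(Ri _ _ _ _ _ tcd)[et ec].
    move: abc'; rewrite -ec => /(Ri _ _ _ _ _ abc)[ea eb].
    rewrite -ea -eb -et in h'.
    by case: h h' => -[t1 -> ->] [] [t2 -> ->] //; exfalso;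
      [apply: n01|apply: n02|apply: n01|apply: n12|apply: n02|apply: n12];
      rewrite -t1 -t2.
- move=> x y z [/RA[? ? ?]|n]; split; apply/fieldR'; try by left.
  + by case: (newXY _ _ _ n).
  + by case: (newXY _ _ _ n).
  + by right; exact: newz n.
- by move=> x y /fieldR' hx /fieldR' hy; have [z hz] := cases _ _ hx hy; exists z.
Qed.

(** Hessenberg's theorem.  If a pairing with infinite field [A] is maximal, then no
    copy of [A] fits into the complement of [A]; so the complement embeds into [A],
    and the whole of [S] embeds into [A * A], hence into [A]. *)
Lemma infinite_square (f0 : nat -> S) : injective f0 ->
  exists m : S * S -> S, injective m.
Proof.
move=> f0i.
pose R0 : set (S * S * S) :=
  [set p | exists i j, p = (f0 i, f0 j, f0 (choice.pickle (i, j)))].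
have fieldR0 x : field R0 x <-> exists i, x = f0 i.
  split=> [[z [i [j [-> _ _]]]]|[i ->]]; first by exists i.
  by exists (f0 (choice.pickle (i, i))), i, i.
have R0P : pairing R0.
  split.
  - by move=> x y z z' [i [j [-> -> ->]]] [i' [j' [/f0i <- /f0i <- ->]]].
  - move=> x y x' y' z [i [j [-> -> ->]]] [i' [j' [-> -> /f0i]]].
    by move=> /(pcan_inj (@choice.pickleK _))[-> ->].
  - by move=> x y z [i [j [-> -> ->]]]; split; apply/fieldR0; eexists.
  - by move=> x y /fieldR0[i ->] /fieldR0[j ->]; eexists; exists i, j.
(* The empty relation is allowed for the sake of the empty chain only. *)
pose P (R : set (S * S * S)) := R = set0 \/ (R0 `<=` R /\ pairing R).
have [F FP Ftot|R [PR Rmax]] := @Zorn_bigcup _ P.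
  case: (pselect (exists2 X, F X & X <> set0)) => [[X FX X0]|nF].
    right; split.
      by have [//|[R0X _]] := FP _ FX; move=> p /R0X Xp; exists X.
    apply: pairing_bigcup => // Y FY.
    have [->|[]//] := FP _ FY.
    by split=> // x y [z []].
  left; apply/seteqP; split=> // p [X FX Xp]; apply: nF; exists X => // e.
  by rewrite e in Xp.
have {PR} [R0R PR] : R0 `<=` R /\ pairing R.
  case: PR => // R_0; exfalso; apply: (Rmax R0); last by right; split.
  rewrite R_0; split=> // /(_ (f0 0%N, f0 0%N, f0 (choice.pickle (0%N, 0%N)))) h.
  by apply: h; exists 0%N, 0%N.
have fA i : field R (f0 i).
  by exists (f0 (choice.pickle (i, i))); apply: R0R; exists i, i.
have fne i j : (i != j)%N -> f0 i <> f0 j by move=> /eqP h /f0i.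
have noext (g : S -> S) : (forall x, field R x -> ~ field R (g x)) ->
    (forall x y, field R x -> field R y -> g x = g y -> x = y) -> False.
  move=> gA gi.
  have [R' RR' PR'] := pairing_extend PR (fA 0%N) (fA 1%N) (fA 2%N)
    (fne 0%N 1%N isT) (fne 0%N 2%N isT) (fne 1%N 2%N isT) gA gi.
  apply: (Rmax _ RR'); right; split=> //.
  exact: subset_trans R0R (properW RR').
case: (injection_total {x | field R x} {x | ~ field R x}) => -[g gi].
  exfalso; pose h x : S :=
    if pselect (field R x) is left Ax then sval (g (exist _ x Ax)) else x.
  apply: (noext h) => [x Ax|x y Ax Ay]; rewrite /h.
    by case: pselect => // Ax'; case: (g _).
  case: pselect => // Ax'; case: pselect => // Ay' e.
  have /gi[//] : g (exist _ x Ax') = g (exist _ y Ay').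
  by move: e; case: (g _) => u pu; case: (g _) => w pw /= e; exact: eq_exist.
case: PR => Rf Ri Rc Rt.
have /choice[m mP] (p : S * S) : exists z, field R p.1 -> field R p.2 -> R (p, z).
  case: (pselect (field R p.1 /\ field R p.2)) => [[Ax Ay]|np].
    by have [z] := Rt _ _ Ax Ay; case: p {Ax Ay} => x y; exists z.
  by exists p.1 => Ax Ay; case: np.
have mi x y x' y' : field R x -> field R y -> field R x' -> field R y' ->
    m (x, y) = m (x', y') -> x = x' /\ y = y'.
  move=> Ax Ay Ax' Ay' e; apply: (Ri _ _ _ _ (m (x, y))); first exact: mP.
  by rewrite e; exact: mP.
have mA x y : field R x -> field R y -> field R (m (x, y)).
  by move=> Ax Ay; have /Rc[] : R (x, y, m (x, y)) by exact: mP.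
pose k x := if pselect (field R x) is right nAx
  then m (f0 0%N, sval (g (exist _ x nAx))) else m (f0 1%N, x).
have kA x : field R (k x).
  by rewrite /k; case: pselect => [Ax|nAx]; apply: mA => //; case: (g _).
have ki : injective k.
  move=> x y; rewrite /k; case: pselect => Ax; case: pselect => Ay.
  - by move=> /mi -[].
  - by move=> /mi -[] //; [case: (g _)|move=> /f0i].
  - by move=> /mi -[] //; [case: (g _)|move=> /f0i].
  - move=> /mi[] //; try by case: (g _).
    move=> _ e; have /gi[//] : g (exist _ x Ax) = g (exist _ y Ay).
    by move: e; case: (g _) => u pu; case: (g _) => w pw /= e; exact: eq_exist.
exists (fun p => m (k p.1, k p.2)) => -[x y] [x' y'] /= /mi[] // /ki -> /ki ->.
by [].
Qed.

(** A sequence is coded by an iterated pairing together with its length, without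
    which the code of a longer sequence could be that of the empty one. *)
Lemma infinite_seq (f0 : nat -> S) : injective f0 ->
  exists c : seq S -> S, injective c.
Proof.
move=> f0i; have [m mi] := infinite_square f0i.
pose c := fix c s := if s is x :: s' then m (x, c s') else f0 0%N.
exists (fun s => m (f0 (size s), c s)) => s t /mi[/f0i].
elim: s t => [|x s IH] [|y t] //= [st] /mi[-> ce].
by rewrite (IH t).
Qed.

End Cardinality.

Lemma injective_card_le (T U : Type) (f : T -> U) :
  injective f -> [set: T] #<= [set: U].
Proof.
move=> fi; have /card_leP : $|{injfun [set: [set: T]] >-> [set: [set: U]]}|; last exact.
apply/injfunPex; exists (fun x : [set: T] => SigSub (mem_set (I : [set: U] (f (val x)))) : [set: U]) => //.
by move=> x y _ _ /(congr1 val) /= /fi /val_inj.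
Qed.

(** * Triangulated categories *)

Section PreCat.
Variable T : precat.
Implicit Types X Y Z W : T.

Lemma comp0m X Y Z (f : hom X Y) : (0 : hom Y Z) \oc f = 0.
Proof. by apply: (addIr ((0 : hom Y Z) \oc f)); rewrite -compDl !add0r. Qed.
Lemma compm0 X Y Z (f : hom Y Z) : f \oc (0 : hom X Y) = 0.
Proof. by apply: (addIr (f \oc (0 : hom X Y))); rewrite -compDr !add0r. Qed.
Lemma compNm X Y Z (f : hom Y Z) (g : hom X Y) : (- f) \oc g = - (f \oc g).
Proof. by apply: (addrI (f \oc g)); rewrite -compDl !subrr comp0m. Qed.
Lemma compmN X Y Z (f : hom Y Z) (g : hom X Y) : f \oc (- g) = - (f \oc g).
Proof. by apply: (addrI (f \oc g)); rewrite -compDr !subrr compm0. Qed.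
Lemma compBl X Y Z (f f' : hom Y Z) (g : hom X Y) :
  (f - f') \oc g = f \oc g - f' \oc g.
Proof. by rewrite compDl compNm. Qed.
Lemma compBr X Y Z (f : hom Y Z) (g g' : hom X Y) :
  f \oc (g - g') = f \oc g - f \oc g'.
Proof. by rewrite compDr compmN. Qed.

Lemma iso_comp X Y Z (f : hom Y Z) (g : hom X Y) :
  is_iso f -> is_iso g -> is_iso (f \oc g).
Proof.
move=> [f' [f'f ff']] [g' [g'g gg']]; exists (g' \oc f'); split.
  by rewrite compA -(compA g') f'f compm1 g'g.
by rewrite compA -(compA f) gg' compm1 ff'.
Qed.
Lemma iso_mono X Y Z (f : hom Y Z) (g g' : hom X Y) :
  is_iso f -> f \oc g = f \oc g' -> g = g'.
Proof. by move=> [k [kf _]] /(congr1 (fun h => k \oc h)); rewrite !compA kf !comp1m. Qed.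
Lemma iso_epi X Y Z (f : hom X Y) (g g' : hom Y Z) :
  is_iso f -> g \oc f = g' \oc f -> g = g'.
Proof. by move=> [k [_ fk]] /(congr1 (fun h => h \oc k)); rewrite -!compA fk !compm1. Qed.
End PreCat.

Section Triangulated.
Variable T : tricat.
Implicit Types X Y Z W : T.

Lemma dist_comp0 X Y Z (f : hom X Y) (g : hom Y Z) (h : hom Z (susp T X)) :
  dist f g h -> g \oc f = 0.
Proof.
move=> fgh; have [[O O0] _] := tri_add T.
have [c [+ _]] := dist_fill (a := idm X) (b := f) (dist_idm X O0) fgh erefl.
by rewrite compm0.
Qed.

Lemma susp_faithful X Y (f g : hom X Y) : fmap (susp T) f = fmap (susp T) g -> f = g.
Proof.
move=> e; apply: (iso_epi (loop_susp_iso (t := T) X)).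
by rewrite -!loop_susp_nat e.
Qed.
Lemma loop_faithful X Y (f g : hom X Y) : fmap (loop T) f = fmap (loop T) g -> f = g.
Proof.
move=> e; apply: (iso_epi (susp_loop_iso (t := T) X)).
by rewrite -!susp_loop_nat e.
Qed.
(** The preimage of [c] is [fmap loop c], transported along [loop_susp]. *)
Lemma susp_full X Y (c : hom (susp T X) (susp T Y)) : exists y : hom X Y, c = fmap (susp T) y.
Proof.
have [k [kl lk]] := loop_susp_iso (t := T) X.
exists (loop_susp (t := T) Y \oc fmap (loop T) c \oc k).
apply: loop_faithful; apply: (iso_mono (loop_susp_iso (t := T) Y)).
by rewrite loop_susp_nat -!compA kl compm1.
Qed.

(** The first map of a distinguished triangle is a weak kernel of the second:
    compare with the triangle [W = W -> 0], rotated so that the map to be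
    constructed is the third one. *)
Lemma dist_weak_kernel X Y Z W (f : hom X Y) (g : hom Y Z) (h : hom Z (susp T X))
    (x : hom W Y) :
  dist f g h -> g \oc x = 0 -> exists y : hom W X, x = f \oc y.
Proof.
move=> fgh gx; have [[O O0] _] := tri_add T.
have tW : dist (0 : hom W O) (0 : hom O (susp T W)) (- fmap (susp T) (idm W)).
  exact: (iffLR (dist_rot _ _ _) (dist_idm W O0)).
have tf : dist g h (- fmap (susp T) f).
  exact: (iffLR (dist_rot _ _ _) fgh).
have e : (0 : hom O Z) \oc (0 : hom W O) = g \oc x by rewrite gx comp0m.
have [c [_]] := dist_fill tW tf e.
have [y ->] := susp_full c; rewrite compmN compNm => /oppr_inj.
rewrite -!fmapM => /susp_faithful; rewrite compm1 => ->.
by exists y.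
Qed.
End Triangulated.

(** * Homology of split extensions *)

Section SplitExact.
Variables (l : comStarRingType) (G : groupType) (T : tricat) (H : homology l G T).
Implicit Types A B C : grStarAlgType l G.

Lemma hmap_id A (f : grhom A A) : f =1 id -> hmap H f = idm (H A).
Proof. by move=> fE; rewrite (_ : f = grhom_id A) ?hmap1 //; apply: grhom_ext. Qed.

Lemma hmap_comp A B C (h : grhom A C) (f : grhom B C) (g : grhom A B) :
  (forall a, h a = f (g a)) -> hmap H h = hmap H f \oc hmap H g.
Proof.
by move=> hE; rewrite -hmapM; congr (hmap H _); apply: grhom_ext => a; rewrite hE.
Qed.

Lemma hmap_ext A B (f f' : grhom A B) : f =1 f' -> hmap H f = hmap H f'.
Proof. by move=> /grhom_ext->. Qed.

Lemma grhom_iso A B (f : grhom A B) (g : grhom B A) :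
  cancel f g -> cancel g f -> is_iso (hmap H f).
Proof.
move=> fg gf; exists (hmap H g); rewrite -!hmapM.
by split; rewrite (@hmap_id _ (grhom_comp _ _)).
Qed.

Variables (A B C : grStarAlgType l G) (i : grhom A B) (p : grhom B C).
Hypothesis e : split_ext i p.

Let ext_triangle : exists2 q : hom (H B) (susp T (loop T (H C))),
  susp_loop (H C) \oc q = hmap H p & dist (bdry H e) (hmap H i) q.
Proof.
have [k [kl lk]] := susp_loop_iso (H C).
have qE : susp_loop (H C) \oc (k \oc hmap H p) = hmap H p by rewrite compA lk comp1m.
by exists (k \oc hmap H p) => //; exact: bdry_dist.
Qed.

Lemma hmap_ext_comp0 : hmap H p \oc hmap H i = 0.
Proof.
have [q <- tq] := ext_triangle.
by rewrite -compA (dist_comp0 (iffLR (dist_rot _ _ _) tq)) compm0.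
Qed.

Lemma hmap_ext_kernel (W : T) (x : hom W (H B)) : hmap H p \oc x = 0 ->
  exists y : hom W (H A), x = hmap H i \oc y.
Proof.
have [q qE tq] := ext_triangle; rewrite -qE -compA => qx.
apply: (dist_weak_kernel (iffLR (dist_rot _ _ _) tq)).
by apply: (iso_mono (susp_loop_iso (H C))); rewrite qx compm0.
Qed.

(** A section of [p] makes the connecting map vanish, so that [H] is left exact
    on the extension. *)
Lemma hmap_split_mono (s : grhom C B) : cancel s p ->
  forall (W : T) (y y' : hom W (H A)), hmap H i \oc y = hmap H i \oc y' -> y = y'.
Proof.
move=> sp W y y' eyy; have [q qE tq] := ext_triangle.
have hs : hmap H p \oc hmap H s = idm (H C).
  by rewrite -hmapM (@hmap_id _ (grhom_comp _ _)).
have b0 : bdry H e = 0.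
  have := dist_comp0 (iffLR (dist_rot _ _ _) (iffLR (dist_rot _ _ _) tq)).
  rewrite compNm => /eqP; rewrite oppr_eq0 => /eqP bq.
  apply: susp_faithful; rewrite -[LHS]compm1.
  have [k [kl lk]] := susp_loop_iso (H C).
  have -> : idm (susp T (loop T (H C))) = q \oc (hmap H s \oc susp_loop (H C)).
    apply: (iso_mono (susp_loop_iso (H C))).
    by rewrite compm1 !compA qE hs comp1m.
  rewrite compA bq comp0m; apply: (addIr (fmap (susp T) 0)).
  by rewrite add0r -fmapD add0r.
have /(dist_weak_kernel tq)[z] : hmap H i \oc (y - y') = 0 by rewrite compBr eyy subrr.
by rewrite b0 comp0m => /eqP; rewrite subr_eq0 => /eqP.
Qed.
End SplitExact.

(** * Linear maps and homomorphisms *)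

Section LinearMaps.
Variables (R : pzRingType) (U V : lmodType R) (f : U -> V).
Hypothesis f_lin : linear f.
Lemma linD : {morph f : a b / a + b}.
Proof. by move=> a b; have := f_lin 1 a b; rewrite !scale1r. Qed.
Lemma lin0 : f 0 = 0.
Proof. by apply: (addIr (f 0)); rewrite -linD !add0r. Qed.
Lemma linZ (k : R) a : f (k *: a) = k *: f a.
Proof. by have := f_lin k a 0; rewrite !addr0 lin0 addr0. Qed.
End LinearMaps.

Section LinearExtension.
Variables (R : pzRingType) (I : choiceType) (M : I -> lmodType R) (V : lmodType R).
Variable h : forall i, M i -> V.
Hypothesis h_lin : forall i, linear (@h i).

Definition lext (f : finfam M) : V := \sum_(i <- supp f) h (f i).

Let lext_sub (S : {fset I}) (f : finfam M) :
  (forall i, i \notin S -> f i = 0) -> lext f = \sum_(i <- S) h (f i).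
Proof.
move=> fS; apply: big_fset_incl => [|i _].
  apply/fsubsetP => i; rewrite suppP; apply: contraNT => /fS ->.
  by rewrite eqxx.
by rewrite suppP negbK => /eqP ->; rewrite lin0.
Qed.

Lemma lext_linear : linear lext.
Proof.
move=> k f g; pose S := (supp f `|` supp g)%fset.
have fS i : i \notin S -> f i = 0.
  by rewrite inE negb_or suppP negbK => /andP[/eqP].
have gS i : i \notin S -> g i = 0.
  by rewrite inE negb_or [i \in supp g]suppP andbC negbK => /andP[/eqP].
rewrite !(@lext_sub S) //; last by move=> i iS /=; rewrite fS // gS // scaler0 addr0.
by rewrite scaler_sumr -big_split; apply: eq_bigr => i _ /=; exact: h_lin.
Qed.

Lemma lext_single i (a : M i) : lext (single a) = h a.
Proof.
rewrite (@lext_sub [fset i]%fset).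
  by rewrite big_seq_fset1 singleE.
by move=> j; rewrite inE eq_sym => ij; rewrite single_ne.
Qed.
End LinearExtension.

Section GrHomMore.
Variables (l : comStarRingType) (G : groupType).
Implicit Types A B D K : grStarAlgType l G.

Lemma grhom_compE A B D (f : grhom B D) (g : grhom A B) a :
  grhom_comp f g a = f (g a).
Proof. by []. Qed.

Definition gr_zero A B : grhom A B.
Proof.
apply: (@GrHom _ _ A B (fun=> 0)); first by move=> k a b; rewrite scaler0 addr0.
- by move=> a b; rewrite nmul0l.
- by move=> a; rewrite star0.
- by move=> g a _; exact: gr0.
Defined.

Definition orth A B D (f : A -> D) (g : B -> D) :=
  (forall a b, f a ** g b = 0) /\ (forall a b, g b ** f a = 0).
End GrHomMore.

(** * Semidirect products *)

(** An action of [B] on [K] by multipliers: [act b] is left multiplication by [b],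
   and [act_adj] makes [k |-> star (act (star b) (star k))] the matching right
   multiplication. *)
Record action (l : comStarRingType) (G : groupType) (B K : grStarAlgType l G) := Action {
  act :> B -> K -> K;
  act_linearl : forall k, linear (act^~ k);
  act_linearr : forall b, linear (act b);
  act_mul : forall b b' k, act (b ** b') k = act b (act b' k);
  actM : forall b k k', act b (k ** k') = act b k ** k';
  act_adj : forall b k k', star (act b k) ** k' = star k ** act (star b) k';
  act_comm : forall b b' k,
    act b (star (act b' (star k))) = star (act b' (star (act b k)));
  act_gr : forall g h b k, gr g b -> gr h k -> gr (g * h)%g (act b k)
}.

Definition sdprod (l : comStarRingType) (G : groupType) (B K : grStarAlgType l G)
  (_ : action B K) : Type := (B * K)%type.

Section SemiDirect.
Variables (l : comStarRingType) (G : groupType) (B K : grStarAlgType l G).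
Variable L : action B K.
Local Notation T := (sdprod L).

Definition ract (b : B) (k : K) : K := star (L (star b) (star k)).

Lemma ractDl k : {morph ract^~ k : a b / a + b}.
Proof. by move=> a b; rewrite /ract starD (linD (act_linearl L _)) starD. Qed.
Lemma ractDr b : {morph ract b : x y / x + y}.
Proof. by move=> x y; rewrite /ract starD (linD (act_linearr L _)) starD. Qed.
Lemma ractZl (c : l) b k : ract (c *: b) k = c *: ract b k.
Proof. by rewrite /ract starZ (linZ (act_linearl L _)) starZ conjrK. Qed.
Lemma ractZr (c : l) b k : ract b (c *: k) = c *: ract b k.
Proof. by rewrite /ract starZ (linZ (act_linearr L _)) starZ conjrK. Qed.
Lemma ract0l k : ract 0 k = 0.
Proof. by rewrite -(scale0r 0) ractZl scale0r. Qed.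
Lemma ract0r b : ract b 0 = 0.
Proof. by rewrite -(scale0r 0) ractZr !scale0r. Qed.
Lemma ract_mul b b' k : ract (b ** b') k = ract b' (ract b k).
Proof. by rewrite /ract starM act_mul starK. Qed.
Lemma ractM b k k' : ract b (k ** k') = k ** ract b k'.
Proof. by rewrite /ract starM actM starM starK. Qed.
Lemma ract_adj b k k' : ract b k ** k' = k ** L b k'.
Proof. by rewrite /ract act_adj !starK. Qed.
Lemma ract_act b b' k : ract b' (L b k) = L b (ract b' k).
Proof. by rewrite /ract act_comm. Qed.
Lemma ract_gr g h b k : gr g k -> gr h b -> gr (g * h)%g (ract b k).
Proof.
move=> gk hb; have := act_gr L (gr_star _ _ hb) (gr_star _ _ gk).
by move/gr_star; rewrite -invgM invgK.
Qed.

HB.instance Definition _ := GRing.Lmodule.copy T (B * K)%type.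

Definition sdmul (x y : T) : T :=
  (x.1 ** y.1, L x.1 y.2 + ract y.1 x.2 + x.2 ** y.2).
Definition sdstar (x : T) : T := (star x.1, star x.2).
Definition sdgr (g : G) : set T := [set x | gr g x.1 /\ gr g x.2].

Let LDl k := linD (act_linearl L k).
Let LDr b := linD (act_linearr L b).
Let LZl k := linZ (act_linearl L k).
Let LZr b := linZ (act_linearr L b).

Lemma sd_ext (x y : T) : x.1 = y.1 -> x.2 = y.2 -> x = y.
Proof. by case: x y => [? ?] [? ?] /= -> ->. Qed.

Lemma sdmulA : associative sdmul.
Proof.
move=> x y z; apply: sd_ext; first exact: nmulA.
rewrite /= !LDr !ractDr !nmulDl !nmulDr act_mul ract_mul ract_act ractM actM.
rewrite ract_adj nmulA -!addrA; congr (_ + (_ + _)).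
rewrite [LHS]addrCA; congr (_ + _); rewrite [RHS]addrCA; congr (_ + _).
exact: addrCA.
Qed.
Lemma sdmulDl : left_distributive sdmul +%R.
Proof.
move=> x y z; apply: sd_ext; first exact: nmulDl.
by rewrite /= LDl ractDr nmulDl (addrACA (L x.1 z.2)) [LHS]addrACA.
Qed.
Lemma sdmulDr : right_distributive sdmul +%R.
Proof.
move=> x y z; apply: sd_ext; first exact: nmulDr.
by rewrite /= LDr ractDl nmulDr (addrACA (L x.1 y.2)) [LHS]addrACA.
Qed.
Lemma sdmulZl (k : l) (x y : T) : sdmul (k *: x) y = k *: sdmul x y.
Proof.
apply: sd_ext; first exact: nmulZl.
by rewrite /= LZl ractZr nmulZl !scalerDr.
Qed.
Lemma sdmulZr (k : l) (x y : T) : sdmul x (k *: y) = k *: sdmul x y.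
Proof.
apply: sd_ext; first exact: nmulZr.
by rewrite /= LZr ractZl nmulZr !scalerDr.
Qed.
HB.instance Definition _ :=
  Lmodule_isNuAlgebra.Build l T sdmulA sdmulDl sdmulDr sdmulZl sdmulZr.

Lemma sdstarK : involutive sdstar.
Proof. by move=> x; apply: sd_ext; exact: starK. Qed.
Lemma sdstarD : {morph sdstar : a b / a + b}.
Proof. by move=> x y; apply: sd_ext; exact: starD. Qed.
Lemma sdstarM (x y : T) : sdstar (x ** y) = sdstar y ** sdstar x.
Proof.
apply: sd_ext; first exact: starM.
rewrite /= !starD starM /ract !starK; congr (_ + _); exact: addrC.
Qed.
Lemma sdstarZ (k : l) (x : T) : sdstar (k *: x) = conjr k *: sdstar x.
Proof. by apply: sd_ext; exact: starZ. Qed.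
Lemma sdgr0 g : sdgr g 0. Proof. by split; exact: gr0. Qed.
Lemma sdgrD g x y : sdgr g x -> sdgr g y -> sdgr g (x + y).
Proof. by move=> [? ?] [? ?]; split; exact: grD. Qed.
Lemma sdgrZ g (k : l) x : sdgr g x -> sdgr g (k *: x).
Proof. by move=> [? ?]; split; exact: grZ. Qed.
Lemma sdgr_span (x : T) : hsum sdgr x.
Proof.
have -> : x = ((x.1, 0) : T) + ((0, x.2) : T).
  by apply: sd_ext; rewrite /= ?addr0 ?add0r.
apply: hsumD.
- apply: (@hsum_morph _ _ _ (@gr l G B) _ (fun b => (b, 0) : T)) => //.
  + by move=> a b; apply: sd_ext; rewrite //= addr0.
  + by move=> g a ga; exists g; split=> //; exact: gr0.
  + exact: gr_span.
- apply: (@hsum_morph _ _ _ (@gr l G K) _ (fun k => (0, k) : T)) => //.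
  + by move=> a b; apply: sd_ext; rewrite //= addr0.
  + by move=> g a ga; exists g; split=> //; exact: gr0.
  + exact: gr_span.
Qed.
Lemma sdgr_free (r : seq G) (f : G -> T) : uniq r -> (forall g, sdgr g (f g)) ->
  \sum_(g <- r) f g = 0 -> forall g, g \in r -> f g = 0.
Proof.
move=> ur gf sf g gr_.
have f1 : \sum_(g <- r) (f g).1 = 0.
  by rewrite -[RHS](congr1 fst sf); elim/big_rec2: _ => // h x y _ ->.
have f2 : \sum_(g <- r) (f g).2 = 0.
  by rewrite -[RHS](congr1 snd sf); elim/big_rec2: _ => // h x y _ ->.
apply: sd_ext.
- by apply: (gr_free _ _ ur (fun h => (gf h).1) f1).
- by apply: (gr_free _ _ ur (fun h => (gf h).2) f2).
Qed.
Lemma sdgrM g h (x y : T) : sdgr g x -> sdgr h y -> sdgr (g * h)%g (x ** y).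
Proof.
move=> [gx1 gx2] [gy1 gy2]; split; first exact: grM.
by apply: grD; [apply: grD; [exact: act_gr|exact: ract_gr]|exact: grM].
Qed.
Lemma sdgr_star g x : sdgr g x -> sdgr g^-1%g (sdstar x).
Proof. by move=> [? ?]; split; exact: gr_star. Qed.
HB.instance Definition _ := NuAlgebra_isGrStar.Build l G T
  sdstarK sdstarD sdstarM sdstarZ sdgr0 sdgrD sdgrZ sdgr_span sdgr_free sdgrM sdgr_star.

Definition semidirect : grStarAlgType l G := T.
Local Notation D := semidirect.

Lemma sd_mulE (x y : D) : x ** y = (x.1 ** y.1, L x.1 y.2 + ract y.1 x.2 + x.2 ** y.2).
Proof. by []. Qed.
Lemma sd_starE (x : D) : star x = (star x.1, star x.2).
Proof. by []. Qed.
Lemma sd_grE g (x : D) : gr g x.1 -> gr g x.2 -> gr g x.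
Proof. by []. Qed.

Definition sd_in : grhom K D.
Proof.
apply: (@GrHom _ _ K D (fun k => (0, k))).
- by move=> c a b; apply: sd_ext; rewrite //= scaler0 addr0.
- move=> a b; rewrite sd_mulE; apply: sd_ext; rewrite /= ?nmul0l //.
  by rewrite (lin0 (act_linearl L b)) ract0l !add0r.
- by move=> a; rewrite sd_starE; apply: sd_ext; rewrite //= star0.
- by move=> g a ga; split=> //; exact: gr0.
Defined.

Definition sd_pr : grhom D B.
Proof. by apply: (@GrHom _ _ D B fst) => // g x []. Defined.

Definition sd_base : grhom B D.
Proof.
apply: (@GrHom _ _ B D (fun b => (b, 0))).
- by move=> c a b; apply: sd_ext; rewrite //= scaler0 addr0.
- move=> a b; rewrite sd_mulE; apply: sd_ext; rewrite //=.
  by rewrite (lin0 (act_linearr L a)) ract0r nmul0l !add0r.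
- by move=> a; rewrite sd_starE; apply: sd_ext; rewrite //= star0.
- by move=> g a ga; split=> //; exact: gr0.
Defined.

Lemma sd_ext_split : split_ext sd_in sd_pr.
Proof.
split.
- by move=> a b [].
- move=> [b k]; split=> [/= ->|[a ->]]; last by [].
  by exists k.
- by move=> b; exists (b, 0).
- exists sd_base; split=> //; first exact: grhom_linear.
  by move=> g c; exact: grhom_gr.
Qed.
End SemiDirect.

Section SemiDirectMap.
Variables (l : comStarRingType) (G : groupType) (B K K' : grStarAlgType l G).
Variables (L : action B K) (L' : action B K') (f : grhom K K').
Hypothesis f_equi : forall b k, f (L b k) = L' b (f k).

Definition sd_map : grhom (semidirect L) (semidirect L').
Proof.
apply: (@GrHom _ _ (semidirect L) (semidirect L') (fun x => (x.1, f x.2))).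
- by move=> c a b; apply: sd_ext; rewrite //= grhom_linear.
- move=> a b; rewrite !sd_mulE; apply: sd_ext; rewrite //=.
  by rewrite !(linD (grhom_linear f)) grhomM f_equi /ract grhom_star f_equi grhom_star.
- by move=> a; rewrite !sd_starE /= grhom_star.
- by move=> g a [ga1 ga2]; split=> //; exact: grhom_gr.
Defined.
End SemiDirectMap.

(** * Orthogonal sums *)

Section OrthogonalSum.
Variables (l : comStarRingType) (G : groupType).
Implicit Types A B D : grStarAlgType l G.

Definition trivial_action A B : action A B.
Proof.
apply: (@Action _ _ A B (fun _ _ => 0)).
- by move=> k c a b; rewrite scaler0 addr0.
- by move=> k c a b; rewrite scaler0 addr0.
- by [].
- by move=> b k k'; rewrite nmul0l.
- by move=> b k k'; rewrite star0 nmul0l nmul0r.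
- by move=> b b' k; rewrite star0.
- by move=> g h b k _ _; exact: gr0.
Defined.

(** The direct product, as the semidirect product for the zero action. *)
Definition prodalg A B := semidirect (trivial_action A B).

Definition prod_snd A B : grhom (prodalg A B) B.
Proof.
apply: (@GrHom _ _ (prodalg A B) B snd) => //.
  by move=> a b; rewrite sd_mulE /= /ract /= star0 !add0r.
by move=> h a [].
Defined.

Definition orth_pair A B D (f : grhom A D) (g : grhom B D) (fg : orth f g) :
  grhom (prodalg A B) D.
Proof.
apply: (@GrHom _ _ (prodalg A B) D (fun x => f x.1 + g x.2)).
- by move=> c a b /=; rewrite !grhom_linear scalerDr addrACA.
- move=> a b; rewrite sd_mulE /= /ract /= star0 !add0r !grhomM nmulDl !nmulDr.
  by rewrite fg.1 fg.2 addr0 add0r.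
- by move=> a; rewrite sd_starE /= !grhom_star starD.
- by move=> h a [ga1 ga2]; apply: grD; exact: grhom_gr.
Defined.

Definition orth_diag A : grhom A (prodalg A A).
Proof.
apply: (@GrHom _ _ A (prodalg A A) (fun a => (a, a))) => //.
by move=> a b; rewrite sd_mulE /= /ract /= star0 !add0r.
Defined.

Definition orth_add A D (f g : grhom A D) (fg : orth f g) : grhom A D :=
  grhom_comp (orth_pair fg) (orth_diag A).

Lemma orth_addE A D (f g : grhom A D) (fg : orth f g) a :
  orth_add fg a = f a + g a.
Proof. by []. Qed.

Variables (T : tricat) (H : homology l G T).

(** The zero map of [A] is the composite of two consecutive maps of the extension
    [A -> A * A -> A]. *)
Lemma hmap_zero A B : hmap H (gr_zero A B) = 0.
Proof.
rewrite (@hmap_comp _ _ _ H _ _ _ _ (gr_zero A B) (gr_zero A A)) //.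
have <- : hmap H (sd_pr (trivial_action A A)) \oc hmap H (sd_in (trivial_action A A)) =
    hmap H (gr_zero A A).
  by rewrite -hmapM; exact: hmap_ext.
by rewrite (hmap_ext_comp0 H (sd_ext_split _)) compm0.
Qed.

(** The product [A * A] is a split extension of [A] by [A], so [H] of the diagonal
    is the sum of [H] of the two coordinate inclusions. *)
Lemma hmap_orth_add A D (f g : grhom A D) (fg : orth f g) :
  hmap H (orth_add fg) = hmap H f + hmap H g.
Proof.
pose L := trivial_action A A.
have diagE : hmap H (orth_diag A) = hmap H (sd_base L) + hmap H (sd_in L).
  have pd : hmap H (sd_pr L) \oc (hmap H (orth_diag A) - hmap H (sd_base L)) = 0.
    by apply/eqP; rewrite compBr -!hmapM subr_eq0; apply/eqP; exact: hmap_ext.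
  have [y dy] := hmap_ext_kernel (sd_ext_split L) pd.
  suff y1 : y = idm (H A) by rewrite addrC -[LHS](subrK (hmap H (sd_base L))) dy y1 compm1.
  have := congr1 (fun h => hmap H (prod_snd A A) \oc h) dy.
  rewrite compA compBr -!hmapM (@hmap_id _ _ _ _ A (grhom_comp _ (orth_diag A))) //.
  rewrite (@hmap_id _ _ _ _ A (grhom_comp _ (sd_in L))) // comp1m => <-.
  rewrite (_ : grhom_comp _ (sd_base L) = gr_zero A A) ?hmap_zero ?subr0 //.
  exact: grhom_ext.
rewrite hmapM diagE compDr -!hmapM; congr (_ + _); apply: hmap_ext => a /=.
  by rewrite (lin0 (grhom_linear g)) addr0.
by rewrite (lin0 (grhom_linear f)) add0r.
Qed.
End OrthogonalSum.

(** * Polynomial homotopies *)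

Section PolynomialHomotopy.
Variables (l : comStarRingType) (G : groupType).
Implicit Types A B D : grStarAlgType l G.

Definition poly_eval A (x : l) : polyalg A -> A :=
  lext (M := fun _ : nat_semi G => A : lmodType l) (V := A) (fun n a => x ^+ n *: a).

Section Eval.
Variables (A : grStarAlgType l G) (x : l).
Hypothesis x_real : conjr x = x.

Lemma poly_eval_linear : linear (poly_eval (A := A) x).
Proof. by apply: lext_linear => n k a b; rewrite scalerDr !scalerA mulrC. Qed.

Lemma poly_eval_eps (n : nat_sz) (a : A) :
  poly_eval x (eps n a : polyalg A) = x ^+ n *: a.
Proof.
apply: (lext_single (M := fun _ : nat_semi G => A : lmodType l) (V := A)).
by move=> m k c d; rewrite scalerDr !scalerA mulrC.
Qed.

Lemma poly_evalM : {morph poly_eval (A := A) x : a b / a ** b}.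
Proof.
have E0 := lin0 poly_eval_linear; have ED := linD poly_eval_linear.
move=> f h; elim/sgalg_ind: f => [|f f' IH IH'|n a]; rewrite ?(E0, nmul0l) //.
  by rewrite !(nmulDl, ED) IH IH'.
elim/sgalg_ind: h => [|h h' IH IH'|m b]; rewrite ?(E0, nmul0r) //.
  by rewrite !(nmulDr, ED) IH IH'.
by rewrite [eps n a ** _]eps_mul /= !poly_eval_eps nmulZl nmulZr scalerA exprD.
Qed.

Lemma poly_eval_star : {morph poly_eval (A := A) x : a / star a}.
Proof.
have E0 := lin0 poly_eval_linear; have ED := linD poly_eval_linear.
move=> f; elim/sgalg_ind: f => [|f f' IH IH'|n a]; rewrite ?(E0, star0) //.
  by rewrite !(starD, ED) IH IH'.
rewrite [star (eps n a : polyalg A)](gsstar_eps (S := nat_semi G)) !poly_eval_eps starZ.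
by congr (_ *: _); elim: (n : nat) => [|m IH]; rewrite ?expr0 ?conjr1 // !exprS conjrM x_real -IH.
Qed.

Lemma poly_eval_gr g (f : polyalg A) : gr g f -> gr g (poly_eval x f).
Proof.
move=> gf; apply: gr_sum => n _; apply: grZ.
by have := gf n; rewrite /= invg1 mul1g mulg1.
Qed.

Definition poly_ev : grhom (polyalg A) A :=
  GrHom poly_eval_linear poly_evalM poly_eval_star poly_eval_gr.

Lemma poly_ev_eps (n : nat_sz) (a : A) : poly_ev (eps n a : polyalg A) = x ^+ n *: a.
Proof. exact: poly_eval_eps. Qed.
End Eval.

Definition poly_ev0 A := poly_ev A (conjr0 l).
Definition poly_ev1 A := poly_ev A (conjr1 l).

(** Both evaluations are left inverse to the inclusion of constants, which [H]
    inverts. *)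
Lemma hmap_homotopy (T : tricat) (H : homology l G T) A D (h : grhom A (polyalg D)) :
  homotopy_invariant H ->
  hmap H (grhom_comp (poly_ev0 D) h) = hmap H (grhom_comp (poly_ev1 D) h).
Proof.
move=> Hinv; rewrite !hmapM; congr (_ \oc _); apply: (iso_epi (Hinv D)).
by rewrite -!hmapM; apply: hmap_ext => a; rewrite /= !poly_eval_eps !expr0.
Qed.
End PolynomialHomotopy.

(** * The universal property of the Cohn algebra *)

Section CohnUniversal.
Variables (l : comStarRingType) (E : graph).
Local Notation gen := (cohn_gen E).

Definition cohn_gen_pi (x : gen) : cohn_sort l E := cohn_pi (genF l x).

(** A word is the product of its first letter and the rest, or a single letter. *)
Lemma cohn_ind (P : cohn_sort l E -> Prop) :
  P 0 -> (forall a b, P a -> P b -> P (a + b)) -> (forall k a, P a -> P (k *: a)) ->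
  (forall a b, P a -> P b -> P (a ** b)) -> (forall x, P (cohn_gen_pi x)) ->
  forall c, P c.
Proof.
move=> P0 PD PZ PM Pg c; have [f ->] := cohn_pi_surj c.
elim/sgalg_ind: f => [|f f' Pf Pf'|w c1]; first by rewrite cohn_pi0.
  by rewrite cohn_piD; exact: PD.
case: w => -[//|x s] iw; elim: s x iw => [|y s IH] x iw.
  have -> : eps (S := word_sz E) (exist _ [:: x] iw) c1 = (c1 : l) *: genF l x.
    rewrite /genF /wordF -epsZ; congr (eps _ _); first exact: val_inj.
    exact/esym/(mulr1 (c1 : l)).
  by rewrite cohn_piZ; apply: PZ; exact: Pg.
have -> : eps (S := word_sz E) (exist _ [:: x, y & s] iw) c1 =
    genF l x ** eps (S := word_sz E) (exist _ (y :: s) isT) c1.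
  rewrite /genF /wordF [RHS]eps_mul /=; congr (eps _ _); first exact: val_inj.
  exact/esym/(mul1r (c1 : l)).
by rewrite cohn_piM; apply: PM; [exact: Pg|exact: IH].
Qed.

Section Eval.
Variables (B : nuAlgType l) (g : gen -> B).

Definition gen_prod (s : seq gen) : B :=
  if s is x :: s' then foldl (fun b y => b ** g y) (g x) s' else 0.

Lemma gen_prod_cat s t : s != [::] -> t != [::] ->
  gen_prod (s ++ t) = gen_prod s ** gen_prod t.
Proof.
case: s => // x s _; case: t => // y t _; rewrite /= foldl_cat /=.
move: (foldl _ _ s) => b; elim/last_ind: t => //= t z IH.
by rewrite -!cats1 !foldl_cat /= IH nmulA.
Qed.

Definition free_eval : free_cohn l E -> B :=
  lext (M := fun _ : word_sz E => scal l : lmodType l) (V := B)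
    (fun w c => (c : l) *: gen_prod (val w)).

Let scale_linear (b : B) : linear (fun c : scal l => (c : l) *: b).
Proof. by move=> k c d; rewrite scalerDl scalerA. Qed.

Lemma free_eval_linear : linear free_eval.
Proof. by apply: lext_linear => w; exact: scale_linear. Qed.
Lemma free_eval_eps (w : word_sz E) (c : scal l) :
  free_eval (eps w c) = (c : l) *: gen_prod (val w).
Proof.
by apply: (lext_single (M := fun _ : word_sz E => scal l : lmodType l) (V := B)) => v;
  exact: scale_linear.
Qed.
Lemma free_eval_gen x : free_eval (genF l x) = g x.
Proof. by rewrite free_eval_eps scale1r. Qed.
Lemma free_evalM : {morph free_eval : a b / a ** b}.
Proof.
have E0 := lin0 free_eval_linear; have ED := linD free_eval_linear.
move=> f h; elim/sgalg_ind: f => [|f f' IH IH'|u a]; rewrite ?(E0, nmul0l) //.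
  by rewrite !(nmulDl, ED) IH IH'.
elim/sgalg_ind: h => [|h h' IH IH'|v b]; rewrite ?(E0, nmul0r) //.
  by rewrite !(nmulDr, ED) IH IH'.
rewrite [eps u a ** _]eps_mul !free_eval_eps nmulZl nmulZr scalerA.
by rewrite gen_prod_cat //; [case: u|case: v].
Qed.

Hypothesis gVV : forall v w, g (GVert v) ** g (GVert w) = if v == w then g (GVert v) else 0.
Hypothesis gSE : forall e, g (GVert (src e)) ** g (GEdge e) = g (GEdge e).
Hypothesis gER : forall e, g (GEdge e) ** g (GVert (rng e)) = g (GEdge e).
Hypothesis gRG : forall e, g (GVert (rng e)) ** g (GGhost e) = g (GGhost e).
Hypothesis gGS : forall e, g (GGhost e) ** g (GVert (src e)) = g (GGhost e).
Hypothesis gGE : forall e f,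
  g (GGhost e) ** g (GEdge f) = if e == f then g (GVert (rng e)) else 0.

Lemma free_eval_ideal a : cohn_ideal a -> free_eval a = 0.
Proof.
have E0 := lin0 free_eval_linear; have ED := linD free_eval_linear.
have EZ := linZ free_eval_linear.
elim=> {a} [a b rab||a b _ IHa _ IHb|k a _ IH|a b _ IH|a b _ IH].
- rewrite ED -scaleN1r EZ scaleN1r; apply/eqP; rewrite subr_eq0; apply/eqP.
  case: rab => *; rewrite free_evalM ?(fun_if free_eval) ?E0 !free_eval_gen //.
- by rewrite E0.
- by rewrite ED IHa IHb addr0.
- by rewrite EZ IH scaler0.
- by rewrite free_evalM IH nmul0r.
- by rewrite free_evalM IH nmul0l.
Qed.

Definition cohn_eval (c : cohn_sort l E) : B := free_eval (repr c).

Lemma cohn_eval_pi f : cohn_eval (cohn_pi f) = free_eval f.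
Proof.
apply/eqP; rewrite -subr_eq0 -scaleN1r -(linZ free_eval_linear) -(linD free_eval_linear).
by rewrite scaleN1r; apply/eqP/free_eval_ideal; exact: cohn_repr.
Qed.
Lemma cohn_eval_linear : linear cohn_eval.
Proof.
move=> k u v; have [a ->] := cohn_pi_surj u; have [b ->] := cohn_pi_surj v.
by rewrite -cohn_piZ -cohn_piD !cohn_eval_pi; exact: free_eval_linear.
Qed.
Lemma cohn_evalM : {morph cohn_eval : a b / a ** b}.
Proof.
move=> u v; have [a ->] := cohn_pi_surj u; have [b ->] := cohn_pi_surj v.
by rewrite -cohn_piM !cohn_eval_pi free_evalM.
Qed.
Lemma cohn_eval_gen x : cohn_eval (cohn_gen_pi x) = g x.
Proof. by rewrite cohn_eval_pi free_eval_gen. Qed.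

(** [hB] stands for the components of a grading of [B], or, in an algebra of
    operators, for the operators that shift degrees by [d]. *)
Variables (G : groupType) (om : edge E -> G) (hB : G -> set B).
Hypothesis hB0 : forall d, hB d 0.
Hypothesis hBD : forall d a b, hB d a -> hB d b -> hB d (a + b).
Hypothesis hBZ : forall d (k : l) a, hB d a -> hB d (k *: a).
Hypothesis hBM : forall d d' a b, hB d a -> hB d' b -> hB (d * d')%g (a ** b).
Hypothesis hBg : forall x, hB (gen_deg om x) (g x).

Let gen_prod_homogeneous (w : word E) : hB (wdeg om w) (gen_prod (val w)).
Proof.
rewrite /wdeg; case: w => -[//|x s] _ /=.
elim: s (g x) (gen_deg om x) (hBg x) => [|y s IH] b d db /=; first by rewrite mulg1.
by rewrite mulgA; apply: IH; exact: hBM.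
Qed.

Lemma cohn_eval_homogeneous d (a : cohn l om) : gr d a -> hB d (cohn_eval a).
Proof.
move=> [f fd <-]; rewrite cohn_eval_pi /free_eval /lext.
elim/big_ind: _ => [||w _] //; first exact: hBD.
case: (eqVneq (wdeg om w) d) => [<-|/eqP/fd->].
  by apply: hBZ; exact: gen_prod_homogeneous.
by rewrite scale0r.
Qed.
End Eval.
End CohnUniversal.

(** * Cohn families in graded *-algebras *)

Section CohnFamilies.
Variables (l : comStarRingType) (E : graph) (G : groupType) (om : edge E -> G).
Local Notation C := (cohn l om).

Lemma cohn_gen_star x : star (cohn_gen_pi l x : C) = cohn_gen_pi l (gen_star x).
Proof. by rewrite [LHS]cohn_starE freestar_gen. Qed.

(** The Cohn relations for projections [P] and partial isometries [U]; those that
    involve ghost edges only follow from these by applying [star]. *)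
Record cohn_family (D : grStarAlgType l G) (P : vert E -> D) (U : edge E -> D) : Prop :=
  CohnFamily {
    cfVV : forall v w, P v ** P w = if v == w then P v else 0;
    cfSE : forall e, P (src e) ** U e = U e;
    cfER : forall e, U e ** P (rng e) = U e;
    cfGE : forall e f, star (U e) ** U f = if e == f then P (rng e) else 0;
    cf_star : forall v, star (P v) = P v;
    cf_grV : forall v, gr 1%g (P v);
    cf_grE : forall e, gr (om e) (U e)
  }.

Section Hom.
Variables (D : grStarAlgType l G) (P : vert E -> D) (U : edge E -> D).
Hypothesis PU : cohn_family P U.

Definition family_gen (x : cohn_gen E) : D :=
  match x with GVert v => P v | GEdge e => U e | GGhost e => star (U e) end.

Let rel_RG e : family_gen (GVert (rng e)) ** family_gen (GGhost e) = family_gen (GGhost e).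
Proof. by rewrite /= -{1}(cf_star PU) -starM (cfER PU). Qed.
Let rel_GS e : family_gen (GGhost e) ** family_gen (GVert (src e)) = family_gen (GGhost e).
Proof. by rewrite /= -{1}(cf_star PU) -starM (cfSE PU). Qed.

Let ev : C -> D := cohn_eval family_gen.
Let ev_gen x : ev (cohn_gen_pi l x) = family_gen x.
Proof.
exact: (@cohn_eval_gen l E D family_gen (cfVV PU) (cfSE PU) (cfER PU) rel_RG rel_GS (cfGE PU)).
Qed.
Let ev_linear : linear ev.
Proof.
exact: (@cohn_eval_linear l E D family_gen (cfVV PU) (cfSE PU) (cfER PU) rel_RG rel_GS (cfGE PU)).
Qed.
Let evM : {morph ev : a b / a ** b}.
Proof.
exact: (@cohn_evalM l E D family_gen (cfVV PU) (cfSE PU) (cfER PU) rel_RG rel_GS (cfGE PU)).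
Qed.

Let ev_star : {morph ev : a / star a}.
Proof.
apply: cohn_ind => [|a b IHa IHb|k a IH|a b IHa IHb|x].
- by rewrite star0 (lin0 ev_linear) star0.
- by rewrite starD !(linD ev_linear) starD IHa IHb.
- by rewrite (starZ k (a : C)) !(linZ ev_linear) starZ IH.
- by rewrite [star _](@starM l G C) !evM starM IHa IHb.
- rewrite cohn_gen_star !ev_gen; case: x => //= [v|e]; first by rewrite (cf_star PU).
  by rewrite starK.
Qed.

Let ev_gr d a : gr d a -> gr d (ev a).
Proof.
apply: (@cohn_eval_homogeneous l E D family_gen (cfVV PU) (cfSE PU) (cfER PU)
  rel_RG rel_GS (cfGE PU) G om (@gr l G D)).
- exact: gr0.
- exact: grD.
- exact: grZ.
- exact: grM.
- by case=> [v|e|e] /=; [exact: (cf_grV PU)|exact: (cf_grE PU)|exact/gr_star/(cf_grE PU)].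
Qed.

Definition cohn_hom : grhom C D := GrHom ev_linear evM ev_star ev_gr.

Lemma cohn_hom_vert v : cohn_hom (cohn_vert l om v) = P v.
Proof. exact: (ev_gen (GVert v)). Qed.
Lemma cohn_hom_edge e : cohn_hom (cohn_edge l om e) = U e.
Proof. exact: (ev_gen (GEdge e)). Qed.
End Hom.

Lemma cohn_hom_ext (D : grStarAlgType l G) (f h : grhom C D) :
  (forall v, f (cohn_vert l om v) = h (cohn_vert l om v)) ->
  (forall e, f (cohn_edge l om e) = h (cohn_edge l om e)) -> f =1 h.
Proof.
move=> fv fe; apply: cohn_ind => [|a b IHa IHb|k a IH|a b IHa IHb|x].
- by rewrite !(lin0 (grhom_linear _)).
- by rewrite !(linD (grhom_linear _)) IHa IHb.
- by rewrite !(linZ (grhom_linear _)) IH.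
- by rewrite ![_ (a ** b)](@grhomM l G C) IHa IHb.
- case: x => [v|e|e]; [exact: fv|exact: fe|].
  have -> : cohn_gen_pi l (GGhost e) = star (cohn_edge l om e).
    by rewrite [RHS](cohn_gen_star (GEdge e)).
  by rewrite !grhom_star fe.
Qed.

Lemma cohn_self_family : cohn_family (D := C) (cohn_vert l om) (cohn_edge l om).
Proof.
have rel a b : cohn_rel (l := l) (E := E) a b -> cohn_pi a = cohn_pi b.
  by move=> r; apply/cohn_piP; exact: CohnRel.
split.
- exact: cohn_vertM.
- by move=> e; rewrite -[LHS]cohn_piM; apply: rel; exact: CohnSE.
- by move=> e; rewrite -[LHS]cohn_piM; apply: rel; exact: CohnER.
- move=> e f; rewrite [star _](cohn_gen_star (GEdge e)) -[LHS]cohn_piM.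
  rewrite (rel _ _ (CohnGE _ e f)); case: eqP => // _; exact: cohn_pi0.
- exact: cohn_vert_star.
- exact: cohn_vert_gr.
- move=> e; exists (genF l (GEdge e)) => //.
  by have := @freegr_eps l E G om (wgen (GEdge e)) (1 : l); rewrite /wdeg /= mulg1.
Qed.

(** In [D[t]] the family [a + t b] still satisfies the Cohn relations if the direction
    [b] is isotropic and orthogonal to [a], since then
    [star (a e + t b e) (a f + t b f) = star (a e) (a f)]; it connects [a] to [a + b]. *)
Section Homotopy.
Variables (D : grStarAlgType l G) (P : vert E -> D) (a b : edge E -> D).
Hypothesis Pa : cohn_family P a.
Hypothesis bS : forall e, P (src e) ** b e = b e.
Hypothesis bR : forall e, b e ** P (rng e) = b e.
Hypothesis ab : forall e f, star (a e) ** b f = 0.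
Hypothesis bb : forall e f, star (b e) ** b f = 0.
Hypothesis b_gr : forall e, gr (om e) (b e).

Let ba e f : star (b e) ** a f = 0.
Proof. by rewrite -[LHS]starK starM starK ab star0. Qed.

Lemma family_shift : cohn_family P (fun e => a e + b e).
Proof.
split=> [|e|e|e f|||e]; try exact: (cfVV Pa); try exact: (cf_star Pa); try exact: (cf_grV Pa).
- by rewrite nmulDr bS (cfSE Pa).
- by rewrite nmulDl bR (cfER Pa).
- by rewrite starD nmulDl !nmulDr ab ba bb (cfGE Pa) !addr0.
- by apply: grD => //; exact: (cf_grE Pa).
Qed.

Let mono (n : nat_sz) (d : D) : polyalg D := eps n d.

Let mono_mul m n c d : mono m c ** mono n d = mono (m + n)%N (c ** d).
Proof. exact: eps_mul. Qed.
Let mono_star n d : star (mono n d) = mono n (star d).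
Proof. exact: (gsstar_eps (S := nat_semi G)). Qed.
Let mono0 n : mono n 0 = 0.
Proof. exact: eps0. Qed.
Let mono_gr g n d : gr g d -> gr g (mono n d).
Proof.
move=> gd; have := gsgr_eps (S := nat_semi G) (n : nat_semi G) gd.
by rewrite /= mul1g invg1 mulg1.
Qed.

Let path_family :
  cohn_family (fun v => mono 0%N (P v)) (fun e => mono 0%N (a e) + mono 1%N (b e)).
Proof.
split=> [v w|e|e|e f|v|v|e].
- by rewrite mono_mul (cfVV Pa); case: eqP => // _; rewrite mono0.
- by rewrite nmulDr !mono_mul bS (cfSE Pa).
- by rewrite nmulDl !mono_mul bR (cfER Pa).
- rewrite starD nmulDl !nmulDr !mono_star !mono_mul ab ba bb (cfGE Pa) !mono0 !addr0.
  by case: eqP => // _; rewrite mono0.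
- by rewrite mono_star (cf_star Pa).
- by apply: mono_gr; exact: (cf_grV Pa).
- by apply: grD; apply: mono_gr => //; exact: (cf_grE Pa).
Qed.

Lemma hmap_family_shift (T : tricat) (H : homology l G T) :
  homotopy_invariant H ->
  exists Pab : cohn_family P (fun e => a e + b e),
    hmap H (cohn_hom Pa) = hmap H (cohn_hom Pab).
Proof.
move=> /(hmap_homotopy (cohn_hom path_family)) h.
have evD x (x_real : conjr x = x) c d :
    poly_ev D x_real (mono 0%N c + mono 1%N d) = c + x *: d.
  by rewrite (linD (grhom_linear _)) !poly_ev_eps expr0 expr1 scale1r.
exists family_shift.
transitivity (hmap H (grhom_comp (poly_ev0 D) (cohn_hom path_family))).
  apply/hmap_ext/cohn_hom_ext => [v|e]; rewrite grhom_compE.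
    by rewrite !cohn_hom_vert poly_ev_eps scale1r.
  by rewrite !cohn_hom_edge evD scale0r addr0.
rewrite h; apply/hmap_ext/cohn_hom_ext => [v|e]; rewrite grhom_compE.
  by rewrite !cohn_hom_vert poly_ev_eps scale1r.
by rewrite !cohn_hom_edge evD scale1r.
Qed.
End Homotopy.
End CohnFamilies.

(** * Linear endomorphisms *)

#[local] Obligation Tactic := idtac.

Section LinearEndomorphisms.
Variables (R : comPzRingType) (V : lmodType R).

Record lend := Lend { lend_fun :> V -> V; lend_linear : linear lend_fun }.

HB.instance Definition _ := gen_eqMixin lend.
HB.instance Definition _ := gen_choiceMixin lend.

Lemma lend_ext (f h : lend) : f =1 h -> f = h.
Proof.
case: f h => f fl [h hl] /= /funext fh; case: h / fh in hl *.
by congr Lend; exact: Prop_irrelevance.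
Qed.

Program Definition lend0 := @Lend (fun=> 0) _.
Next Obligation. by move=> k a b; rewrite scaler0 addr0. Qed.
Program Definition lendD (f h : lend) := @Lend (fun v => f v + h v) _.
Next Obligation.
by move=> f h k a b; rewrite !lend_linear scalerDr addrACA.
Qed.
Program Definition lendN (f : lend) := @Lend (fun v => - f v) _.
Next Obligation. by move=> f k a b; rewrite lend_linear opprD scalerN. Qed.
Program Definition lendZ (c : R) (f : lend) := @Lend (fun v => c *: f v) _.
Next Obligation.
by move=> c f k a b; rewrite lend_linear scalerDr !scalerA mulrC.
Qed.
Program Definition lendM (f h : lend) := @Lend (fun v => f (h v)) _.
Next Obligation. by move=> f h k a b; rewrite !lend_linear. Qed.

Lemma lendDA : associative lendD.
Proof. by move=> ???; apply: lend_ext => v /=; rewrite addrA. Qed.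
Lemma lendDC : commutative lendD.
Proof. by move=> ??; apply: lend_ext => v /=; rewrite addrC. Qed.
Lemma lend0D : left_id lend0 lendD.
Proof. by move=> ?; apply: lend_ext => v /=; rewrite add0r. Qed.
Lemma lendND : left_inverse lend0 lendN lendD.
Proof. by move=> ?; apply: lend_ext => v /=; rewrite addNr. Qed.
HB.instance Definition _ := GRing.isZmodule.Build lend lendDA lendDC lend0D lendND.

Lemma lendZA a b v : lendZ a (lendZ b v) = lendZ (a * b) v.
Proof. by apply: lend_ext => x /=; rewrite scalerA. Qed.
Lemma lend1Z : left_id 1 lendZ.
Proof. by move=> ?; apply: lend_ext => v /=; rewrite scale1r. Qed.
Lemma lendZDr : right_distributive lendZ +%R.
Proof. by move=> ???; apply: lend_ext => v /=; rewrite scalerDr. Qed.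
Lemma lendZDl v : {morph lendZ^~ v : a b / a + b}.
Proof. by move=> ??; apply: lend_ext => x /=; rewrite scalerDl. Qed.
HB.instance Definition _ :=
  GRing.Zmodule_isLmodule.Build R lend lendZA lend1Z lendZDr lendZDl.

Lemma lendMA : associative lendM.
Proof. by move=> ???; exact: lend_ext. Qed.
Lemma lendMDl : left_distributive lendM +%R.
Proof. by move=> ???; exact: lend_ext. Qed.
Lemma lendMDr : right_distributive lendM +%R.
Proof. by move=> f g h; apply: lend_ext => v /=; rewrite (linD (@lend_linear f)). Qed.
Lemma lendMZl (k : R) (f h : lend) : lendM (k *: f) h = k *: lendM f h.
Proof. exact: lend_ext. Qed.
Lemma lendMZr (k : R) (f h : lend) : lendM f (k *: h) = k *: lendM f h.
Proof. by apply: lend_ext => v /=; rewrite (linZ (@lend_linear f)). Qed.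
HB.instance Definition _ :=
  Lmodule_isNuAlgebra.Build R lend lendMA lendMDl lendMDr lendMZl lendMZr.
End LinearEndomorphisms.

(** * Signed matrices *)

Section SignedMatrices.
Variables (l : comStarRingType) (G : groupType) (X : gset G).
Implicit Types A B : grStarAlgType l G.

(** [M_X A] with two copies, of sign + and -, of each index. *)
Definition smat A : grStarAlgType l G := matpm (matx X A).

Section Coefficients.
Variable A : grStarAlgType l G.
Local Notation K := (smat A).

Definition smat_unit (i j : 'I_2) (x y : X) (a : A) : K :=
  eps (S := mxunit (two G)) (i, j) (eps (S := mxunit X) (x, y) a : matx X A).

Lemma smat_ind (P : K -> Prop) :
  P 0 -> (forall f h, P f -> P h -> P (f + h)) ->
  (forall i j x y a, P (smat_unit i j x y a)) -> forall f, P f.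
Proof.
move=> P0 PD P1; apply: (@sgalg_ind _ (mxunit (two G)) (matx X A)) => // -[i j].
elim/(@sgalg_ind _ (mxunit X) A) => [|m m' IH IH'|[x y] a]; last exact: P1.
  by rewrite eps0.
by rewrite epsD; exact: PD.
Qed.

Lemma smat_unit_linear i j x y : linear (smat_unit i j x y).
Proof. by move=> k a b; rewrite /smat_unit epsD epsZ epsD epsZ. Qed.

Lemma smat_unitM i j x y a i' j' x' y' b :
  smat_unit i j x y a ** smat_unit i' j' x' y' b =
  if (j == i') && (y == x') then smat_unit i j' x y' (a ** b) else 0.
Proof.
rewrite /smat_unit [LHS](eps_mul (S := mxunit (two G))) /=.
case: eqP => //= _; rewrite [_ ** _](eps_mul (S := mxunit X)) /=.
by case: eqP => //= _; rewrite eps0.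
Qed.

Lemma smat_unit_star i j x y a :
  star (smat_unit i j x y a) = (-1) ^+ (i + j) *: smat_unit j i y x (star a).
Proof.
rewrite [LHS]/star /= /pmstar [star _](gsstar_eps (S := mxunit (two G))) /=.
rewrite [star _](gsstar_eps (S := mxunit X)) /= conj_h_eps epsZ addnC.
by [].
Qed.

Lemma smat_unit_gr g i j x y a :
  gr g a -> gr (gdeg x * g * (gdeg y)^-1)%g (smat_unit i j x y a).
Proof.
move=> /(gsgr_eps (S := mxunit X) ((x, y) : mxunit X)).
move=> /(gsgr_eps (S := mxunit (two G)) ((i, j) : mxunit (two G))).
by rewrite /= mul1g invg1 mulg1.
Qed.

(** Left multiplication by the possibly infinite 0-1 matrix of the partial map [t],
    in both signs. *)
Definition row_op (t : X -> option X) : K -> K :=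
  lext (M := fun _ : mxunit (two G) => matx X A : lmodType l) (V := K)
    (fun p m => eps (S := mxunit (two G)) p
       (lext (M := fun _ : mxunit X => A : lmodType l) (V := matx X A)
         (fun q a => osingle (S := mxunit X) (omap (fun z => (z, q.2)) (t q.1)) a) m)).

Let row_op_in (t : X -> option X) (q : mxunit X) :
  linear (fun a : A => osingle (S := mxunit X) (omap (fun z => (z, q.2)) (t q.1)) a).
Proof. by move=> k a b; rewrite osingleD osingleZ. Qed.
Let row_op_out (t : X -> option X) (p : mxunit (two G)) :
  linear (fun m : matx X A => eps (S := mxunit (two G)) p
       (lext (M := fun _ : mxunit X => A : lmodType l) (V := matx X A)
         (fun q a => osingle (S := mxunit X) (omap (fun z => (z, q.2)) (t q.1)) a) m)).
Proof.
move=> k a b; rewrite (lext_linear (row_op_in t)).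
by rewrite epsD epsZ.
Qed.

Lemma row_op_linear t : linear (row_op t).
Proof. by apply: lext_linear => p; exact: row_op_out. Qed.

Lemma row_op_unit t i j x y a :
  row_op t (smat_unit i j x y a) =
  if t x is Some z then smat_unit i j z y a else 0.
Proof.
rewrite [LHS](lext_single (row_op_out t)).
rewrite (lext_single (row_op_in t)) /=.
by case: (t x) => //=; rewrite eps0.
Qed.
End Coefficients.
End SignedMatrices.

Section RowOps.
Variables (l : comStarRingType) (G : groupType) (X : gset G) (A : grStarAlgType l G).
Local Notation K := (smat X A).
Implicit Types (s t u : X -> option X) (k : K).

Let opD t := linD (@row_op_linear l G X A t).
Let op0 t := lin0 (@row_op_linear l G X A t).
Let opZ t := linZ (@row_op_linear l G X A t).

Lemma row_op_comp t s u : (forall x, obind t (s x) = u x) ->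
  forall k, row_op t (row_op s k) = row_op u k.
Proof.
move=> ts; elim/smat_ind => [|f h IH IH'|i j x y a]; first by rewrite !op0.
  by rewrite !opD IH IH'.
by rewrite !row_op_unit -ts; case: (s x) => [z|] /=; rewrite ?row_op_unit ?op0.
Qed.

Lemma row_op_none t : (forall x, t x = None) -> forall k, row_op t k = 0.
Proof.
move=> t0; elim/smat_ind => [|f h IH IH'|i j x y a]; first by rewrite !op0.
  by rewrite !opD IH IH' addr0.
by rewrite row_op_unit t0.
Qed.

Lemma row_opM t k k' : row_op t (k ** k') = row_op t k ** k'.
Proof.
elim/smat_ind: k => [|f h IH IH'|i j x y a]; first by rewrite !(op0, nmul0l).
  by rewrite !(opD, nmulDl) IH IH'.
elim/smat_ind: k' => [|f h IH IH'|i' j' x' y' b]; first by rewrite !(op0, nmul0r).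
  by rewrite !(opD, nmulDr) IH IH'.
rewrite smat_unitM row_op_unit; case: ifP => e.
  by rewrite row_op_unit; case: (t x) => [z|]; rewrite ?nmul0l // smat_unitM e.
by rewrite op0; case: (t x) => [z|]; rewrite ?nmul0l // smat_unitM e.
Qed.

(** Transposing the matrix of a partial injection inverts the injection; the signs
    cancel because [row_op] acts in the same way on both copies. *)
Lemma row_op_adj t s : (forall x z, t x = Some z <-> s z = Some x) ->
  forall k k', star (row_op t k) ** k' = star k ** row_op s k'.
Proof.
move=> ts; elim/smat_ind => [|f h IH IH'|i j x y a] k'.
- by rewrite op0 star0 !nmul0l.
- by rewrite opD !starD !nmulDl IH IH'.
elim/smat_ind: k' => [|f h IH IH'|i' j' x' y' b]; first by rewrite !(op0, nmul0r).
  by rewrite !(opD, nmulDr) IH IH'.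
rewrite !row_op_unit smat_unit_star.
case tx: (t x) => [z|]; case sx: (s x') => [w|]; rewrite ?(star0, nmul0l, nmul0r) //.
- rewrite smat_unit_star !nmulZl !smat_unitM; congr (_ *: _).
  case: (i == i') => //=; have -> // : (z == x') = (x == w).
  apply/eqP/eqP => [zx|xw]; first by move/ts: tx; rewrite zx sx => -[].
  by move/ts: sx; rewrite -xw tx => -[].
- rewrite smat_unit_star nmulZl smat_unitM; case: (eqVneq z x') => [zx|]; rewrite ?andbF ?scaler0 //.
  by move/ts: tx; rewrite zx sx.
- rewrite nmulZl smat_unitM; case: (eqVneq x w) => [xw|]; rewrite ?andbF ?scaler0 //.
  by move/ts: sx; rewrite -xw tx.
Qed.

Lemma col_op_unit t i j x y (a : A) : star (row_op t (star (smat_unit i j x y a))) =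
  if t y is Some z then smat_unit i j x z a else 0.
Proof.
rewrite smat_unit_star opZ row_op_unit starZ conjr_sign.
case: (t y) => [z|]; last by rewrite star0 scaler0.
by rewrite smat_unit_star scalerA addnC -expr2 sqrr_sign scale1r starK.
Qed.

(** The right-hand operation moves column indices only. *)
Lemma row_op_comm t s k :
  row_op t (star (row_op s (star k))) = star (row_op s (star (row_op t k))).
Proof.
elim/smat_ind: k => [|f h IH IH'|i j x y a]; first by rewrite !(op0, star0).
  by rewrite !(opD, starD) IH IH'.
rewrite col_op_unit row_op_unit; case tx: (t x) => [z|].
  by rewrite col_op_unit; case: (s y) => [w|]; rewrite ?op0 // row_op_unit tx.
by case: (s y) => [w|]; rewrite ?op0 ?row_op_unit ?tx !(star0, op0).
Qed.

Lemma row_op_gr t d : (forall x z, t x = Some z -> gdeg z = d * gdeg x)%g ->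
  forall g k, gr g k -> gr (d * g)%g (row_op t k).
Proof.
move=> td g k gk; apply: gr_sum => -[i j] _.
set m := k (i, j).
have gm : gr g (m : matx X A) by have := gk (i, j); rewrite /= invg1 mul1g mulg1.
suff /(gsgr_eps (S := mxunit (two G)) ((i, j) : mxunit (two G))) :
    gr (d * g)%g (lext (M := fun _ : mxunit X => A : lmodType l) (V := matx X A)
    (fun q a => osingle (S := mxunit X) (omap (fun z => (z, q.2)) (t q.1)) a) m).
  by rewrite /= mul1g invg1 mulg1.
apply: gr_sum => -[x y] _ /=.
case tx: (t x) => [z|] /=; last exact: gr0.
have := gsgr_eps (S := mxunit X) ((z, y) : mxunit X) (gm (x, y)).
by rewrite /= (td _ _ tx) !mulgA mulgK mulgK.
Qed.
End RowOps.

(** * Change of coefficients *)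

Section CoefficientMap.
Variables (l : comStarRingType) (G : groupType).
Implicit Types A B : grStarAlgType l G.

Section SemigroupAlgebra.
Variables (S : grSemi G) (A B : grStarAlgType l G) (f : grhom A B).

Program Definition sg_map_fun (h : gsgalg S A) : gsgalg S B :=
  @FinFam _ _ (fun _ : S => B : lmodType l) (fun s => f (h s)) _.
Next Obligation.
move=> h; apply: (sub_finite_set _ (finfam_fin h)) => s /=.
by apply: contraNneq => ->; rewrite (lin0 (grhom_linear f)).
Qed.

Lemma sg_map_linear : linear sg_map_fun.
Proof. by move=> k a b; apply: finfamP => s /=; rewrite grhom_linear. Qed.
Lemma sg_map_eps (s : S) a : sg_map_fun (eps s a) = eps s (f a).
Proof.
apply: finfamP => t /=; case: (eqVneq s t) => [<-|st].
  by rewrite !single_fun_eq.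
by rewrite !single_fun_ne // (lin0 (grhom_linear f)).
Qed.
Lemma sg_mapM : {morph sg_map_fun : a b / a ** b}.
Proof.
have E0 := lin0 sg_map_linear; have ED := linD sg_map_linear.
move=> u v; elim/sgalg_ind: u => [|u u' IH IH'|s a]; rewrite ?(E0, nmul0l) //.
  by rewrite !(nmulDl, ED) IH IH'.
elim/sgalg_ind: v => [|v v' IH IH'|t b]; rewrite ?(E0, nmul0r) //.
  by rewrite !(nmulDr, ED) IH IH'.
rewrite [eps s a ** _]eps_mul !sg_map_eps [RHS]eps_mul -grhomM.
by case: (sz_op s t) => [c|] /=; rewrite ?sg_map_eps.
Qed.

Definition sg_map : grhom (gsgalg S A) (gsgalg S B).
Proof.
apply: (@GrHom _ _ (gsgalg S A) (gsgalg S B) sg_map_fun sg_map_linear sg_mapM).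
- by move=> a; apply: finfamP => s; exact: grhom_star.
- by move=> g a ga s; apply: grhom_gr; exact: ga.
Defined.
End SemigroupAlgebra.

Definition pm_map A B (f : grhom A B) : grhom (matpm A) (matpm B).
Proof.
apply: (@GrHom _ _ (matpm A) (matpm B) (sg_map (mxunit (two G)) f)).
- exact: (@grhom_linear _ _ _ _ (sg_map (mxunit (two G)) f)).
- exact: (@grhomM _ _ _ _ (sg_map (mxunit (two G)) f)).
- move=> a; apply: finfamP => p.
  by rewrite /= (linZ (grhom_linear f)) grhom_star.
- exact: (@grhom_gr _ _ _ _ (sg_map (mxunit (two G)) f)).
Defined.

Definition smat_map (X : gset G) A B (f : grhom A B) : grhom (smat X A) (smat X B) :=
  pm_map (sg_map (mxunit X) f).

Lemma smat_map_unit (X : gset G) A B (f : grhom A B) i j (x y : X) a :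
  smat_map X f (smat_unit i j x y a) = smat_unit i j x y (f a).
Proof.
rewrite [LHS](sg_map_eps (S := mxunit (two G)) (sg_map (mxunit X) f)).
by rewrite [sg_map _ f _](sg_map_eps (S := mxunit X) f).
Qed.

Lemma smat_map_row_op (X : gset G) A B (f : grhom A B) t (k : smat X A) :
  smat_map X f (row_op t k) = row_op t (smat_map X f k).
Proof.
elim/smat_ind: k => [|u v IH IH'|i j x y a].
- by rewrite !(lin0 (grhom_linear _), lin0 (row_op_linear _)).
- by rewrite !(linD (row_op_linear _), linD (grhom_linear _)) IH IH'.
rewrite smat_map_unit !row_op_unit; case: (t x) => [z|]; first exact: smat_map_unit.
exact: lin0 (grhom_linear _).
Qed.
End CoefficientMap.

(** * The Fock action *)

Section Fock.
Variables (l : comStarRingType) (E : graph) (G : groupType) (om : edge E -> G).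
Local Notation C := (cohn l om).

Definition base_point : gset G := GSet (fun _ : unit => 1%g).

(** The pair [p] stands for the nonempty sequence [p.1 :: p.2], composable or not: the
    action only looks at its first edge. *)
Definition edge_seqs : gset G :=
  GSet (fun p : edge E * seq (edge E) => foldr (fun e d => om e * d)%g 1%g (p.1 :: p.2)).

Definition fock : gset G := gsetU base_point edge_seqs.

Definition fock0 : fock := inl tt.
Definition fock1 (e : edge E) : fock := inr (e, [::]).

(** The action of the generators on indices.  The base point has no image, and a ghost
    edge never leads back to it, so that for every edge [e] the index [fock1 e] lies
    outside the range of the action of the edges: this is the defect that makes room
    for one more isometry. *)
Definition shift (x : cohn_gen E) (z : fock) : option fock :=
  match z with
  | inl _ => None
  | inr (e, s) =>
    match x with
    | GVert v => if src e == v then Some z else None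
    | GEdge f => if rng f == src e then Some (inr (f, e :: s)) else None
    | GGhost f => if s is e' :: s' then
        if (e == f) && (rng f == src e') then Some (inr (e', s')) else None
      else None
    end
  end.

Lemma shift_inv x z z' : shift x z = Some z' <-> shift (gen_star x) z' = Some z.
Proof.
case: x z z' => [v|f|f] [[]|[e s]] [[]|[e' s']] //=; try by split; case: ifP.
- by split; case: eqP => // ve [<- <-]; rewrite ve eqxx.
- by split=> //; case: s' => // a s'; case: ifP.
- split.
    by case: ifP => // fe [<- <-]; rewrite eqxx fe.
  by case: s' => // a s'; case: ifP => // /andP[/eqP-> fe] [<- <-]; rewrite fe.
- by split=> //; case: s => // a s; case: ifP.
- split.
    by case: s => // a s; case: ifP => // /andP[/eqP-> fe] [<- <-]; rewrite fe.
  by case: ifP => // fe [<- <-]; rewrite eqxx fe.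
Qed.

Lemma shift_deg x z z' : shift x z = Some z' -> gdeg z' = (gen_deg om x * gdeg z)%g.
Proof.
case: x z => [v|f|f] [[]|[e s]] //=; try by case: ifP => // _ [<-] /=; rewrite ?mul1g.
case: s => // e' s; case: ifP => // /andP[/eqP-> _] [<-] /=.
by rewrite !mulgA mulVg mul1g.
Qed.

Section Action.
Variable A : grStarAlgType l G.
Local Notation K := (smat fock A).

Definition shift_op (x : cohn_gen E) : lend K := Lend (@row_op_linear l G fock A (shift x)).

Local Notation act_eval := (cohn_eval shift_op).

Let opVV v w : shift_op (GVert v) ** shift_op (GVert w) =
  if v == w then shift_op (GVert v) else 0.
Proof.
case: eqP => [<-|vw]; apply: lend_ext => k.
  by apply: row_op_comp => -[[]|[e s]] //=; case: ifP => //= ->.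
rewrite [LHS](row_op_comp (u := fun=> None)); first exact: row_op_none.
by move=> [[]|[e s]] //=; case: eqP => //= ->; case: eqP => // wv; case: vw.
Qed.
Let opSE e : shift_op (GVert (src e)) ** shift_op (GEdge e) = shift_op (GEdge e).
Proof.
by apply: lend_ext => k; apply: row_op_comp => -[[]|[f s]] //=; case: ifP => //=; rewrite eqxx.
Qed.
Let opER e : shift_op (GEdge e) ** shift_op (GVert (rng e)) = shift_op (GEdge e).
Proof.
apply: lend_ext => k; apply: row_op_comp => -[[]|[f s]] //=.
by rewrite (eq_sym (rng e)); case: ifP => //= fe; rewrite eq_sym fe.
Qed.
Let opRG e : shift_op (GVert (rng e)) ** shift_op (GGhost e) = shift_op (GGhost e).
Proof.
apply: lend_ext => k; apply: row_op_comp => -[[]|[f [|f' s]]] //=.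
by case: ifP => //= /andP[_]; rewrite eq_sym => ->.
Qed.
Let opGS e : shift_op (GGhost e) ** shift_op (GVert (src e)) = shift_op (GGhost e).
Proof.
apply: lend_ext => k; apply: row_op_comp => -[[]|[f [|f' s]]] //=; first by case: ifP.
case: (eqVneq f e) => [->|fe] /=; first by rewrite !eqxx /= ?eqxx.
by case: ifP => //=; rewrite (negbTE fe).
Qed.
Let opGE e f : shift_op (GGhost e) ** shift_op (GEdge f) =
  if e == f then shift_op (GVert (rng e)) else 0.
Proof.
case: eqP => [<-|ef]; apply: lend_ext => k.
  apply: row_op_comp => -[[]|[f' s]] //=.
  by rewrite (eq_sym (src f')); case: ifP => //= ->; rewrite eqxx.
rewrite [LHS](row_op_comp (u := fun=> None)); first exact: row_op_none.
by move=> [[]|[f' s]] //=; case: ifP => //= _; case: eqP => //= fe; case: ef.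
Qed.

Let act_gen x : act_eval (cohn_gen_pi l x) = shift_op x.
Proof. exact: (cohn_eval_gen opVV opSE opER opRG opGS opGE). Qed.
Let act_evalD := linD (cohn_eval_linear opVV opSE opER opRG opGS opGE).
Let act_evalZ := linZ (cohn_eval_linear opVV opSE opER opRG opGS opGE).
Let act_eval0 := lin0 (cohn_eval_linear opVV opSE opER opRG opGS opGE).
Let act_evalM := cohn_evalM opVV opSE opER opRG opGS opGE.

Lemma fock_action_subproof :
  {L : action C K | forall x k, L (cohn_gen_pi l x) k = row_op (shift x) k}.
Proof.
have act_genk x k : act_eval (cohn_gen_pi l x) k = row_op (shift x) k by rewrite act_gen.
refine (exist _ (@Action _ _ C K (fun c k => act_eval c k) _ _ _ _ _ _ _) act_genk)
  => {act_genk}.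
- by move=> k c a b; rewrite act_evalD act_evalZ.
- by move=> c; exact: lend_linear.
- by move=> b b' k; rewrite [cohn_eval _ _]act_evalM.
- elim/cohn_ind => [|a b IHa IHb|c a IH|a b IHa IHb|x] k k'.
  + by rewrite act_eval0 nmul0l.
  + by rewrite act_evalD /= IHa IHb nmulDl.
  + by rewrite act_evalZ /= IH nmulZl.
  + by rewrite act_evalM /= IHb IHa.
  + by rewrite act_gen; exact: row_opM.
- elim/cohn_ind => [|a b IHa IHb|c a IH|a b IHa IHb|x] k k'.
  + by rewrite (@star0 _ _ C) act_eval0 star0 nmul0l nmul0r.
  + by rewrite (@starD _ _ C) !act_evalD /= starD nmulDl IHa IHb nmulDr.
  + by rewrite (@starZ _ _ C) !act_evalZ /= starZ nmulZl IH nmulZr.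
  + by rewrite (@starM _ _ C) !act_evalM /= IHa IHb.
  + by rewrite cohn_gen_star !act_gen; apply: row_op_adj => z z'; exact: shift_inv.
- elim/cohn_ind => [|a b IHa IHb|c a IH|a b IHa IHb|x] b' k.
  + by rewrite act_eval0 /= star0 (lin0 (lend_linear _)) star0.
  + by rewrite act_evalD /= starD (linD (lend_linear _)) starD IHa IHb.
  + by rewrite act_evalZ /= starZ (linZ (lend_linear _)) starZ conjrK IH.
  + by rewrite act_evalM /= IHb IHa.
  elim/cohn_ind: b' k => [|a b IHa IHb|c a IH|a b IHa IHb|y] k.
  + by rewrite act_eval0 /= star0 (lin0 (lend_linear _)).
  + by rewrite act_evalD /= !starD (linD (lend_linear _)) IHa IHb.
  + by rewrite act_evalZ /= !starZ (linZ (lend_linear _)) IH.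
  + rewrite act_evalM /=.
    by have := IHa (star (act_eval b (star k))); rewrite starK => ->; rewrite IHb starK.
  + by rewrite !act_gen; exact: row_op_comm.
- move=> g h b k gb.
  have := @cohn_eval_homogeneous l E (lend K) shift_op opVV opSE opER opRG opGS opGE
    G om (fun d => [set f : lend K | forall h k, gr h k -> gr (d * h)%g (f k)]).
  move=> H; apply: (H _ _ _ _ _ g b gb) => {H g h b k gb}.
  + by move=> d h k _; exact: gr0.
  + by move=> d a b ha hb h k gk; apply: grD; [exact: ha|exact: hb].
  + by move=> d c a ha h k gk; apply: grZ; exact: ha.
  + by move=> d d' a b ha hb h k gk; rewrite -mulgA; apply: ha; exact: hb.
  + by move=> x h k; apply: row_op_gr => z z'; exact: shift_deg.
Qed.

Definition fock_action : action C K := sval fock_action_subproof.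

Lemma fock_action_gen x k : fock_action (cohn_gen_pi l x) k = row_op (shift x) k.
Proof. exact: (svalP fock_action_subproof). Qed.
End Action.

Lemma smat_map_action (A B : grStarAlgType l G) (f : grhom A B) c (k : smat fock A) :
  smat_map fock f (fock_action A c k) = fock_action B c (smat_map fock f k).
Proof.
have fD := linD (grhom_linear (smat_map fock f)).
have fZ := linZ (grhom_linear (smat_map fock f)).
have f0 := lin0 (grhom_linear (smat_map fock f)).
have aD X k' := linD (act_linearl (fock_action X) k').
have aZ X k' := linZ (act_linearl (fock_action X) k').
have a0 X k' := lin0 (act_linearl (fock_action X) k').
elim/cohn_ind: c k => [|a b IHa IHb|c a IH|a b IHa IHb|x] k.
- by rewrite !a0 f0.
- by rewrite !aD fD IHa IHb.
- by rewrite !aZ fZ IH.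
- by rewrite !(act_mul (fock_action _) (a : C)) IHa IHb.
- by rewrite !fock_action_gen smat_map_row_op.
Qed.
End Fock.

(** * The corner inclusion *)

Section Corner.
Variables (l : comStarRingType) (E : graph) (G : groupType) (om : edge E -> G).
Implicit Types A B : grStarAlgType l G.
Local Notation X := (fock om).
Local Notation pt := (fock0 om).

Section OnePoint.
Variable A : grStarAlgType l G.

Definition one_point : grhom A (matx (base_point G) A).
Proof.
apply: (@GrHom l G A (matx (base_point G) A)
  (fun a => eps (S := mxunit (base_point G)) (tt, tt) a)).
- by move=> k a b; rewrite epsD epsZ.
- by move=> a b; rewrite eps_mul.
- by move=> a; exact/esym/(gsstar_eps (S := mxunit (base_point G))).
- move=> g a /(gsgr_eps (S := mxunit (base_point G)) ((tt, tt) : mxunit (base_point G))).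
  by rewrite /= mul1g invg1 mulg1.
Defined.

Definition one_point_inv : grhom (matx (base_point G) A) A.
Proof.
apply: (@GrHom l G (matx (base_point G) A) A (fun m => m (tt, tt))) => //.
- by move=> a b; rewrite matx_mulE (fsbigTE [fset tt]%fset) ?big_seq_fset1 // => -[]; rewrite inE.
- by move=> g a /(_ (tt, tt)); rewrite /= invg1 mul1g mulg1.
Defined.

Definition corner : grhom A (smat X A) :=
  grhom_comp (pm_corner (matx X A))
    (grhom_comp (matx_incl (base_point G) (edge_seqs om) A) one_point).

Lemma cornerE a : corner a = smat_unit ord0 ord0 pt pt a.
Proof. by rewrite /= matx_incl_eps. Qed.
End OnePoint.

Lemma fock_card : [set: edge_seqs om] #<= [set: vert E + edge E + nat + G].
Proof.
pose f0 (n : nat) : vert E + edge E + nat + G := inl (inr n).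
have f0i : injective f0 by move=> m n [].
have [c ci] := infinite_seq f0i.
pose h (e : edge E) : vert E + edge E + nat + G := inl (inl (inr e)).
have hi : injective h by move=> e e' [].
apply: (@injective_card_le _ _ (fun p : edge_seqs om => c (map h (p.1 :: p.2)))).
by move=> [e s] [e' s'] /ci /= [-> /(inj_map hi) ->].
Qed.

Lemma corner_iso (T : tricat) (H : homology l G T) A :
  graph_stable H E -> is_iso (hmap H (corner A)).
Proof.
move=> [Hpm HG]; rewrite !hmapM; apply: iso_comp; first exact: Hpm.
apply: iso_comp.
  apply: HG; [by exists tt| |exact: fock_card].
  by apply: (@injective_card_le _ _ (fun _ => inl (inr 0%N))) => -[] [].
apply: (@grhom_iso _ _ _ _ _ _ _ (one_point_inv A)) => [a|m] /=.
  by rewrite single_fun_eq.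
apply: finfamP => -[[] []]; exact: single_fun_eq.
Qed.

Lemma smat_map_corner A B (f : grhom A B) a :
  smat_map X f (corner A a) = corner B (f a).
Proof. by rewrite !cornerE smat_map_unit. Qed.
End Corner.

(** * Two families over the Fock action *)

Section Families.
Variables (l : comStarRingType) (E : graph) (G : groupType) (om : edge E -> G).
Local Notation C := (cohn l om).
Local Notation X := (fock om).
Local Notation pt := (fock0 om).
Local Notation K A := (smat X A).
Local Notation D A := (semidirect (fock_action om A)).

Lemma act_row0 (A : grStarAlgType l G) (c : C) i j y (a : A) : fock_action om A c (smat_unit i j pt y a) = 0.
Proof.
have aD k := linD (act_linearl (fock_action om A) k).
have aZ k := linZ (act_linearl (fock_action om A) k).
elim/cohn_ind: c => [|b c IHb IHc|k c IH|b c IHb IHc|x].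
- exact: lin0 (act_linearl _ _).
- by rewrite aD IHb IHc addr0.
- by rewrite aZ IH scaler0.
- by rewrite (act_mul (fock_action _ _) (b : C)) IHc (lin0 (act_linearr _ _)).
- by rewrite fock_action_gen row_op_unit.
Qed.

Lemma ract_col0 (A : grStarAlgType l G) (c : C) i j x (a : A) : ract (fock_action om A) c (smat_unit i j x pt a) = 0.
Proof.
rewrite /ract smat_unit_star (linZ (act_linearr (fock_action om A) _)) act_row0.
by rewrite scaler0 star0.
Qed.

Lemma base_corner_orth (A B B' : grStarAlgType l G) (f : grhom B C) (g : grhom B' A) :
  orth (grhom_comp (sd_base (fock_action om A)) f)
       (grhom_comp (grhom_comp (sd_in (fock_action om A)) (corner om A)) g).
Proof.
have gE b : grhom_comp (grhom_comp (sd_in (fock_action om A)) (corner om A)) g b =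
    sd_in (fock_action om A) (smat_unit ord0 ord0 pt pt (g b)) by rewrite -cornerE.
split=> a b; rewrite gE grhom_compE sd_mulE; apply: sd_ext; rewrite /= ?nmul0l ?nmul0r //.
  by rewrite act_row0 ract0r !addr0.
by rewrite (lin0 (act_linearr (fock_action om A) _)) ract_col0 !addr0.
Qed.

Lemma base_cornerE (A B : grStarAlgType l G) (f : grhom B C) (g : grhom B A) b :
  orth_add (base_corner_orth f g) b = (f b, smat_unit ord0 ord0 pt pt (g b)) :> D A.
Proof.
by rewrite -cornerE orth_addE; apply: sd_ext; rewrite /= ?addr0 ?add0r.
Qed.

Lemma hmap_base_corner (T : tricat) (H : homology l G T) (A B : grStarAlgType l G)
    (f : grhom B C) (g : grhom B A) (s : grhom B (D A)) :
  s =1 orth_add (base_corner_orth f g) ->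
  hmap H s = hmap H (sd_base (fock_action om A)) \oc hmap H f
    + hmap H (sd_in (fock_action om A)) \oc hmap H (corner om A) \oc hmap H g.
Proof. by move=> /hmap_ext ->; rewrite hmap_orth_add !hmapM. Qed.

Section Coefficients.
Variables (A : grStarAlgType l G) (p : vert E -> A).
Hypothesis pM : forall v w, p v ** p w = if v == w then p v else 0.
Hypothesis p_star : forall v, star (p v) = p v.
Hypothesis p_gr : forall v, gr 1%g (p v).

Local Notation L := (fock_action om A).

(** Matrices in the column of the positive base point are the vectors that the
    homotopy moves; this one has norm [(-1) ^+ i *: (star a ** a)]. *)
Definition col0 (i : 'I_2) (x : X) (a : A) : K A := smat_unit i ord0 x pt a.

Definition fock_vert (v : vert E) : D A := (cohn_vert l om v, col0 ord0 pt (p v)).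

Lemma col0_starM i x a i' x' a' :
  star (col0 i x a) ** col0 i' x' a' =
  if (i == i') && (x == x') then (-1) ^+ i *: col0 ord0 pt (star a ** a') else 0.
Proof.
rewrite smat_unit_star addn0 nmulZl smat_unitM.
by case: ifP => // _; rewrite scaler0.
Qed.

Lemma fock_vertM v c (k : K A) : fock_vert v ** ((c, k) : D A) =
  (cohn_vert l om v ** c, L (cohn_vert l om v) k + col0 ord0 pt (p v) ** k).
Proof. by rewrite sd_mulE /= ract_col0 addr0. Qed.

Lemma fock_Mvert v c i x a : ((c, col0 i x a) : D A) ** fock_vert v =
  (c ** cohn_vert l om v, col0 i x (a ** p v)).
Proof. by rewrite sd_mulE /= act_row0 ract_col0 smat_unitM !eqxx !add0r. Qed.

Lemma vert_fock1 v i e a : L (cohn_vert l om v) (col0 i (fock1 om e) a) =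
  if src e == v then col0 i (fock1 om e) a else 0.
Proof.
rewrite [LHS](fock_action_gen (GVert v)) row_op_unit /=.
by case: ifP.
Qed.

Lemma fock_starM (c c' : C) (k k' : K A) : L (star c) k' = 0 -> L (star c') k = 0 ->
  star ((c, k) : D A) ** ((c', k') : D A) = (star c ** c', star k ** k').
Proof. by move=> e e'; rewrite sd_mulE /= e /ract starK e' star0 !add0r. Qed.

Lemma ghost_fock1 e i f a : L (star (cohn_edge l om e)) (col0 i (fock1 om f) a) = 0.
Proof.
rewrite [star _](cohn_gen_star l om (GEdge e)) fock_action_gen row_op_unit.
by [].
Qed.

Lemma fock_vert_projection :
  [/\ forall v w, fock_vert v ** fock_vert w = if v == w then fock_vert v else 0,
      forall v, star (fock_vert v) = fock_vert v & forall v, gr 1%g (fock_vert v)].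
Proof.
split=> [v w|v|v].
- rewrite fock_Mvert pM cohn_vertM; case: eqP => // _; apply: sd_ext => //=.
  exact: lin0 (smat_unit_linear _ _ _ _).
- rewrite sd_starE /= cohn_vert_star smat_unit_star p_star addn0 expr0 scale1r.
  by [].
- apply: sd_grE; first exact: cohn_vert_gr.
  have := smat_unit_gr (X := X) ord0 ord0 pt pt (p_gr v).
  by rewrite /= invg1 !mulg1.
Qed.

Lemma col0_gr i x g a : gr g a -> gr (gdeg x * g)%g (col0 i x a).
Proof. by move=> /(smat_unit_gr (X := X) i ord0 x pt); rewrite /= invg1 mulg1. Qed.

(** Prepending [e] with the base point included: the base point goes to the sequence
    [e]. *)
Definition fock_edge (e : edge E) : D A :=
  (cohn_edge l om e, col0 ord0 (fock1 om e) (p (rng e))).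

Lemma fock_family : cohn_family om fock_vert fock_edge.
Proof.
have [PM Ps Pg] := fock_vert_projection; have Cf := cohn_self_family l om.
split=> // [e|e|e f|e].
- rewrite fock_vertM vert_fock1 eqxx (cfSE Cf) smat_unitM /=.
  by rewrite addr0.
- by rewrite fock_Mvert pM eqxx (cfER Cf).
- rewrite fock_starM ?ghost_fock1 // (cfGE Cf) col0_starM p_star pM /=.
  have -> : (fock1 om e == fock1 om f) = (e == f).
    by apply/eqP/eqP => [[]|->].
  by case: eqP => [->|//]; rewrite eqxx scale1r.
- apply: sd_grE; first exact: (cf_grE Cf).
  by have := col0_gr ord0 (fock1 om e) (p_gr (rng e)); rewrite /= !mulg1.
Qed.
End Coefficients.

(** * The homotopy *)

Section Homotopy.
Local Notation Vx := (cohn_vert l om).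
Local Notation Ed := (cohn_edge l om).
Local Notation P := (fock_vert Vx).
Let Cf := cohn_self_family l om.

(** The images of the edges under the orthogonal sum of the base section and the
    corner inclusion. *)
Definition corner_edge (e : edge E) : D C := (Ed e, col0 ord0 pt (Ed e)).

Let fock1_eq e f : (fock1 om e == fock1 om f) = (e == f).
Proof. by apply/eqP/eqP => [[]|->]. Qed.
Let ghost_fock0 e i (a : C) : fock_action om C (star (Ed e)) (col0 i pt a) = 0.
Proof. exact: act_row0. Qed.

Let P_family : [/\ forall v w, P v ** P w = if v == w then P v else 0,
  forall v, star (P v) = P v & forall v, gr 1%g (P v)].
Proof. exact: (fock_vert_projection (cfVV Cf) (cf_star Cf) (cf_grV Cf)). Qed.

Lemma corner_family : cohn_family om P corner_edge.
Proof.
have [PM Ps Pg] := P_family.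
split=> // [e|e|e f|e].
- by rewrite fock_vertM act_row0 add0r smat_unitM !eqxx (cfSE Cf).
- by rewrite fock_Mvert (cfER Cf).
- rewrite fock_starM ?ghost_fock0 // col0_starM !eqxx (cfGE Cf) scale1r.
  by case: eqP => // _; apply: sd_ext => //; exact: lin0 (smat_unit_linear _ _ _ _).
- apply: sd_grE; first exact: (cf_grE Cf).
  by have := col0_gr ord0 pt (cf_grE Cf e); rewrite mul1g.
Qed.

Let dir (i : 'I_2) x (a : C) : D C := sd_in (fock_action om C) (col0 i x a).

Let P_dir0 e : P (src e) ** dir ord0 pt (Ed e) = dir ord0 pt (Ed e).
Proof. by rewrite fock_vertM act_row0 add0r nmul0r smat_unitM !eqxx (cfSE Cf). Qed.
Let P_dir1 i e : P (src e) ** dir i (fock1 om e) (Vx (rng e)) = dir i (fock1 om e) (Vx (rng e)).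
Proof. by rewrite fock_vertM vert_fock1 eqxx smat_unitM nmul0r andbF addr0. Qed.
Let dir_P i x e a : a ** Vx (rng e) = a -> dir i x a ** P (rng e) = dir i x a.
Proof. by move=> h; rewrite fock_Mvert nmul0l h. Qed.
Let dir_gr i x g a : gr g a -> gr (gdeg x * g)%g (dir i x a).
Proof. by move=> ga; apply: grhom_gr; exact: col0_gr. Qed.
Let VxR e : Vx (rng e) ** Vx (rng e) = Vx (rng e).
Proof. by rewrite (cfVV Cf) eqxx. Qed.

Let dirs_star i x a i' x' a' : star (dir i x a) ** dir i' x' a' =
  if (i == i') && (x == x') then (-1) ^+ i *: dir ord0 pt (star a ** a') else 0.
Proof.
rewrite -grhom_star -grhomM col0_starM; case: ifP => _.
  exact: linZ (grhom_linear _) _ _.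
exact: lin0 (grhom_linear _).
Qed.

Let edge_dir e (k k' : K C) : fock_action om C (star (Ed e)) k' = 0 ->
  star ((Ed e, k) : D C) ** sd_in (fock_action om C) k' =
  sd_in (fock_action om C) (star k ** k').
Proof.
move=> h; rewrite [LHS]fock_starM // ?nmul0r // star0.
exact: lin0 (act_linearl _ _).
Qed.

(** Both families are connected by a straight line to the same third family, whose
    edges are [e] at the base point plus the sequence [e] in both signs. *)
Lemma hmap_fock_corner (T : tricat) (H : homology l G T) :
  homotopy_invariant H ->
  hmap H (cohn_hom (fock_family (cfVV Cf) (cf_star Cf) (cf_grV Cf))) =
  hmap H (cohn_hom corner_family).
Proof.
move=> Hinv; set F0 := fock_family _ _ _.
pose neg e := dir ord_max (fock1 om e) (Vx (rng e)).
pose b0 e := dir ord0 pt (Ed e) + neg e.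
pose bc e := dir ord0 (fock1 om e) (Vx (rng e)) + neg e.
have neg_gr e : gr (om e) (neg e).
  by have := dir_gr ord_max (fock1 om e) (cf_grV Cf (rng e)); rewrite /= !mulg1.
have isotropic e f : star (neg e) ** neg f =
    - (if e == f then dir ord0 pt (Vx (rng e)) else 0).
  rewrite dirs_star eqxx fock1_eq expr1 scaleN1r (cf_star Cf) (cfVV Cf).
  by case: eqP => [->|]; rewrite ?eqxx ?oppr0.
have [E0 ->] : exists E0 : cohn_family om P (fun e => fock_edge Vx e + b0 e), 
    hmap H (cohn_hom F0) = hmap H (cohn_hom E0).
  apply: (hmap_family_shift F0 _ _ _ _ _ Hinv) => [e|e|e f|e f|e].
  - by rewrite nmulDr P_dir0 P_dir1.
  - by rewrite nmulDl !dir_P ?(cfER Cf) ?VxR.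
  - rewrite nmulDr !edge_dir ?ghost_fock0 ?ghost_fock1 // !col0_starM /=.
    exact: (addr0 (0 : D C)).
  - rewrite starD nmulDl !nmulDr isotropic !dirs_star eqxx expr0 scale1r (cfGE Cf) /=.
    rewrite addr0 add0r; case: eqP => _; rewrite ?subrr // subr0.
    by rewrite /dir [col0 _ _ _](lin0 (smat_unit_linear _ _ _ _)) (lin0 (grhom_linear _)).
  - apply: grD => //.
    by have := dir_gr ord0 pt (cf_grE Cf e); rewrite mul1g.
have [Ec ->] : exists Ec : cohn_family om P (fun e => corner_edge e + bc e),
    hmap H (cohn_hom corner_family) = hmap H (cohn_hom Ec).
  apply: (hmap_family_shift corner_family _ _ _ _ _ Hinv) => [e|e|e f|e f|e].
  - by rewrite nmulDr !P_dir1.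
  - by rewrite nmulDl !dir_P ?VxR.
  - rewrite nmulDr !edge_dir ?ghost_fock1 // !col0_starM /=.
    exact: (addr0 (0 : D C)).
  - rewrite starD nmulDl !nmulDr isotropic !dirs_star /= fock1_eq expr0 scale1r.
    rewrite addr0 add0r (cf_star Cf) (cfVV Cf); case: eqP => [->|_]; last by rewrite subrr.
    by rewrite eqxx subrr.
  - apply: grD => //.
    by have := dir_gr ord0 (fock1 om e) (cf_grV Cf (rng e)); rewrite /= !mulg1.
apply/hmap_ext/cohn_hom_ext => [v|e]; first by rewrite !cohn_hom_vert.
rewrite !cohn_hom_edge; apply: sd_ext => //=.
exact: addrCA.
Qed.
End Homotopy.
End Families.

(** * Functions on the vertices *)

Section Vertices.
Variables (l : comStarRingType) (E : graph) (G : groupType).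
Local Notation V := (fsfuns l G (vert E)).

Lemma chiM v w : chi l G v ** chi l G w = if v == w then chi l G v else 0 :> V.
Proof.
case: (eqVneq v w) => [<-|vw]; last first.
  apply: finfamP => u /=; case: (eqVneq v u) => [vu|vu].
    by rewrite [X in _ ** X]single_fun_ne ?nmul0r // -vu eq_sym.
  by rewrite [X in X ** _]single_fun_ne ?nmul0l.
rewrite -(@grhomM _ _ _ _ (dirsum_inj (fun _ : vert E => gscal l G) v)).
by congr (dirsum_inj _ _ _); exact: (mulr1 (1 : l)).
Qed.
Lemma chi_star v : star (chi l G v : V) = chi l G v.
Proof.
rewrite -(@grhom_star _ _ _ _ (dirsum_inj (fun _ : vert E => gscal l G) v)).
by congr (dirsum_inj _ _ _); exact: conjr1.
Qed.
Lemma chi_gr v : gr 1%g (chi l G v : V).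
Proof.
by apply: (@grhom_gr _ _ _ _ (dirsum_inj (fun _ : vert E => gscal l G) v)); left.
Qed.

Lemma fsfuns_hom_ext (D : grStarAlgType l G) (f h : grhom V D) :
  (forall v, f (chi l G v) = h (chi l G v)) -> f =1 h.
Proof.
move=> fh; apply: finfam_ind => [|a b IHa IHb|v a].
- by rewrite !(lin0 (grhom_linear _)).
- by rewrite !(linD (grhom_linear _)) IHa IHb.
have -> : single (M := fun _ : vert E => gscal l G : lmodType l) (i := v) a = (a : l) *: chi l G v.
  rewrite -[RHS](linZ (grhom_linear (dirsum_inj (fun _ : vert E => gscal l G) v))).
  by congr (single _); exact/esym/(mulr1 (a : l)).
by rewrite !(linZ (grhom_linear _)) fh.
Qed.

End Vertices.

(** * The inclusion of the vertices *)

Theorem proposition11p5 (l : comStarRingType) (lam : l) (G : groupType)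
    (E : graph) (om : edge E -> G) (T : tricat) (H : homology l G T) :
  lam + conjr lam = 1 ->
  homotopy_invariant H ->
  graph_stable H E ->
  additive_for H (vert E) ->
  is_iso (hmap H (cohn_phi l om)).
Proof.
move=> _ Hinv Hstab _.
pose C : grStarAlgType l G := cohn l om; pose V := fsfuns l G (vert E).
pose phi : grhom V C := cohn_phi l om.
pose L A := fock_action om A : action C _.
pose kappa (A : grStarAlgType l G) := corner om A.
have kappa_iso A : is_iso (hmap H (kappa A)) by exact: corner_iso.
pose Cf := cohn_self_family l om.
pose sV : grhom C (semidirect (L V)) :=
  cohn_hom (fock_family om (@chiM l E G) (@chi_star l E G) (@chi_gr l E G)).
pose sC : grhom C (semidirect (L C)) :=
  cohn_hom (fock_family om (cfVV Cf) (cf_star Cf) (cf_grV Cf)).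
pose tV := sd_base (L V); pose tC := sd_base (L C).
pose iV := sd_in (L V); pose iC := sd_in (L C).
have phi_chi v : phi (chi l G v) = cohn_vert l om v by exact: cohn_phi_chi.
have monoV := hmap_split_mono (H := H) (sd_ext_split (L V)) (s := tV) (fun _ => erefl).
have monoC := hmap_split_mono (H := H) (sd_ext_split (L C)) (s := tC) (fun _ => erefl).
have [theta thetaE] : exists theta, hmap H sV - hmap H tV = hmap H iV \oc theta.
  apply: (hmap_ext_kernel (sd_ext_split (L V))).
  apply/eqP; rewrite compBr -!hmapM subr_eq0; apply/eqP.
  apply/hmap_ext/cohn_hom_ext => [v|e]; rewrite !grhom_compE.
    by rewrite cohn_hom_vert.
  by rewrite cohn_hom_edge.
have theta_phi : theta \oc hmap H phi = hmap H (kappa V).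
  apply: monoV; rewrite compA -thetaE compBl -hmapM.
  rewrite (@hmap_base_corner l E G om T H V V phi (grhom_id V)) => [|].
    by rewrite hmap1 compm1 addrAC subrr add0r.
  apply: fsfuns_hom_ext => v; rewrite grhom_compE phi_chi cohn_hom_vert.
  by rewrite base_cornerE phi_chi.
pose psi := smat_map (fock om) phi.
have psi_equi c k : psi (L V c k) = L C c (psi k) by exact: smat_map_action.
have theta_kappa : hmap H psi \oc theta = hmap H (kappa C).
  apply: monoC.
  have mapI : hmap H iC \oc hmap H psi = hmap H (sd_map psi_equi) \oc hmap H iV.
    by rewrite -!hmapM; apply: hmap_ext.
  have mapT : hmap H (sd_map psi_equi) \oc hmap H tV = hmap H tC.
    rewrite -hmapM; apply: hmap_ext => c; rewrite grhom_compE.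
    by apply: sd_ext => //; exact: (lin0 (grhom_linear psi)).
  have mapS : hmap H (sd_map psi_equi) \oc hmap H sV = hmap H sC.
    rewrite -hmapM; apply/hmap_ext/cohn_hom_ext => [v|e]; rewrite grhom_compE.
      rewrite !cohn_hom_vert; apply: sd_ext => //.
      by rewrite [LHS]smat_map_unit phi_chi.
    rewrite !cohn_hom_edge; apply: sd_ext => //.
    by rewrite [LHS]smat_map_unit phi_chi.
  rewrite compA mapI -compA -thetaE compBr mapS mapT [hmap H sC](hmap_fock_corner om Hinv).
  rewrite (@hmap_base_corner l E G om T H C C (grhom_id C) (grhom_id C)) => [|].
    by rewrite !hmap1 !compm1 addrAC subrr add0r.
  apply: cohn_hom_ext => [v|e]; rewrite base_cornerE.
    by rewrite cohn_hom_vert.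
  by rewrite cohn_hom_edge.
have [k [kl kr]] := kappa_iso V.
exists (k \oc theta); split; first by rewrite -compA theta_phi.
apply: (iso_mono (kappa_iso C)); rewrite compm1 -[RHS]theta_kappa !compA -hmapM.
rewrite (@hmap_ext _ _ _ H _ _ (grhom_comp (kappa C) phi) (grhom_comp psi (kappa V))).
  by rewrite hmapM -(compA (hmap H psi)) kr compm1.
by move=> a; rewrite !grhom_compE; exact/esym/smat_map_corner.
Qed.
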